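(* Let $\Omega_D\subset\mathbb{R}^{m+1}_*$ be a bounded axially symmetric domain and $f\in C^1(\overline{\Omega_D})\cap\mathcal{S}(\Omega_D)$. Then $$G_{\boldsymbol{q}}T_{\Omega_D}f(\boldsymbol{q})=f(\boldsymbol{q})\quad\text{for all }\boldsymbol{q}\in\Omega_D.$$
   Context: $\mathcal{C}l_m$ is the real Clifford algebra generated by $\boldsymbol{e}_1,\ldots,\boldsymbol{e}_m$ with $\boldsymbol{e}_i\boldsymbol{e}_j+\boldsymbol{e}_j\boldsymbol{e}_i=-2\delta_{ij}$, with basis $e_A$, $A\subset\{1,\ldots,m\}$; Clifford conjugation is $\overline{\sum_A x_Ae_A}=\sum_A(-1)^{|A|(|A|+1)/2}x_Ae_A$. $\mathbb{R}^{m+1}$ is identified with the paravectors $\boldsymbol{x}=x_0+\underline{\boldsymbol{x}}$, $\underline{\boldsymbol{x}}=\sum_{k=1}^m x_k\boldsymbol{e}_k$, $\mathrm{Re}[\boldsymbol{x}]=x_0$; $\mathbb{R}^{m+1}_*=\mathbb{R}^{m+1}\setminus\mathbb{R}$. $\mathbb{S}=\{\underline{\boldsymbol{x}}: x_1^2+\cdots+x_m^2=1\}$, with area $\omega_{m-1}$. For $J\in\mathbb{S}$, $\Phi_J(u+iv)=u+Jv$. For $D\subset\mathbb{C}$ open and invariant under complex conjugation, $\Omega_D=\bigcup_{J\in\mathbb{S}}\Phi_J(D)\subset\mathbb{R}^{m+1}$; sets of this form are called axially symmetric. A stem function on $D$ is $F=F_1+iF_2:D\to\mathcal{C}l_m\otimes\mathbb{C}$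 with $F_1,F_2$ $\mathcal{C}l_m$-valued, $F_1(\bar z)=F_1(z)$, $F_2(\bar z)=-F_2(z)$. It induces the (left) slice function $f:\Omega_D\to\mathcal{C}l_m$, $f(u+Jv)=F_1(u+iv)+JF_2(u+iv)$ for $J\in\mathbb{S}$, $u+iv\in D$. $\mathcal{S}(\Omega_D)$ is the set of slice functions on $\Omega_D$. The slice Cauchy-Riemann operator in the variable $\boldsymbol{q}$ is $G_{\boldsymbol{q}}=\frac{\partial}{\partial q_0}+\frac{\underline{\boldsymbol{q}}}{|\underline{\boldsymbol{q}}|^2}\sum_{j=1}^m q_j\frac{\partial}{\partial q_j}$. The kernels are $S^{-1}(\boldsymbol{q},\boldsymbol{x})=-(\boldsymbol{q}^2-2\mathrm{Re}[\boldsymbol{x}]\boldsymbol{q}+|\boldsymbol{x}|^2)^{-1}(\boldsymbol{q}-\overline{\boldsymbol{x}})$ and $K(\boldsymbol{q},\boldsymbol{x})=\frac{2S^{-1}(\boldsymbol{q},\boldsymbol{x})}{\omega_{m-1}|\underline{\boldsymbol{x}}|^{m-1}}$. The Teodorescu transform is $T_{\Omega_D}f(\boldsymbol{q})=-\frac{1}{2\pi}\int_{\Omega_D}K(\boldsymbol{q},\boldsymbol{x})f(\boldsymbol{x})\,dV(\boldsymbol{x})$, with $dV$ the volume element. *)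

(* Defs.v *)
From HB Require Import structures.
From mathcomp Require Import all_boot all_order all_algebra.
From mathcomp Require Import all_classical all_reals all_analysis.
From mathcomp Require Import complex.
Set Implicit Arguments.
Unset Strict Implicit.
Unset Printing Implicit Defensive.
Import Order.TTheory GRing.Theory Num.Theory.
Import numFieldNormedType.Exports.
Local Open Scope classical_set_scope.
Local Open Scope ring_scope.
Local Open Scope complex_scope.

Section SymmetricDifference.
Variable m : nat.
Implicit Types A B C : {set 'I_m}.

Definition symd A B : {set 'I_m} := [set i | (i \in A) (+) (i \in B)]%SET.

Lemma symdA : associative symd.
Proof. by move=> A B C; apply/setP => i; rewrite !inE addbA. Qed.

Lemma symdC : commutative symd.
Proof. by move=> A B; apply/setP => i; rewrite !inE addbC. Qed.

Lemma symd0s : left_id finset.set0 symd.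
Proof. by move=> A; apply/setP => i; rewrite !inE. Qed.

Lemma symdK A : cancel (symd A) (symd A).
Proof. by move=> B; apply/setP => i; rewrite !inE addbA addbb. Qed.

(* Moving the generators of B leftwards through those of A costs one sign for
   each pair i \in A, j \in B with j < i; each common index contributes another
   one, since e_i ^+ 2 = -1. *)
Definition clsign A B : bool :=
  odd (\sum_(i in A) \sum_(j in B) (j <= i)%N).

Lemma clsignE A B :
  clsign A B = \big[addb/false]_i \big[addb/false]_j
    [&& i \in A, j \in B & (j <= i)%N].
Proof.
rewrite /clsign (big_morph odd oddD (erefl _)) big_mkcond.
apply: eq_bigr => i _; case: ifP => [_|_] /=; last by rewrite big1.
rewrite (big_morph odd oddD (erefl _)) big_mkcond.
by apply: eq_bigr => j _; case: ifP => //= _; rewrite oddb.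
Qed.

Lemma clsignDl A B C : clsign (symd A B) C = clsign A C (+) clsign B C.
Proof.
rewrite !clsignE -big_split; apply: eq_bigr => i _ /=.
rewrite -big_split; apply: eq_bigr => j _ /=.
by rewrite inE; case: (i \in A); case: (i \in B); case: (j \in C); case: leq.
Qed.

Lemma clsignDr A B C : clsign A (symd B C) = clsign A B (+) clsign A C.
Proof.
rewrite !clsignE -big_split; apply: eq_bigr => i _ /=.
rewrite -big_split; apply: eq_bigr => j _ /=.
by rewrite inE; case: (i \in A); case: (j \in B); case: (j \in C); case: leq.
Qed.

Lemma clsign0s A : clsign finset.set0 A = false.
Proof. by rewrite /clsign big_set0. Qed.

Lemma clsigns0 A : clsign A finset.set0 = false.
Proof. by rewrite /clsign big1 // => i _; rewrite big_set0. Qed.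

End SymmetricDifference.

(* x : clifford R m stands for \sum_A x A *: e_A.  The type is an alias so as
   not to inherit the pointwise product of finite functions. *)
Definition clifford (R : realType) (m : nat) := {ffun {set 'I_m} -> R}.

HB.instance Definition _ (R : realType) (m : nat) :=
  GRing.Lmodule.on (clifford R m).

Section CliffordRing.
Variables (R : realType) (m : nat).
Implicit Types (x y z : clifford R m) (A B C : {set 'I_m}).

Definition cl_basis A : clifford R m := [ffun B => (B == A)%:R].

Definition cl_mul x y : clifford R m :=
  \sum_A \sum_B ((-1) ^+ clsign A B * (x A * y B)) *: cl_basis (symd A B).

Lemma cl_mulE x y C :
  cl_mul x y C = \sum_A (-1) ^+ clsign A (symd A C) * (x A * y (symd A C)).
Proof.
rewrite /cl_mul sum_ffunE; apply: eq_bigr => A _.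
rewrite sum_ffunE (bigD1 (symd A C)) //= !ffunE symdK eqxx /GRing.scale /=.
rewrite mulr1 big1 ?addr0 // => B neB; rewrite !ffunE.
by case: eqP => [eC|_]; [rewrite eC symdK eqxx in neB|rewrite /GRing.scale /= mulr0].
Qed.

Lemma cl_mulA : associative cl_mul.
Proof.
move=> x y z; apply/ffunP => D; rewrite !cl_mulE.
under eq_bigr => A _.
  rewrite cl_mulE 2!mulr_sumr.
  over.
under [RHS]eq_bigr => E _.
  rewrite cl_mulE mulr_suml mulr_sumr.
  over.
rewrite exchange_big [RHS]exchange_big /= exchange_big /=.
apply: eq_bigr => A _.
rewrite [RHS](reindex_inj (can_inj (symdK A))) /=.
apply: eq_bigr => B _.
have -> : symd (symd A B) D = symd B (symd A D).
  by rewrite symdA (symdC B).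
rewrite symdK.
set F := symd B (symd A D).
have -> : symd A D = symd B F by rewrite /F symdK.
rewrite clsignDl clsignDr !signr_addb.
rewrite -!mulrA (mulrCA (x A)).
by rewrite [in RHS](mulrCA ((-1) ^+ clsign B F)) [RHS]mulrCA.
Qed.

Lemma cl_mul1x : left_id (cl_basis finset.set0) cl_mul.
Proof.
move=> x; apply/ffunP => C; rewrite cl_mulE (bigD1 finset.set0) //= big1.
  by rewrite addr0 symd0s clsign0s ffunE eqxx !mul1r.
by move=> A A0; rewrite ffunE (negbTE A0) mul0r mulr0.
Qed.

Lemma cl_mulx1 : right_id (cl_basis finset.set0) cl_mul.
Proof.
have sAA A : symd A A = finset.set0 by apply/setP => i; rewrite !inE addbb.
move=> x; apply/ffunP => C; rewrite cl_mulE (bigD1 C) //= big1.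
  by rewrite addr0 sAA clsigns0 ffunE eqxx mulr1 mul1r.
move=> A AC; rewrite [X in _ * (_ * X)]ffunE.
case: eqP => [eA|_]; last by rewrite !mulr0.
by rewrite -(symdK A C) eA symdC symd0s eqxx in AC.
Qed.

Lemma cl_mulDl : left_distributive cl_mul +%R.
Proof.
move=> x y z; apply/ffunP => C; rewrite [RHS]ffunE !cl_mulE -big_split.
by apply: eq_bigr => A _ /=; rewrite ffunE mulrDl mulrDr.
Qed.

Lemma cl_mulDr : right_distributive cl_mul +%R.
Proof.
move=> x y z; apply/ffunP => C; rewrite [RHS]ffunE !cl_mulE -big_split.
by apply: eq_bigr => A _ /=; rewrite ffunE !mulrDr.
Qed.

Lemma cl_oner_neq0 : cl_basis finset.set0 != 0.
Proof.
apply/eqP => /ffunP /(_ finset.set0) /eqP.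
by rewrite !ffunE eqxx oner_eq0.
Qed.

HB.instance Definition _ := GRing.Zmodule_isNzRing.Build (clifford R m)
  cl_mulA cl_mul1x cl_mulx1 cl_mulDl cl_mulDr cl_oner_neq0.

Lemma cl_scalerAl (a : R) x y : a *: (x * y) = (a *: x) * y.
Proof.
apply/ffunP => C; rewrite ffunE !cl_mulE scaler_sumr.
by apply: eq_bigr => A _; rewrite ffunE /GRing.scale /= -mulrA mulrCA.
Qed.

HB.instance Definition _ :=
  GRing.Lmodule_isLalgebra.Build R (clifford R m) cl_scalerAl.

Lemma cl_scalerAr (a : R) x y : a *: (x * y) = x * (a *: y).
Proof.
apply/ffunP => C; rewrite ffunE !cl_mulE scaler_sumr.
apply: eq_bigr => A _; rewrite [in RHS]ffunE /GRing.scale /=.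
by rewrite [in RHS](mulrCA (x A)) [RHS]mulrCA.
Qed.

HB.instance Definition _ :=
  GRing.Lalgebra_isAlgebra.Build R (clifford R m) cl_scalerAr.

Definition cl_unit : pred (clifford R m) :=
  fun x => `[< exists y, y * x = 1 /\ x * y = 1 >].

Definition cl_inv x : clifford R m := xget x [set y | y * x = 1 /\ x * y = 1].

Lemma cl_invP x : cl_unit x -> cl_inv x * x = 1 /\ x * cl_inv x = 1.
Proof. by move=> /asboolP; exact: xgetPex. Qed.

Lemma cl_mulVx : {in cl_unit, left_inverse 1 cl_inv *%R}.
Proof. by move=> x /cl_invP[]. Qed.

Lemma cl_mulxV : {in cl_unit, right_inverse 1 cl_inv *%R}.
Proof. by move=> x /cl_invP[]. Qed.

Lemma cl_unitP x y : y * x = 1 /\ x * y = 1 -> cl_unit x.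
Proof. by move=> xy; apply/asboolP; exists y. Qed.

Lemma cl_inv_out : {in [predC cl_unit], cl_inv =1 id}.
Proof.
move=> x /asboolPn nx; apply: xgetPN => y xy.
by apply: nx; exists y.
Qed.

HB.instance Definition _ := GRing.NzRing_hasMulInverse.Build (clifford R m)
  cl_mulVx cl_mulxV cl_unitP cl_inv_out.

Definition cl_gen (i : 'I_m) : clifford R m := cl_basis (finset.set1 i).

Lemma cl_basisM A B :
  cl_basis A * cl_basis B = (-1) ^+ clsign A B *: cl_basis (symd A B).
Proof.
rewrite [LHS]/(cl_mul _ _) /cl_mul (bigD1 A) //= [X in _ + X]big1 ?addr0.
  rewrite (bigD1 B) //= big1 ?addr0; first by rewrite !ffunE !eqxx !mulr1.
  by move=> C CB; rewrite !ffunE (negbTE CB) !mulr0 scale0r.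
move=> C CA; rewrite big1 // => D _.
by rewrite ffunE (negbTE CA) mul0r mulr0 scale0r.
Qed.

Lemma cl_genM (i j : 'I_m) :
  cl_gen i * cl_gen j + cl_gen j * cl_gen i = (- 2 * (i == j)%:R)%:A.
Proof.
rewrite /cl_gen !cl_basisM (symdC (finset.set1 j)) /clsign !big_set1 !oddb.
have [->|ij] := eqVneq i j.
  have -> : symd (finset.set1 j) (finset.set1 j) = finset.set0.
    by apply/setP => k; rewrite !inE addbb.
  by rewrite leqnn -scalerDl mulr1 expr1 -opprD.
rewrite mulr0 scale0r -scalerDl leq_eqVlt (leq_eqVlt i).
rewrite (inj_eq val_inj) (inj_eq val_inj) eq_sym (negbTE ij) /=.
by case: ltngtP ij => [||/val_inj ->]; rewrite ?eqxx ?addNr ?subrr ?scale0r.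
Qed.

Lemma cl_basis_prod A : cl_basis A = \prod_(i <- enum A) cl_gen i.
Proof.
have pathE s : pairwise ltn (map val s) ->
    \prod_(i <- s) cl_gen i = cl_basis [set i in s]%SET.
  elim: s => [_|i s IHs].
    rewrite big_nil -[1]/(cl_basis finset.set0).
    by congr cl_basis; apply/setP => i; rewrite !inE.
  rewrite map_cons pairwise_cons big_cons => /andP[/allP ltis /IHs ->].
  have lti j : j \in s -> (i < j)%N by move=> js; apply/ltis/map_f.
  rewrite cl_basisM /clsign big_set1 big1 ?scale1r.
    congr cl_basis; apply/setP => j; rewrite !inE.
    by have [->|//] := eqVneq j i; case: (boolP (i \in s)) => // /lti; rewrite ltnn.
  by move=> j; rewrite inE => /lti; rewrite ltnNge => /negbTE ->.
rewrite pathE; first by congr cl_basis; apply/setP => i; rewrite inE mem_enum.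
have -> : enum A = [seq i <- enum 'I_m | i \in A] by rewrite [in RHS]enumT.
rewrite pairwise_map; apply: pairwise_filter.
rewrite -[pairwise _ _]pairwise_map val_enum_ord -sorted_pairwise.
  exact: iota_ltn_sorted.
exact: ltn_trans.
Qed.

Lemma cl_basis_sum x : x = \sum_A x A *: cl_basis A.
Proof.
apply/ffunP => B; rewrite sum_ffunE (bigD1 B) //= !ffunE eqxx big1 ?addr0.
  by rewrite /GRing.scale /= mulr1.
by move=> A AB; rewrite !ffunE eq_sym (negbTE AB) /GRing.scale /= mulr0.
Qed.

Definition cl_conj x : clifford R m :=
  [ffun A : {set 'I_m} => (-1) ^+ ((#|A| * #|A|.+1) %/ 2) * x A].

End CliffordRing.

Section LebesgueMeasure.
Variable R : realType.

Definition tuple_cons n (p : n.-tuple (measurableTypeR R) * measurableTypeR R) :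
  n.+1.-tuple (measurableTypeR R) := [the n.+1.-tuple _ of p.2 :: p.1].

Lemma measurable_tuple_cons n : measurable_fun [set: _] (@tuple_cons n).
Proof.
by apply: measurable_cons; [exact: measurable_snd|exact: measurable_fst].
Qed.

(* The one-dimensional factor is on the right, because \x asks only its right
   factor to be sigma-finite; it contributes the first coordinate. *)
Definition lebesgue_cons n
    (mu : {measure set (n.-tuple (measurableTypeR R)) -> \bar R}) :
    set (n.+1.-tuple (measurableTypeR R)) -> \bar R :=
  pushforward (mu \x lebesgue_measure)%E (@tuple_cons n).

Section LebesgueCons.
Variables (n : nat).
Variable mu : {measure set (n.-tuple (measurableTypeR R)) -> \bar R}.

Let lebesgue_cons0 : lebesgue_cons mu set0 = 0%E.
Proof. by rewrite /lebesgue_cons /pushforward preimage_set0 measure0. Qed.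

Let lebesgue_cons_ge0 A : (0 <= lebesgue_cons mu A)%E.
Proof.
by rewrite /lebesgue_cons; apply: measure_ge0; exact: measurable_tuple_cons.
Qed.

Let lebesgue_cons_sigma_additive : semi_sigma_additive (lebesgue_cons mu).
Proof.
rewrite /lebesgue_cons; apply: measure_semi_sigma_additive.
exact: measurable_tuple_cons.
Qed.

HB.instance Definition _ := isMeasure.Build _ _ _ (lebesgue_cons mu)
  lebesgue_cons0 lebesgue_cons_ge0 lebesgue_cons_sigma_additive.

End LebesgueCons.

Fixpoint lebesgue_tuple n :
    {measure set (n.-tuple (measurableTypeR R)) -> \bar R} :=
  if n is n'.+1 then
    [the {measure set _ -> \bar R} of lebesgue_cons (lebesgue_tuple n')]
  else [the {measure set _ -> \bar R} of \d_([tuple] : 0.-tuple _)].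

End LebesgueMeasure.

Section VolumeIntegral.
Variables (R : realType) (n : nat).

Definition row_of_tuple (t : n.-tuple (measurableTypeR R)) : 'rV[R]_n :=
  \row_i tnth t i.

Definition volume (A : set 'rV[R]_n) : \bar R :=
  lebesgue_tuple R n (row_of_tuple @^-1` A).

Definition volume_integrable (A : set 'rV[R]_n) (g : 'rV[R]_n -> R) : Prop :=
  (lebesgue_tuple R n).-integrable (row_of_tuple @^-1` A)
    (fun t => (g (row_of_tuple t))%:E).

Definition volume_integral (A : set 'rV[R]_n) (g : 'rV[R]_n -> R) : R :=
  \int[lebesgue_tuple R n]_(t in row_of_tuple @^-1` A) g (row_of_tuple t).

(* Euclidean norm: `|x| on row vectors is the sup norm. *)
Definition enorm (x : 'rV[R]_n) : R := Num.sqrt (\sum_i x 0 i ^+ 2).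

Definition usphere : set 'rV[R]_n := [set J | \sum_i J 0 i ^+ 2 = 1].

(* Surface measure of A `<=` usphere: n times the volume of the cone over A. *)
Definition surface_area (A : set 'rV[R]_n) : R :=
  n%:R * fine (volume [set r *: J | r in `[0, 1]%classic & J in A]).

End VolumeIntegral.

Section SliceAnalysis.
Variables (R : realType) (m : nat).
Local Notation Cl := (clifford R m).
Implicit Types (x q : 'rV[R]_m.+1) (f g : 'rV[R]_m.+1 -> Cl).
Implicit Types (D : set R[i]) (W : set 'rV[R]_m.+1).

Definition sc x : R := x 0 ord0.
Definition vec x : 'rV[R]_m := \row_k x 0 (lift ord0 k).

Definition cl_vec (v : 'rV[R]_m) : Cl := \sum_k v 0 k *: cl_gen R k.
Definition para x : Cl := (sc x)%:A + cl_vec (vec x).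

Definition off_axis : set 'rV[R]_m.+1 := [set x | vec x != 0].

Definition slice_point (J : 'rV[R]_m) (z : R[i]) : 'rV[R]_m.+1 :=
  let: u +i* v := z in row_mx u%:M (v *: J).

Lemma para_slice_point (J : 'rV[R]_m) (u v : R) :
  para (slice_point J (u +i* v)) = u%:A + v *: cl_vec J.
Proof.
have sE : sc (slice_point J (u +i* v)) = u.
  transitivity ((u%:M : 'M[R]_1) 0 0); last by rewrite mxE mulr1n.
  rewrite -(row_mxEl u%:M (v *: J)) /sc /slice_point.
  by congr (row_mx _ _ _ _); exact/val_inj.
have vE : vec (slice_point J (u +i* v)) = v *: J.
  apply/rowP => k; rewrite mxE -(row_mxEr u%:M (v *: J)).
  by congr (row_mx _ _ _ _); exact/val_inj.
rewrite /para sE vE /cl_vec scaler_sumr; congr (_ + _).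
by apply: eq_bigr => k _; rewrite mxE scalerA.
Qed.

Definition conj_invariant D : Prop := forall z, D z -> D z^*.

Definition axial D : set 'rV[R]_m.+1 :=
  \bigcup_(J in @usphere R m) (slice_point J @` D).

(* F z = (F_1(z), F_2(z)) encodes F_1 + i F_2, with values in Cl \otimes C. *)
Definition stem D (F : R[i] -> Cl * Cl) : Prop :=
  forall z, D z -> (F z^*).1 = (F z).1 /\ (F z^*).2 = - (F z).2.

Definition slice_function D f : Prop :=
  exists2 F, stem D F & forall J z, usphere J -> D z ->
    f (slice_point J z) = (F z).1 + cl_vec J * (F z).2.

Definition has_partials f q : Prop :=
  forall j A, derivable (fun x => f x A) q (delta_mx 0 j).

Definition partial (j : 'I_m.+1) f q : Cl :=
  [ffun A => 'D_(delta_mx 0 j) (fun x => f x A) q].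

(* For W open: f is C^1 on W, and f and its first order partial derivatives
   extend continuously to the closure (for f, the values on the boundary are
   those of the extension). *)
Definition C1_closure W f : Prop :=
  [/\ forall A, {within closure W, continuous (fun x => f x A)},
      forall q, W q -> has_partials f q &
      forall j A, exists2 h : 'rV[R]_m.+1 -> R,
        {within closure W, continuous h} &
        forall q, W q -> h q = partial j f q A].

Definition slice_CR f q : Cl :=
  partial ord0 f q +
  ((enorm (vec q) ^+ 2)^-1 *: cl_vec (vec q)) *
    \sum_(j < m) vec q 0 j *: partial (lift ord0 j) f q.

(* Off units, x^-1 = x: this happens on the null set of x where
   q ^+ 2 - 2 Re[x] q + |x| ^+ 2 = 0. *)
Definition slice_cauchy_kernel q x : Cl :=
  - ((para q ^+ 2 - (2 * sc x) *: para q + (enorm x ^+ 2)%:A)^-1 *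
     (para q - cl_conj (para x))).

Definition teodorescu_kernel q x : Cl :=
  (2 / (surface_area (@usphere R m) * enorm (vec x) ^+ m.-1)) *:
    slice_cauchy_kernel q x.

Definition cl_integrable W g : Prop :=
  forall A, volume_integrable W (fun x => g x A).

Definition cl_integral W g : Cl := [ffun A => volume_integral W (fun x => g x A)].

Definition teodorescu W f q : Cl :=
  - (2 * pi)^-1 *: cl_integral W (fun x => teodorescu_kernel q x * f x).

End SliceAnalysis.

Arguments axial {R} m D.

(* Main.v *)
Require Import Defs.
From HB Require Import structures.
From mathcomp Require Import all_boot all_order all_algebra.
From mathcomp Require Import all_classical all_reals all_analysis.
From mathcomp Require Import complex measurable_realfun ring lra.
Set Implicit Arguments.
Unset Strict Implicit.
Unset Printing Implicit Defensive.
Import Order.TTheory GRing.Theory Num.Theory.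
Import numFieldNormedType.Exports.
Local Open Scope classical_set_scope.
Local Open Scope ring_scope.

(** Fix q off the real axis, let a be its scalar part, b the length and I the
direction of its vector part; likewise let u, v and J belong to the integration
point x.  Write f x = F1 + J F2 with F1 even and F2 odd in v, extended by zero.

The transform is a planar potential.  The kernel at (q, x) is an affine function
of J whose coefficients lie in the span of 1 and I and depend on (v, u) only
([slice_cauchy_kernelE]).  Averaging the integrand over J and - J, which does not
change the volume integral, removes its odd part and leaves a function of (v, u)
([slice_symmetrize], [axial_integrand_flip]).  The factor v^(1 - m) of the kernel
cancels the area of the spheres of radius v ([axial_weight_density]), so what remains
is an integral over the plane with respect to du dv ([ge0_integral_axial],
[integral_axial]).  In partial fractions every coefficient has the poles b and - b,
and the parities of F1 and F2 merge the two contributions into one pole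
([coef_integral]).  The outcome, [teodorescuE], is that T f (q) = U + I V, where

   U + I V = 1/(2 pi) \int (z_q - z)^-1 (F1 + I F2)(z) dz

is the classical Cauchy transform over the slice through q: z = u + I v,
z_q = a + I b, and dz stands for du dv.

The slice operator is the planar one.  On functions of the form U + I V it acts
as the Cauchy-Riemann operator in (a, b) with I as imaginary unit, because the
direction I does not change along rays ([slice_CR_slice]).  The claim is thereby
reduced to the fact that the Cauchy transform is a right inverse of the
Cauchy-Riemann operator.

The planar statement, [pot_derive].  The density is only known to be bounded, to
have bounded support and to be Lipschitz at the point q under consideration.
Subtract its value at q times the indicator of a square centred at q.  The
difference vanishes at q to first order, hence cancels one pole, and the resolvent
identity 1/w' - 1/w = - (w' - w)/(w w') turns the difference quotients of its
potential into potentials of bounded densities, which are continuous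
([pot_quotient], [pot_continuous]).  The derivatives so obtained satisfy the
homogeneous Cauchy-Riemann equations.  For the square Fubini and the
arctangent give explicit derivatives pi, 0, 0, pi ([is_derive_window],
[pot_re_square_dx], [pot_im_square_dy], [pot_re_square_eq0],
[pot_im_square_eq0]), which add up to 2 pi times the value of the density.

Regularity of f enters through F1 and F2, which are recovered from the restriction
of f to a single slice ([slice_stemE]): continuity on the compact closure gives
boundedness, and the bounded partial derivatives give the Lipschitz estimate by the
mean value theorem ([slice_restriction_lipschitz]). *)

(** * Affine maps of the line and scaling of tuples *)

Section AffineChange.
Context {R : realType}.
Implicit Types (c d : R) (A : set R).

Lemma measurable_affine c d :
  measurable_fun [set: R] (fun x : measurableTypeR R => c * x + d : measurableTypeR R).
Proof.
by apply: measurable_funD => //; apply: measurable_funM.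
Qed.

Lemma lebesgue_measure_affine c d A : c != 0 -> measurable A ->
  lebesgue_measure ((fun x => c * x + d) @^-1` A) =
  ((`|c|^-1)%:E * lebesgue_measure A)%E.
Proof.
move=> c0 mA; pose g : measurableTypeR R -> measurableTypeR R := fun x => c * x + d.
have mg : measurable_fun setT g by exact: measurable_affine.
pose k := NngNum (normr_ge0 c).
pose nu0 : {measure set (measurableTypeR R) -> \bar R} :=
  mscale k (pushforward lebesgue_measure g).
pose nu := nu0 mg.
have nuE : forall X, measurable X -> lebesgue_measure X = nu X.
  apply: lebesgue_measure_unique => _ [[a b]] _ <- /=.
  rewrite /mscale/= /pushforward.
  have [c_gt0|c_lt0] : c > 0 \/ c < 0.
    by move: c0; rewrite neq_lt => /orP[|]; [right|left].
  - have -> : g @^-1` `]a, b] = `](a - d) / c, (b - d) / c]%classic.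
      apply/seteqP; split => x /=; rewrite !in_itv/= /g;
        by rewrite ltr_pdivrMr// ler_pdivlMr// (mulrC x) ltrBlDr lerBrDr.
    rewrite !lebesgue_measure_itv/= !lte_fin ltr_pM2r ?invr_gt0//.
    rewrite ltrD2r; case: ifPn => ab; last by rewrite mule0.
    rewrite -EFinB -EFinM gtr0_norm//; congr (_%:E).
    by field.
  - have -> : g @^-1` `]a, b] = `[(b - d) / c, (a - d) / c[%classic.
      apply/seteqP; split => x /=; rewrite !in_itv/= /g;
        by rewrite ler_ndivrMr// ltr_ndivlMr// (mulrC x) lerBrDr ltrBlDr andbC.
    rewrite !lebesgue_measure_itv/= !lte_fin ltr_nM2r ?invr_lt0//.
    rewrite ltrD2r; case: ifPn => ab; last by rewrite mule0.
    rewrite -EFinB -EFinM ltr0_norm//; congr (_%:E).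
    by field.
rewrite [in RHS]nuE//= /mscale /pushforward/= muleA -EFinM mulVf ?mul1e//.
by rewrite normr_eq0.
Qed.

Lemma ge0_integral_affine c d (f : R -> \bar R) : c != 0 ->
  measurable_fun [set: measurableTypeR R] f -> (forall x, 0 <= f x)%E ->
  (\int[lebesgue_measure]_x f (c * x + d)%R =
   (`|c|^-1)%:E * \int[lebesgue_measure]_x f x)%E.
Proof.
move=> c0 mf f0.
pose g : measurableTypeR R -> measurableTypeR R := fun x => c * x + d.
have mg : measurable_fun setT g by exact: measurable_affine.
have /= := ge0_integral_pushforward mg lebesgue_measure measurableT mf
  (fun x _ => f0 x).
rewrite preimage_setT => <-.
have ic0 : 0 <= `|c|^-1 by rewrite invr_ge0.
rewrite -(ge0_integral_mscale lebesgue_measure measurableT (NngNum ic0) mf)//.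
apply: eq_measure_integral => A mA _.
by rewrite /mscale/=; exact: lebesgue_measure_affine.
Qed.

(** An isometry leaves the integrals of the positive and the negative part unchanged;
    c = - 1 serves the parity arguments. *)
Lemma integral_isometry c d (f : R -> \bar R) : `|c| = 1 ->
  measurable_fun [set: measurableTypeR R] f ->
  (\int[lebesgue_measure]_x f (c * x + d)%R = \int[lebesgue_measure]_x f x)%E.
Proof.
move=> c1 mf; rewrite integralE [in RHS]integralE.
have c0 : c != 0 by rewrite -normr_eq0 c1 oner_neq0.
congr (_ - _)%E.
- have := @ge0_integral_affine c d (f^\+)%E c0 (measurable_funepos mf).
  rewrite c1 invr1 mul1e => <-; last by move=> x; exact: funepos_ge0.
  by apply: eq_integral => x _; rewrite !funeposE.
- have := @ge0_integral_affine c d (f^\-)%E c0 (measurable_funeneg mf).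
  rewrite c1 invr1 mul1e => <-; last by move=> x; exact: funeneg_ge0.
  by apply: eq_integral => x _; rewrite !funenegE.
Qed.

End AffineChange.

Section Scaling.
Context {R : realType}.
Local Notation tupleR n := (n.-tuple (measurableTypeR R)).

Definition scale_tuple n (c : R) (t : tupleR n) : tupleR n :=
  map_tuple (fun x : measurableTypeR R => c * x) t.

Lemma measurable_scale_tuple n c : measurable_fun setT (@scale_tuple n c).
Proof.
apply/measurable_fun_tnthP => i.
rewrite (_ : _ \o _ = (fun t : tupleR n => c * tnth t i : measurableTypeR R)).
  by apply: measurable_funM => //; exact: measurable_tnth.
by apply/funext => t /=; rewrite tnth_map.
Qed.

Lemma lebesgue_tupleS n (A : set (tupleR n.+1)) :
  lebesgue_tuple R n.+1 A =
  (\int[lebesgue_tuple R n]_y lebesgue_measure [set x | A (tuple_cons (y, x))])%E.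
Proof.
rewrite /= /lebesgue_cons /pushforward /= /product_measure1.
apply: eq_integral => y _ /=; congr lebesgue_measure.
by apply/seteqP; split => x; rewrite /xsection/= inE.
Qed.

Lemma measurable_tuple_section n (A : set (tupleR n.+1)) y : measurable A ->
  measurable [set x | A (tuple_cons (y, x))].
Proof.
move=> mA.
rewrite (_ : [set _ | _] = xsection (@tuple_cons R n @^-1` A) y).
  by apply: measurable_xsection; rewrite -[X in measurable X]setTI;
    exact: measurable_tuple_cons.
by apply/seteqP; split => x; rewrite /xsection/= inE.
Qed.

Lemma measurable_fun_tuple_section n (A : set (tupleR n.+1)) : measurable A ->
  measurable_fun setT
    (fun y => lebesgue_measure [set x : measurableTypeR R | A (tuple_cons (y, x))]).
Proof.
move=> mA; rewrite (_ : (fun _ => _) =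
    lebesgue_measure \o xsection (@tuple_cons R n @^-1` A)).
  apply: measurable_fun_xsection; rewrite -[X in measurable X]setTI.
  exact: measurable_tuple_cons.
apply/funext => y /=; congr lebesgue_measure.
by apply/seteqP; split => x; rewrite /xsection/= inE.
Qed.

(** Induction on the dimension: each coordinate contributes one factor by Fubini. *)
Lemma lebesgue_tuple_scale n (c : R) (A : set (tupleR n)) : c != 0 ->
  measurable A ->
  lebesgue_tuple R n (@scale_tuple n c @^-1` A) =
  ((`|c| ^- n)%:E * lebesgue_tuple R n A)%E.
Proof.
move=> c0; elim: n A => [|n IH] A mA.
  rewrite /= expr0 invr1 mul1e; congr dirac; apply/seteqP.
  by split => t /=; rewrite (tuple0 t) (tuple0 (scale_tuple _ _)).
rewrite !lebesgue_tupleS.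
have sE y x : scale_tuple c (tuple_cons (y, x)) = tuple_cons (scale_tuple c y, c * x).
  exact/val_inj.
under eq_integral => y _.
  rewrite (_ : [set _ | _] = (fun x => c * x + 0) @^-1`
      [set x | A (tuple_cons (scale_tuple c y, x))]); last first.
    by apply/seteqP; split => x /=; rewrite sE addr0.
  rewrite lebesgue_measure_affine//; last exact: measurable_tuple_section.
  over.
have ic0 : (0 <= (`|c|^-1)%:E)%E by rewrite lee_fin invr_ge0.
pose phi y := lebesgue_measure [set x : measurableTypeR R | A (tuple_cons (y, x))].
have mphi : measurable_fun setT phi by exact: measurable_fun_tuple_section.
have phi0 y : (0 <= phi y)%E by [].
rewrite ge0_integralZl//; last first.
  exact: (measurableT_comp mphi (measurable_scale_tuple _)).
have /= := ge0_integral_pushforward (measurable_scale_tuple c)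
  (lebesgue_tuple R n) measurableT mphi (fun x _ => phi0 x).
rewrite preimage_setT => <-.
have icn : 0 <= `|c| ^- n by rewrite invr_ge0 exprn_ge0.
rewrite exprS invfM EFinM -muleA; congr (_ * _)%E.
rewrite -(ge0_integral_mscale _ measurableT (NngNum icn) mphi)//.
apply: eq_measure_integral => [|mf B mB _]; first exact: measurable_scale_tuple.
by rewrite /mscale/=; exact: IH.
Qed.

End Scaling.

(** * Integrals of radial functions *)

Section Radial.
Context {R : realType}.
Local Notation lam := (@lebesgue_measure R).
Local Notation RT := (measurableTypeR R).

Lemma ge0_integral_mrestr d (T : measurableType d) (mu : {measure set T -> \bar R})
    (D : set T) (mD : measurable D) (f : T -> \bar R) :
  measurable_fun setT f -> (forall x, 0 <= f x)%E ->
  (\int[mrestr mu mD]_x f x = \int[mu]_(x in D) f x)%E.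
Proof.
move=> mf f0.
rewrite -(setUv D) ge0_integral_setU//=; last 3 first.
- exact: measurableC.
- exact: measurable_funTS.
- exact/disj_setPCl.
rewrite [X in (_ + X)%E](_ : _ = 0%E) ?adde0.
  apply: eq_measure_integral => A mA AD /=.
  by rewrite /mrestr setIidl.
have m0 : mrestr mu mD (~` D) = 0%E by rewrite /mrestr setICl measure0.
by apply: null_set_integral => //; [exact: measurableC|exact: measurable_funTS].
Qed.

Lemma measurable_subgraph (w : R -> R) : measurable_fun setT (w : RT -> RT) ->
  measurable [set p : RT * RT | 0 < p.2 < w p.1].
Proof.
move=> mw.
have m1 : measurable_fun setT (fun p : RT * RT => (0 : R) < p.2).
  by apply: measurable_fun_ltr; [exact: measurable_cst|exact: measurable_snd].
have m2 : measurable_fun setT (fun p : RT * RT => (p.2 : R) < w p.1).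
  apply: measurable_fun_ltr; first exact: measurable_snd.
  exact: (measurableT_comp mw measurable_fst).
rewrite (_ : [set _ | _] = ([set: RT * RT] `&` (fun p => 0 < p.2) @^-1` [set true]) `&`
    ([set: RT * RT] `&` (fun p => (p.2 : R) < w p.1) @^-1` [set true])).
  by apply: measurableI; [exact: m1|exact: m2].
rewrite !setTI.
by apply/seteqP; split => p /=; [move=> /andP[]|move=> [-> ->]].
Qed.

(** The image under h of the measure of density w, realised as plane Lebesgue measure
    on the subgraph of w: integrals against it are then a case of Tonelli. *)
Definition density_measure (w : R -> R) (mw : measurable_fun setT (w : RT -> RT))
  (h : RT -> RT) := pushforward (mrestr (lam \x lam)%E (measurable_subgraph mw)) (h \o fst).

Lemma ge0_integral_density (w : R -> R) (mw : measurable_fun setT (w : RT -> RT))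
    (h : RT -> RT) (mh : measurable_fun setT h) (G : R -> \bar R) :
  measurable_fun setT (G : RT -> \bar R) -> (forall x, 0 <= G x)%E ->
  (forall x, 0 <= w x) ->
  (\int[density_measure mw h]_v G v = \int[lam]_v ((w v)%:E * G (h v)))%E.
Proof.
move=> mG G0 w0.
have mhf : measurable_fun [set: RT * RT] (h \o fst).
  exact: (measurableT_comp mh measurable_fst).
have mGh : measurable_fun setT (G \o h) by exact: measurableT_comp.
rewrite /density_measure.
have /= := ge0_integral_pushforward mhf
  (mrestr (lam \x lam)%E (measurable_subgraph mw)) measurableT mG (fun x _ => G0 x).
rewrite preimage_setT => ->.
rewrite ge0_integral_mrestr//; last exact: (measurableT_comp mG mhf).
rewrite integral_mkcond fubini_tonelli1; last 2 first.
- have [+ _] := measurable_restrictT (G \o h \o fst) (measurable_subgraph mw); apply.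
  by apply: measurable_funTS; exact: (measurableT_comp mG mhf).
- by move=> p; rewrite patchE; case: ifP.
apply: eq_integral => v _; rewrite /fubini_F/=.
rewrite (_ : (fun y => _) = (fun=> G (h v)) \_ `]0, w v[%classic); last first.
  apply/funext => s; rewrite !patchE; congr (if _ then _ else _).
rewrite -integral_mkcond integral_cst//= lebesgue_measure_itv/= lte_fin.
by rewrite muleC; case: ltgtP (w0 v) => // [w_gt0|<-] _; rewrite ?oppr0 ?adde0.
Qed.

(** The sign s, with s * s = 1, lets one primitive serve both half-lines, where |v| is
    v or - v. *)
Lemma integral_powers (s k a b : R) n : s * s = 1 -> a < b ->
  (\int[lam]_(v in `[a, b]) (k * (s * v) ^+ n)%:E =
   (k * s / n.+1%:R * ((s * b) ^+ n.+1 - (s * a) ^+ n.+1))%:E)%E.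
Proof.
move=> ss ab; pose F : R -> R := (k * s / n.+1%:R) \*: ((s \*: id) ^+ n.+1).
have FE (v : R) : F v = k * s / n.+1%:R * (s * v) ^+ n.+1.
  by rewrite /F exprfctE.
have n0 : n.+1%:R != 0 :> R by rewrite pnatr_eq0.
have dF (v : R) : is_derive v 1 F (k * (s * v) ^+ n).
  apply: is_derive_eq; rewrite /GRing.scale/= -[s *: v]/(s * v) -[RHS]mulr1 -[in RHS]ss.
  by field.
rewrite (@continuous_FTC2 _ _ F)//.
- by rewrite !FE -EFinB -mulrBr.
- have : continuous (fun v : R => k * (s * v) ^+ n).
    move=> v; apply: (@continuous_comp _ _ _ (fun v => (s * v) ^+ n) ( *%R k)); last exact: mulrl_continuous.
    apply: (@continuous_comp _ _ _ (fun v => s * v) (fun v => v ^+ n)).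
      exact: mulrl_continuous.
    exact: exprn_continuous.
  by move=> /continuous_subspaceT.
- have cF : continuous F.
    by move=> v; apply/differentiable_continuous/derivable1_diffP; exact: ex_derive.
  split => //.
  + by apply: cvg_at_right_filter; exact: cF.
  + by apply: cvg_at_left_filter; exact: cF.
- by move=> v _; rewrite derive1E derive_val.
Qed.

(** Half-open intervals are differences of half-lines of finite measure, and they form a
    generating system stable under intersection. *)
Lemma eq_measure_cdf (m1 m2 : {measure set RT -> \bar R}) :
  (forall b, m1 `]-oo, b]%classic = m2 `]-oo, b]%classic) ->
  (forall b, m1 `]-oo, b]%classic < +oo)%E ->
  forall A, measurable A -> m1 A = m2 A.
Proof.
move=> m12 m1oo.
have m1oc (m : {measure set RT -> \bar R}) a b : a < b ->
    (m `]-oo, b]%classic < +oo)%E ->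
    m `]a, b]%classic = (m `]-oo, b]%classic - m `]-oo, a]%classic)%E.
  move=> ab mb.
  rewrite (_ : `]a, b]%classic = `]-oo, b] `\` `]-oo, a]); last first.
    apply/seteqP; split => x /=; rewrite !in_itv/=.
      by move=> /andP[ax ->]; split => //; apply/negP; rewrite -ltNge.
    by move=> [-> /negP]; rewrite -ltNge => ->.
  rewrite measureD//; congr (_ - m _)%E.
  apply/seteqP; split => x /=; rewrite !in_itv/=; first by case.
  by move=> xa; split => //; exact: le_trans xa (ltW ab).
move=> A mA; apply: (@measure_unique _ R RT (@ocitv R : set (set RT)) (fun k => `](- k%:R), k%:R]%classic : set RT) _ _ _ _ m1 m2) => //.
- exact: ocitvI.
- by move=> k; apply: is_ocitv.
- apply/seteqP; split => // x _; exists (Num.bound `|x|) => //=.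
  rewrite in_itv/=; have := archi_boundP (normr_ge0 x).
  by rewrite ltr_norml => /andP[-> /ltW].
- move=> B /ocitvP[->|[[a b] /= ab ->]]; first by rewrite !measure0.
  by rewrite !m1oc -?m12.
- move=> k; apply: le_lt_trans (m1oo k%:R); apply: le_measure; rewrite ?inE//.
  by apply: subset_itv; rewrite bnd_simp.
Qed.

Lemma integral_even_powers (k r : R) n : 0 <= k -> 0 < r ->
  (\int[lam]_(v in `[(- r)%R, r]) (k * `|v| ^+ n)%:E =
   (2 * k / n.+1%:R * r ^+ n.+1)%:E)%E.
Proof.
move=> k0 r0.
have mf : measurable_fun setT (fun v : RT => (k * `|v| ^+ n)%:E).
  apply/measurable_EFinP; apply: measurable_funM => //.
  by apply: measurable_funX; exact: normr_measurable.
rewrite (@itv_bndbnd_setU _ _ _ (BLeft 0)) ?bnd_simp//; last 2 first.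
- by rewrite oppr_le0 ltW.
- exact: ltW.
rewrite ge0_integral_setU//=; last 3 first.
- exact: measurable_funTS.
- by move=> x _; rewrite lee_fin mulr_ge0// exprn_ge0.
- apply/disj_setPS => x [] /=; rewrite !in_itv/= => /andP[_ x0] /andP[].
  by rewrite leNgt x0.
rewrite integral_itv_bndo_bndc//; last exact: measurable_funTS.
rewrite (@eq_integral _ _ _ _ _ (fun v : RT => (k * (- 1 * (v : R)) ^+ n)%:E)); last first.
  by move=> v; rewrite inE/= in_itv/= => /andP[_ v0]; rewrite ler0_norm// mulN1r.
rewrite [X in (_ + X)%E](@eq_integral _ _ _ _ _ (fun v : RT => (k * (1 * (v : R)) ^+ n)%:E)); last first.
  by move=> v; rewrite inE/= in_itv/= => /andP[v0 _]; rewrite ger0_norm// mul1r.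
rewrite !integral_powers ?mulr1 ?mulrN1 ?opprK ?oppr_lt0//.
rewrite -EFinD mulr0 mulrNN !mul1r !expr0n/= sub0r subr0; congr (_%:E).
by field; rewrite addrC natr1 pnatr_eq0.
Qed.

(** The distribution function of N is that of |v| under the even density
    C (n + 1) / 2 |v|^n.  The density is spread over the whole line, and not over the
    half-line, so that planar integrands may later be reflected in v. *)
Lemma ge0_integral_radial d (T : measurableType d) (mu : {measure set T -> \bar R})
    (N : T -> RT) (C : R) n (G : R -> \bar R) :
  measurable_fun setT N -> (forall x, 0 <= N x) -> 0 <= C ->
  (forall r, 0 <= r -> mu [set x | N x <= r] = (C * r ^+ n.+1)%:E) ->
  measurable_fun setT (G : RT -> \bar R) -> (forall x, 0 <= G x)%E ->
  (\int[mu]_x G (N x) =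
   \int[lam]_v ((C * n.+1%:R / 2 * `|v| ^+ n)%:E * G `|v|%R))%E.
Proof.
move=> mN N0 C0 muN mG G0.
pose w (v : R) := C * n.+1%:R / 2 * `|v| ^+ n.
have w0 v : 0 <= w v.
  by rewrite mulr_ge0 ?exprn_ge0// mulr_ge0// mulr_ge0.
have mabs : measurable_fun setT (Num.norm : RT -> RT) by exact: normr_measurable.
have mw : measurable_fun setT (w : RT -> RT).
  by apply: measurable_funM => //; apply: measurable_funX.
have /= := ge0_integral_pushforward mN mu measurableT mG (fun x _ => G0 x).
rewrite preimage_setT => <-.
rewrite -(ge0_integral_density mw mabs mG G0 w0).
have mhf : measurable_fun [set: RT * RT] (Num.norm \o fst : RT * RT -> RT).
  exact: (measurableT_comp mabs measurable_fst).
have nu1 b : pushforward mu N `]-oo, b]%classic =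
    (if 0 <= b then C * b ^+ n.+1 else 0)%:E.
  rewrite /pushforward; case: ifPn => [b0|].
    by rewrite -muN//; congr (mu _).
  rewrite -ltNge => b0.
  rewrite (_ : _ @^-1` _ = set0) ?measure0//; apply/seteqP; split => // x /=.
  by rewrite in_itv/= => /(le_trans (N0 x)); rewrite leNgt b0.
have nu2 b : density_measure mw Num.norm `]-oo, b]%classic =
    (if 0 <= b then C * b ^+ n.+1 else 0)%:E.
  transitivity (\int[density_measure mw Num.norm]_v (\1_(`]-oo, b]) v)%:E)%E.
    by rewrite integral_indic// setIT.
  rewrite ge0_integral_density//; last first.
    by apply/measurable_EFinP; exact: measurable_indic.
  transitivity (\int[lam]_(v in `[(- b)%R, b]) (w v)%:E)%E.
    rewrite [RHS]integral_mkcond; apply: eq_integral => v _.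
    rewrite patchE indicE /= !mem_setE !in_itv/= ler_norml.
    by case: ifPn => _; rewrite ?mule1 ?mule0.
  case: ifPn => [|].
    rewrite le_eqVlt => /predU1P[<-|b0].
      rewrite oppr0 set_itv1 integral_set1 expr0n/= mulr0//.
    rewrite integral_even_powers ?mulr_ge0//; congr (_%:E).
    by field; rewrite addrC natr1 pnatr_eq0.
  rewrite -ltNge => b0; rewrite set_itv_ge ?integral_set0//.
  by rewrite bnd_simp -ltNge (lt_trans b0)// oppr_gt0.
apply: eq_measure_integral => // A mA _.
apply: eq_measure_cdf => // b.
  by transitivity (pushforward mu N `]-oo, b]%classic); [|rewrite nu1 -nu2].
have : (pushforward mu N `]-oo, b]%classic < +oo)%E by rewrite nu1 ltry.
exact.
Qed.

End Radial.

(** * Squares in the plane and balls of tuples *)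

Section SupNorm.
Context {R : realType}.
Local Notation lam := (@lebesgue_measure R).
Local Notation RT := (measurableTypeR R).
Local Notation mu2 := (lam \x lam)%E.

(** Squaring makes the argument nonnegative, where the inverse is a power function. *)
Lemma measurable_funV d (T : measurableType d) (f : T -> RT) :
  measurable_fun setT f -> measurable_fun setT (fun x => (f x)^-1 : RT).
Proof.
move=> mf; rewrite (_ : (fun _ => _) =
    (fun x => f x * ((f x) ^+ 2) `^ (- 1) : RT)); last first.
  apply/funext => x; rewrite powR_inv1 ?sqr_ge0//.
  by have [->|f0] := eqVneq (f x) 0; [rewrite mul0r invr0|field].
apply: measurable_funM => //.
exact: (measurableT_comp (measurable_powR (-1)) (measurable_funX 2 mf)).
Qed.

Definition supdist (c p : R * R) : R := Num.max `|c.1 - p.1| `|c.2 - p.2|.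

Lemma supdist_ge0 c p : 0 <= supdist c p.
Proof. by rewrite le_max normr_ge0. Qed.

Lemma measurable_supdist c : measurable_fun setT (supdist c : RT * RT -> RT).
Proof.
apply: measurable_maxr; apply: measurableT_comp => //.
  by apply: measurable_funB => //; exact: measurable_fst.
by apply: measurable_funB => //; exact: measurable_snd.
Qed.

Definition square c r : set (RT * RT) := [set p | supdist c p <= r].

Lemma measurable_square c r : measurable (square c r).
Proof.
rewrite (_ : square c r = [set: RT * RT] `&` supdist c @^-1` `]-oo, r]%classic).
  exact: measurable_supdist.
by rewrite setTI; apply/seteqP; split => p /=; rewrite in_itv.
Qed.

Lemma squareE c r : square c r =
  `[c.1 - r, c.1 + r]%classic `*` `[c.2 - r, c.2 + r]%classic.
Proof.
apply/seteqP; split => -[x y] /=; rewrite /square/= /supdist ge_max !in_itv/=.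
  by rewrite !ler_distlC => /andP[].
by rewrite !ler_distlC => -[-> ->].
Qed.

Lemma lebesgue_square c (r : R) : 0 <= r ->
  mu2 (square c r) = (4 * r ^+ 2)%:E.
Proof.
move=> r0; rewrite squareE product_measure1E//.
rewrite /= !lebesgue_measure_itv/= !lte_fin !ltrD2l.
have [_|rr] := ltP (- r) r.
  by rewrite -!EFinD -EFinM; congr (_%:E); ring.
have -> : r = 0 by lra.
by rewrite mule0 expr0n/= mulr0.
Qed.

(** A square of radius v has area 4 v^2, so radially the integrand is 4 |v| / |v| on a
    segment of length 2 r. *)
Lemma integral_inv_supdist c (r : R) : 0 <= r ->
  (\int[mu2]_(p in square c r) ((supdist c p)^-1)%:E
     <= (8 * r)%:E)%E.
Proof.
move=> r0.
pose G : R -> \bar R := fun v => (v^-1 * \1_(`[0%R, r]%classic) v)%:E.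
have mG : measurable_fun setT (G : RT -> \bar R).
  apply/measurable_EFinP; apply: measurable_funM; last exact: measurable_indic.
  exact: measurable_funV.
have G0 v : (0 <= G v)%E.
  rewrite lee_fin /G indicE; case: (boolP (v \in _)); rewrite ?mulr0 ?mulr1//.
  by rewrite inE/= in_itv/= => /andP[v0 _]; rewrite invr_ge0.
rewrite integral_mkcond.
rewrite (eq_integral (fun p : RT * RT => G (supdist c p))); last first.
  move=> p _; rewrite patchE /G indicE.
  have -> : (supdist c p \in `[0, r]%classic) = (supdist c p <= r).
    by apply/idP/idP; rewrite inE/= in_itv/= supdist_ge0.
  have -> : (p \in square c r) = (supdist c p <= r) by apply/idP/idP; rewrite inE.
  by case: ifPn => _; rewrite ?mulr1 ?mulr0.
rewrite (ge0_integral_radial (measurable_supdist c) (supdist_ge0 c) (C := 4) (n := 1))//;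
  last exact: lebesgue_square.
apply: (@le_trans _ _ (\int[lam]_(v in `[(- r)%R, r]) (cst 4%:E) v)%E).
  rewrite [leRHS]integral_mkcond; apply: ge0_le_integral => //.
  - by move=> v _; rewrite mule_ge0// lee_fin mulr_ge0// divr_ge0// mulr_ge0.
  - apply: emeasurable_funM.
      apply/measurable_EFinP; apply: measurable_funM => //.
      by apply: measurable_funX; exact: normr_measurable.
    by apply: (measurableT_comp mG); exact: normr_measurable.
  - by have [+ _] := measurable_restrictT (cst 4%:E : RT -> \bar R) (measurable_itv `[(- r)%R, r]); apply.
  - move=> v _; rewrite /G patchE indicE !mem_setE !in_itv/= normr_ge0/= ler_norml.
    case: ifPn => _; rewrite ?mulr1 ?mulr0 ?mule0// -EFinM lee_fin expr1.
    have [->|v0] := eqVneq v 0; first by rewrite normr0 mulr0 mul0r.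
    by rewrite mulfK ?normr_eq0//; lra.
rewrite integral_cst//= lebesgue_measure_itv/= lte_fin.
have [_|rr] := ltP (- r) r; first by rewrite -EFinD -EFinM lee_fin; lra.
by rewrite mule0 lee_fin; lra.
Qed.

End SupNorm.

Section Ball.
Context {R : realType}.
Local Notation RT := (measurableTypeR R).
Local Notation tupleR n := (n.-tuple RT).

Definition tnorm n (t : tupleR n) : R := enorm (row_of_tuple t).

Lemma tnormE n (t : tupleR n) : tnorm t = Num.sqrt (\sum_i tnth t i ^+ 2).
Proof. by congr Num.sqrt; apply: eq_bigr => i _; rewrite mxE. Qed.

Lemma tnorm_ge0 n (t : tupleR n) : 0 <= tnorm t.
Proof. exact: sqrtr_ge0. Qed.

Lemma tnorm_scale n c (t : tupleR n) : tnorm (scale_tuple c t) = `|c| * tnorm t.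
Proof.
rewrite !tnormE -sqrtr_sqr -sqrtrM ?sqr_ge0// mulr_sumr; congr Num.sqrt.
by apply: eq_bigr => i _; rewrite tnth_map exprMn.
Qed.

Lemma measurable_sqrt : measurable_fun setT (Num.sqrt : RT -> RT).
Proof. by apply: continuous_measurable_fun; exact: sqrt_continuous. Qed.

Lemma measurable_tnorm n : measurable_fun setT (@tnorm n : tupleR n -> RT).
Proof.
rewrite (_ : @tnorm n = Num.sqrt \o (fun t : tupleR n => \sum_i tnth t i ^+ 2 : RT)).
  apply: (measurableT_comp measurable_sqrt).
  apply: measurable_sum => i; apply: measurable_funX; exact: measurable_tnth.
by apply/funext => t; rewrite tnormE.
Qed.

Lemma measurable_ball_tuple n r : measurable [set t : tupleR n | tnorm t <= r].
Proof.
rewrite (_ : [set _ | _] = [set: tupleR n] `&` @tnorm n @^-1` `]-oo, r]%classic).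
  exact: measurable_tnorm.
by rewrite setTI; apply/seteqP; split => p /=; rewrite in_itv.
Qed.

Definition cube n (r : R) : set (tupleR n) := [set t | forall i, `|tnth t i| <= r].

Lemma measurable_cube n r : measurable (@cube n r).
Proof.
rewrite (_ : cube r = \bigcap_(i in [set: 'I_n]) [set t : tupleR n | `|tnth t i| <= r]).
  apply: fin_bigcap_measurable => // i _.
  rewrite (_ : [set _ | _] = [set: tupleR n] `&` (fun t => `|tnth t i : R| : RT) @^-1` `]-oo, r]%classic).
    have : measurable_fun setT (fun t : tupleR n => `|tnth t i : R| : RT).
      by apply: measurableT_comp => //; exact: measurable_tnth.
    by apply.
  by rewrite setTI; apply/seteqP; split => p /=; rewrite in_itv.
by apply/seteqP; split => [t tr i _|t tr i]; exact: tr.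
Qed.

Lemma lebesgue_cube n (r : R) : 0 <= r ->
  lebesgue_tuple R n (cube r) = ((2 * r) ^+ n)%:E.
Proof.
move=> r0; elim: n => [|n IH].
  by rewrite /= diracE mem_set// => -[].
rewrite lebesgue_tupleS.
rewrite (eq_integral (fun y => (2 * r)%:E * (\1_(@cube n r) y)%:E)%E); last first.
  move=> y _; have [ycube|ycube] := pselect (@cube n r y).
    rewrite indicE mem_set// mule1.
    rewrite (_ : [set _ | _] = `[- r, r]%classic); last first.
      apply/seteqP; split => x /=; rewrite in_itv/= -ler_norml.
        by move=> /(_ ord0).
      by move=> xr i; case: (unliftP ord0 i) => [j|] ->//; rewrite tnthS; exact: ycube.
    rewrite lebesgue_measure_itv/= lte_fin.
    have [_|] := ltP (- r) r; first by rewrite opprK -EFinD mulr_natl.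
    by move=> rr; have -> : r = 0; [lra|rewrite mulr0].
  rewrite indicE memNset// mule0.
  rewrite (_ : [set _ | _] = set0) ?measure0//; apply/seteqP; split => // x /= xr.
  by apply: ycube => i; have := xr (lift ord0 i); rewrite tnthS.
rewrite ge0_integralZl_EFin//; last 2 first.
- by apply/measurable_EFinP; apply: measurable_indic; exact: measurable_cube.
- by rewrite mulr_ge0.
rewrite integral_indic//; last exact: measurable_cube.
by rewrite setIT IH -EFinM exprS.
Qed.

End Ball.

(** * Volume of balls and area of the sphere *)

Section UnitBall.
Context {R : realType}.
Variable n : nat.
Local Notation RT := (measurableTypeR R).
Local Notation m := n.+1.
Local Notation tupleR n := (n.-tuple RT).

Definition ball_volume : R := fine (lebesgue_tuple R m [set t | tnorm t <= 1]).

Lemma le_tnorm k (t : tupleR k) i : `|tnth t i| <= tnorm t.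
Proof.
rewrite tnormE -sqrtr_sqr ler_sqrt; last by apply: sumr_ge0 => j _; exact: sqr_ge0.
by rewrite (bigD1 i)//= lerDl; apply: sumr_ge0 => j _; exact: sqr_ge0.
Qed.

Lemma lebesgue_unit_ball_lty :
  (lebesgue_tuple R m [set t | (tnorm t <= 1)%R] < +oo)%E.
Proof.
apply: (@le_lt_trans _ _ (lebesgue_tuple R m (cube 1))).
  apply: le_measure; rewrite ?inE.
  - exact: measurable_ball_tuple.
  - exact: measurable_cube.
  - by move=> t /= t1 i; exact: le_trans (le_tnorm t i) t1.
by rewrite lebesgue_cube// ltry.
Qed.

Lemma lebesgue_unit_ballE :
  lebesgue_tuple R m [set t | tnorm t <= 1] = ball_volume%:E.
Proof. by rewrite /ball_volume fineK// ge0_fin_numE// lebesgue_unit_ball_lty. Qed.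

Lemma ball_volume_gt0 : 0 < ball_volume.
Proof.
rewrite -lte_fin -lebesgue_unit_ballE.
apply: (@lt_le_trans _ _ (lebesgue_tuple R m (cube m%:R^-1))).
  by rewrite lebesgue_cube// lte_fin exprn_gt0// mulr_gt0.
apply: le_measure; rewrite ?inE.
- exact: measurable_cube.
- exact: measurable_ball_tuple.
- move=> t /= tm; rewrite tnormE -[leRHS]sqrtr1 ler_sqrt//.
  apply: (@le_trans _ _ (\sum_(i < m) m%:R^-1)).
    apply: ler_sum => i _; rewrite -real_normK ?num_real//.
    apply: (@le_trans _ _ (m%:R^-1 ^+ 2)).
      by rewrite lerXn2r ?nnegrE.
    by rewrite expr2 ler_piMl// invf_le1// ler1n.
  by rewrite sumr_const card_ord -[leLHS]mulr_natr mulVf// pnatr_eq0.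
Qed.

(** Scaling reduces to the unit ball when r > 0; for r = 0 the ball lies in balls of
    arbitrarily small volume. *)
Lemma lebesgue_ball_tuple (r : R) : 0 <= r ->
  lebesgue_tuple R m [set t | tnorm t <= r] = (ball_volume * r ^+ m)%:E.
Proof.
have scaled s : 0 < s ->
    lebesgue_tuple R m [set t | tnorm t <= s] = (ball_volume * s ^+ m)%:E.
  move=> s0; have := lebesgue_tuple_scale (c := s^-1) _ (measurable_ball_tuple 1 : measurable [set t : tupleR m | _]).
  rewrite invr_eq0 gt_eqF// => /(_ isT).
  rewrite (_ : _ @^-1` _ = [set t | tnorm t <= s]); last first.
    apply/seteqP; split => t /=; rewrite tnorm_scale gtr0_norm ?invr_gt0//;
      by rewrite ler_pdivrMl// mulr1.
  move=> ->; rewrite lebesgue_unit_ballE -EFinM gtr0_norm ?invr_gt0// -exprVn invrK.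
  by rewrite mulrC.
rewrite le_eqVlt => /predU1P[<-|]; last exact: scaled.
rewrite expr0n/= mulr0; apply/eqP; rewrite -measure_le0; apply/lee_addgt0Pr => e e0.
rewrite add0e; pose s := Num.min 1 (e / ball_volume).
have s0 : 0 < s by rewrite lt_min ltr01 divr_gt0// ball_volume_gt0.
apply: (@le_trans _ _ (lebesgue_tuple R m [set t | tnorm t <= s])).
  apply: le_measure; rewrite ?inE; [exact: measurable_ball_tuple..|].
  by move=> t /= /le_trans; apply; exact: ltW.
rewrite scaled// lee_fin mulrC -ler_pdivlMr ?ball_volume_gt0//.
apply: (@le_trans _ _ s); last by rewrite ge_min lexx orbT.
by rewrite exprS ler_piMr ?(ltW s0)// exprn_ile1// ?(ltW s0)// ge_min lexx.
Qed.

(** The cone over the sphere is the closed ball; its vertex is represented by an arbitrary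
    direction. *)
Lemma surface_area_usphere :
  surface_area (@usphere R m) = m%:R * ball_volume.
Proof.
rewrite /surface_area /ball_volume /volume; congr (_ * fine (lebesgue_tuple R m _)).
apply/seteqP; split => t /=.
  move=> [r]; rewrite in_itv/= => /andP[r0 r1] [J J1] rJ.
  rewrite /tnorm -rJ /enorm.
  rewrite (_ : \sum_i _ = r ^+ 2 * \sum_i J 0 i ^+ 2); last first.
    by rewrite mulr_sumr; apply: eq_bigr => i _; rewrite mxE exprMn.
  by rewrite J1 mulr1 sqrtr_sqr ger0_norm.
move=> t1; have [t0|t0] := eqVneq (tnorm t) 0.
  exists 0; first by rewrite in_itv/= lexx ler01.
  exists (delta_mx 0 ord0).
    rewrite /usphere/= (bigD1 ord0)//= mxE !eqxx expr1n big1 ?addr0// => i i0.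
    by rewrite mxE (negbTE i0) andbF expr0n.
  rewrite scale0r; apply/rowP => i; rewrite !mxE; apply/esym/eqP.
  by rewrite -normr_le0 -t0 le_tnorm.
exists (tnorm t); first by rewrite in_itv/= tnorm_ge0.
exists ((tnorm t)^-1 *: row_of_tuple t); last by rewrite scalerA mulfV// scale1r.
rewrite /usphere/=.
rewrite (_ : \sum_i _ = (tnorm t) ^- 2 * \sum_i (row_of_tuple t) 0 i ^+ 2); last first.
  by rewrite mulr_sumr; apply: eq_bigr => i _; rewrite mxE exprMn exprVn.
rewrite -[X in _ * X]sqr_sqrtr; last by apply: sumr_ge0 => i _; exact: sqr_ge0.
by rewrite -/(enorm _) -/(tnorm t) mulVf// expf_neq0.
Qed.

Lemma surface_area_usphere_gt0 : 0 < surface_area (@usphere R m).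
Proof. by rewrite surface_area_usphere mulr_gt0// ball_volume_gt0. Qed.

Lemma sigma_finite_lebesgue_tuple : sigma_finite [set: tupleR m] (lebesgue_tuple R m).
Proof.
exists (fun k => cube k%:R).
  apply/esym/seteqP; split => // t _; exists (Num.bound (tnorm t)) => //= i.
  by apply: le_trans (le_tnorm t i) (ltW _); exact: archi_boundP (tnorm_ge0 t).
move=> k; split; first exact: measurable_cube.
by rewrite lebesgue_cube// ltry.
Qed.

End UnitBall.

(** * Volume integrals of axially symmetric functions *)

Section AxialIntegral.
Context {R : realType}.
Variable n : nat.
Local Notation RT := (measurableTypeR R).
Local Notation m := n.+1.
Local Notation tupleR n := (n.-tuple RT).
Local Notation lam := (@lebesgue_measure R).
Local Notation mu2 := (lam \x lam)%E.

Definition tail_tuple k (t : tupleR k.+1) : tupleR k := [tuple of behead t].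

Lemma tuple_consK k (y : tupleR k) (u : RT) :
  tail_tuple (tuple_cons (y, u)) = y /\ thead (tuple_cons (y, u)) = u.
Proof. by split; first exact/val_inj. Qed.

Lemma measurable_thead k : measurable_fun setT (fun t : tupleR k.+1 => thead t : RT).
Proof. exact: (@measurable_tnth _ RT k.+1 ord0). Qed.

Lemma measurable_tail k : measurable_fun setT (@tail_tuple k).
Proof. exact: measurable_behead. Qed.

Lemma integral_tuple_cons k (G : tupleR k.+1 -> \bar R) : measurable_fun setT G ->
  (forall t, 0 <= G t)%E ->
  (\int[lebesgue_tuple R k.+1]_t G t =
   \int[(lebesgue_tuple R k \x lam)%E]_p G (tuple_cons p))%E.
Proof.
move=> mG G0.
have /= := ge0_integral_pushforward (@measurable_tuple_cons R k)
  (lebesgue_tuple R k \x lam)%E measurableT mG (fun t _ => G0 t).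
rewrite preimage_setT => <-.
by apply: eq_measure_integral; first exact: measurable_tuple_cons.
Qed.

Definition axial_density (v : R) : R := @ball_volume R n * m%:R / 2 * `|v| ^+ n.

Lemma axial_density_ge0 v : 0 <= axial_density v.
Proof.
by rewrite mulr_ge0 ?exprn_ge0// divr_ge0// mulr_ge0// ltW// ball_volume_gt0.
Qed.

Lemma measurable_axial_density : measurable_fun setT (axial_density : RT -> RT).
Proof.
by apply: measurable_funM => //; apply: measurable_funX; exact: normr_measurable.
Qed.

(** Fubini isolates the scalar coordinate, and the integral over the others is radial. *)
Lemma ge0_integral_axial (G : R * R -> \bar R) :
  measurable_fun setT (G : RT * RT -> \bar R) -> (forall p, 0 <= G p)%E ->
  (\int[lebesgue_tuple R m.+1]_t G (tnorm (tail_tuple t), thead t) =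
   \int[mu2]_p ((axial_density p.1)%:E * G (`|p.1|%R, p.2)))%E.
Proof.
move=> mG G0.
pose sf : {sigma_finite_measure set (tupleR m) -> \bar R} :=
  HB.pack (lebesgue_tuple R m : set _ -> \bar R) (Measure.on (lebesgue_tuple R m))
  (Measure_isSigmaFinite.Build _ _ _ (lebesgue_tuple R m) (sigma_finite_lebesgue_tuple n)).
rewrite integral_tuple_cons; last 2 first.
- apply: (measurableT_comp mG).
  apply: measurable_fun_pair; last exact: measurable_thead.
  exact: (measurableT_comp (@measurable_tnorm R m) (@measurable_tail m)).
- by move=> t; exact: G0.
transitivity (\int[(sf \x lam)%E]_p G (tnorm p.1, p.2))%E.
  apply: eq_integral => -[y u] _ /=.
  by have [-> ->] := tuple_consK y u.
have mN : measurable_fun setT (@tnorm R m : tupleR m -> RT) by exact: measurable_tnorm.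
rewrite fubini_tonelli1; last 2 first.
- apply: (measurableT_comp mG); apply: measurable_fun_pair => //.
  exact: (measurableT_comp mN measurable_fst).
- by move=> p; exact: G0.
pose Phi (v : R) : \bar R := (\int[lam]_u G (v, u))%E.
have mPhi : measurable_fun setT (Phi : RT -> \bar R).
  exact: (measurable_fun_fubini_tonelli_F (m2 := lam) G).
have Phi0 v : (0 <= Phi v)%E by exact: integral_ge0.
transitivity (\int[lebesgue_tuple R m]_y Phi (tnorm y))%E; first by [].
rewrite (ge0_integral_radial mN (@tnorm_ge0 R m) (C := @ball_volume R n) (n := n))//;
  last exact: lebesgue_ball_tuple; last first.
  by rewrite ltW// ball_volume_gt0.
have mG' : measurable_fun setT (fun p : RT * RT => G (`|p.1|%R, p.2)).
  apply: (measurableT_comp mG); apply: measurable_fun_pair => //.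
  by apply: measurableT_comp => //; exact: measurable_fst.
rewrite fubini_tonelli1; last 2 first.
- apply: emeasurable_funM => //; apply/measurable_EFinP.
  exact: (measurableT_comp measurable_axial_density measurable_fst).
- by move=> p; rewrite mule_ge0// lee_fin axial_density_ge0.
apply: eq_integral => v _; rewrite /fubini_F/= ge0_integralZl_EFin//.
- by apply: (measurableT_comp mG); exact: measurable_pair1.
- exact: axial_density_ge0.
Qed.

(** Splitting into positive and negative parts commutes with the nonnegative density. *)
Lemma integral_axial (G : R * R -> \bar R) :
  measurable_fun setT (G : RT * RT -> \bar R) ->
  (\int[lebesgue_tuple R m.+1]_t G (tnorm (tail_tuple t), thead t) =
   \int[mu2]_p ((axial_density p.1)%:E * G (`|p.1|%R, p.2)))%E.
Proof.
move=> mG; rewrite integralE [RHS]integralE; congr (_ - _)%E.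
- transitivity (\int[mu2]_p ((axial_density p.1)%:E * G^\+ (`|p.1|%R, p.2)))%E.
    rewrite -ge0_integral_axial; [|exact: measurable_funepos|exact: funepos_ge0].
    by apply: eq_integral => t _; rewrite !funeposE.
  apply: eq_integral => p _; rewrite !funeposE maxe_pMr ?mule0//.
  by rewrite lee_fin axial_density_ge0.
- transitivity (\int[mu2]_p ((axial_density p.1)%:E * G^\- (`|p.1|%R, p.2)))%E.
    rewrite -ge0_integral_axial; [|exact: measurable_funeneg|exact: funeneg_ge0].
    by apply: eq_integral => t _; rewrite !funenegE.
  apply: eq_integral => p _; rewrite !funenegE maxe_pMr ?oppe0 ?mule0 ?muleN//.
  by rewrite lee_fin axial_density_ge0.
Qed.

Definition flip_tail k (t : tupleR k.+1) : tupleR k.+1 :=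
  tuple_cons (scale_tuple (-1) (tail_tuple t), thead t).

Lemma measurable_flip_tail k : measurable_fun setT (@flip_tail k).
Proof.
apply: measurable_cons; first exact: measurable_thead.
exact: (measurableT_comp (measurable_scale_tuple _) (@measurable_tail k)).
Qed.

Lemma lebesgue_flip_tail k (A : set (tupleR k.+1)) : measurable A ->
  lebesgue_tuple R k.+1 (@flip_tail k @^-1` A) = lebesgue_tuple R k.+1 A.
Proof.
move=> mA; rewrite !lebesgue_tupleS.
pose phi y := lam [set x | A (tuple_cons (y, x))].
have mphi : measurable_fun setT phi by exact: measurable_fun_tuple_section.
have phi0 y : (0 <= phi y)%E by [].
transitivity (\int[lebesgue_tuple R k]_y phi (scale_tuple (-1) y))%E.
  apply: eq_integral => y _; congr (lam _); apply/seteqP; split => x /=;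
    by rewrite /flip_tail; have [-> ->] := tuple_consK y x.
have /= := ge0_integral_pushforward (@measurable_scale_tuple R k (-1))
  (lebesgue_tuple R k) measurableT mphi (fun x _ => phi0 x).
rewrite preimage_setT => <-.
apply: eq_measure_integral => [|mf B mB _]; first exact: measurable_scale_tuple.
transitivity (lebesgue_tuple R k (@scale_tuple R k (-1) @^-1` B)); first by [].
by rewrite lebesgue_tuple_scale ?oppr_eq0// normrN1 expr1n invr1 mul1e.
Qed.

Lemma integral_flip_tail k (G : tupleR k.+1 -> \bar R) : measurable_fun setT G ->
  (forall t, 0 <= G t)%E ->
  (\int[lebesgue_tuple R k.+1]_t G (flip_tail t) = \int[lebesgue_tuple R k.+1]_t G t)%E.
Proof.
move=> mG G0.
have /= := ge0_integral_pushforward (@measurable_flip_tail k)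
  (lebesgue_tuple R k.+1) measurableT mG (fun x _ => G0 x).
rewrite preimage_setT => <-.
apply: eq_measure_integral => [|mf B mB _]; first exact: measurable_flip_tail.
exact: lebesgue_flip_tail.
Qed.

(** Negating the vector part preserves volume, so the positive and negative parts have the
    same integral. *)
Lemma integral_flip_tail_odd k (h : tupleR k.+1 -> R) :
  (lebesgue_tuple R k.+1).-integrable setT (EFin \o h) ->
  (forall t, h (flip_tail t) = - h t) ->
  \int[lebesgue_tuple R k.+1]_t h t = 0.
Proof.
move=> ih hodd; have /integrableP[mh _] := ih.
rewrite /Rintegral integralE.
rewrite -(integral_flip_tail (measurable_funepos mh)); last exact: funepos_ge0.
have -> : (\int[lebesgue_tuple R k.+1]_t (EFin \o h)^\+ (flip_tail t) =
    \int[lebesgue_tuple R k.+1]_t (EFin \o h)^\- t)%E.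
  by apply: eq_integral => t _; rewrite funeposE funenegE /= hodd.
by rewrite subee// integrable_neg_fin_num.
Qed.

End AxialIntegral.

(** * Potentials of the inverse kernel in the plane *)

Section PlanarPotential.
Context {R : realType}.
Local Notation lam := (@lebesgue_measure R).
Local Notation RT := (measurableTypeR R).
Local Notation mu2 := (lam \x lam)%E.
Implicit Types (p q c : R * R) (g : R * R -> R) (K : R -> R -> R).

(** The real and imaginary parts of 1 / (x + i y) are [kre y x] and [- kim y x]. *)
Definition kre (y x : R) : R := x / (x ^+ 2 + y ^+ 2).
Definition kim (y x : R) : R := y / (x ^+ 2 + y ^+ 2).

Definition pot K g q : R := \int[mu2]_p (g p * K (q.1 - p.1) (q.2 - p.2)).

(** The bound is by the sup norm, so that squares play the role of discs and
    [integral_inv_supdist] applies directly. *)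
Definition inverse_kernel K : Prop :=
  measurable_fun setT (fun w : RT * RT => K w.1 w.2 : RT) /\
  forall y x, `|K y x| <= (Num.max `|y| `|x|)^-1.

Lemma sqrD_gt0 (y x : R) : 0 < Num.max `|y| `|x| -> 0 < x ^+ 2 + y ^+ 2.
Proof.
rewrite lt_max !normr_gt0 => /orP[y0|x0].
  by rewrite ltr_wpDl ?sqr_ge0// exprn_even_gt0.
by rewrite ltr_pwDl ?sqr_ge0// exprn_even_gt0.
Qed.

Lemma inverse_kernel_re : inverse_kernel kre.
Proof.
split.
  apply: measurable_funM; first exact: measurable_snd.
  by apply: measurable_funV; apply: measurable_funD; apply: measurable_funX;
    [exact: measurable_snd|exact: measurable_fst].
move=> y x; rewrite /kre normrM.
have [max0|max0] := leP (Num.max `|y| `|x|) 0.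
  have -> : x = 0.
    by apply/eqP; rewrite -normr_eq0 eq_le normr_ge0 andbT (le_trans _ max0)// le_max lexx orbT.
  by rewrite normr0 mul0r invr_ge0 le_max normr_ge0.
have s0 := sqrD_gt0 max0.
rewrite normfV (gtr0_norm s0) ler_pdivrMr// ler_pdivlMl//.
rewrite -(real_normK (num_real x)) -(real_normK (num_real y)).
have := normr_ge0 x; have := normr_ge0 y; move: `|x| `|y| => a b b0 a0.
have [ab|ba] := leP b a; nra.
Qed.

Lemma inverse_kernel_im : inverse_kernel kim.
Proof.
split.
  apply: measurable_funM; first exact: measurable_fst.
  by apply: measurable_funV; apply: measurable_funD; apply: measurable_funX;
    [exact: measurable_snd|exact: measurable_fst].
move=> y x; have [_ /(_ x y)] := inverse_kernel_re.
by rewrite /kre /kim addrC maxC.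
Qed.

Definition planar_density c (r M : R) g : Prop :=
  [/\ measurable_fun setT (g : RT * RT -> RT), forall p, `|g p| <= M &
      forall p, r < supdist c p -> g p = 0].

Lemma supdist_triangle c q p : supdist q p <= supdist q c + supdist c p.
Proof.
rewrite /supdist ge_max; apply/andP; split.
  by rewrite -(subrKA c.1) (le_trans (ler_normD _ _))// lerD// le_max lexx.
by rewrite -(subrKA c.2) (le_trans (ler_normD _ _))// lerD// le_max lexx orbT.
Qed.

Lemma supdistC c p : supdist c p = supdist p c.
Proof. by rewrite /supdist distrC [X in _ = Num.max _ X]distrC. Qed.

Lemma measurable_shifted_kernel K q : inverse_kernel K ->
  measurable_fun setT (fun p : RT * RT => K (q.1 - p.1) (q.2 - p.2) : RT).
Proof.
move=> [mK _].
apply: (measurableT_comp mK (f := fun w : RT * RT => K w.1 w.2 : RT)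
  (g := fun p : RT * RT => (q.1 - p.1, q.2 - p.2) : RT * RT)).
apply: measurable_fun_pair; apply: measurable_funB => //.
Qed.

(** The support lies in a square around the pole, where the kernel is dominated by the
    inverse distance. *)
Lemma integrable_pot K c r M g q : inverse_kernel K -> 0 <= r ->
  planar_density c r M g ->
  mu2.-integrable setT (fun p => (g p * K (q.1 - p.1) (q.2 - p.2))%:E).
Proof.
move=> iK r0 [mg gM gs].
have M0 : 0 <= M := le_trans (normr_ge0 _) (gM c).
have mgK : measurable_fun setT
    (fun p : RT * RT => g p * K (q.1 - p.1) (q.2 - p.2) : RT).
  by apply: measurable_funM => //; exact: measurable_shifted_kernel.
apply/integrableP; split; first exact/measurable_EFinP.
pose s := supdist q c + r.
have s0 : 0 <= s by rewrite addr_ge0// supdist_ge0.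
apply: (@le_lt_trans _ _ (\int[mu2]_(p in square q s) (M%:E * ((supdist q p)^-1)%:E))%E); last first.
  have mi : measurable_fun setT (fun p : RT * RT => ((supdist q p)^-1)%:E).
    by apply/measurable_EFinP; apply: measurable_funV; exact: measurable_supdist.
  rewrite ge0_integralZl_EFin//.
  - apply: (@le_lt_trans _ _ (M%:E * (8 * s)%:E)%E); last by rewrite -EFinM ltry.
    by rewrite lee_wpmul2l ?lee_fin// integral_inv_supdist.
  - exact: measurable_square.
  - by move=> p _; rewrite lee_fin invr_ge0 supdist_ge0.
  - exact: measurable_funTS.
rewrite [leRHS]integral_mkcond; apply: ge0_le_integral => //.
- by apply/measurable_EFinP; exact: measurableT_comp.
- have [+ _] := measurable_restrictT (fun p : RT * RT => (M%:E * ((supdist q p)^-1)%:E)%E) (measurable_square q s); apply.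
  apply/measurable_funTS/measurable_EFinP/measurable_funM => //.
  by apply: measurable_funV; exact: measurable_supdist.
- move=> p _; rewrite patchE; case: ifPn => [_|].
    rewrite -EFinM lee_fin normrM ler_pM//; exact: iK.2.
  rewrite notin_setE/= => /negP; rewrite -ltNge => sp.
  rewrite gs ?mul0r ?normr0//.
  by have := supdist_triangle c q p; rewrite /s in sp; lra.
Qed.

Definition kernel_increment K : Prop := forall y x y' x',
  0 < Num.max `|y| `|x| -> 0 < Num.max `|y'| `|x'| ->
  `|K y' x' - K y x| <= 4 * Num.max `|y' - y| `|x' - x| *
    ((Num.max `|y| `|x|)^-1 * (Num.max `|y'| `|x'|)^-1).

(** Real part of 1 / w' - 1 / w = - (w' - w) / (w w'). *)
Lemma kre_increment y x y' x' :
  0 < Num.max `|y| `|x| -> 0 < Num.max `|y'| `|x'| ->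
  kre y' x' - kre y x =
  - ((x' - x) * (kre y x * kre y' x' - kim y x * kim y' x') +
     (y' - y) * (kre y x * kim y' x' + kim y x * kre y' x')).
Proof.
move=> /sqrD_gt0 w0 /sqrD_gt0 w0'; rewrite /kre /kim; field.
by rewrite !gt_eqF.
Qed.

(** Imaginary part of the same identity, up to sign. *)
Lemma kim_increment y x y' x' :
  0 < Num.max `|y| `|x| -> 0 < Num.max `|y'| `|x'| ->
  kim y' x' - kim y x =
  - ((x' - x) * (kre y x * kim y' x' + kim y x * kre y' x') -
     (y' - y) * (kre y x * kre y' x' - kim y x * kim y' x')).
Proof.
move=> /sqrD_gt0 w0 /sqrD_gt0 w0'; rewrite /kre /kim; field.
by rewrite !gt_eqF.
Qed.

Lemma kernel_increment_bound (dx dy a b a' b' m n : R) :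
  `|a| <= m -> `|b| <= m -> `|a'| <= n -> `|b'| <= n ->
  `|dx * (a * a' - b * b') + dy * (a * b' + b * a')| <=
    4 * Num.max `|dy| `|dx| * (m * n).
Proof.
move=> am bm an bn.
have m0 : 0 <= m := le_trans (normr_ge0 _) am.
have n0 : 0 <= n := le_trans (normr_ge0 _) an.
have mul2 u v u' v' : `|u| <= m -> `|v| <= n -> `|u'| <= m -> `|v'| <= n ->
    `|u * v + u' * v'| <= 2 * (m * n).
  move=> um vn um' vn'; apply: le_trans (ler_normD _ _) _; rewrite !normrM.
  have := ler_pM (normr_ge0 u) (normr_ge0 v) um vn.
  have := ler_pM (normr_ge0 u') (normr_ge0 v') um' vn'.
  by lra.
apply: le_trans (ler_normD _ _) _; rewrite !normrM.
have dy0 : `|dy| <= Num.max `|dy| `|dx| by rewrite le_max lexx.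
have dx0 : `|dx| <= Num.max `|dy| `|dx| by rewrite le_max lexx orbT.
have h1 : `|a * a' - b * b'| <= 2 * (m * n) by rewrite -mulNr mul2// normrN.
have h2 : `|a * b' + b * a'| <= 2 * (m * n) by exact: mul2.
have := ler_pM (normr_ge0 _) (normr_ge0 _) dx0 h1.
have := ler_pM (normr_ge0 _) (normr_ge0 _) dy0 h2.
by lra.
Qed.

Lemma kernel_increment_re : kernel_increment kre.
Proof.
move=> y x y' x' w0 w0'; rewrite kre_increment// normrN.
have [_ r] := inverse_kernel_re; have [_ i] := inverse_kernel_im.
exact: kernel_increment_bound.
Qed.

Lemma kernel_increment_im : kernel_increment kim.
Proof.
move=> y x y' x' w0 w0'; rewrite kim_increment// normrN.
have [_ r] := inverse_kernel_re; have [_ i] := inverse_kernel_im.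
have -> : (x' - x) * (kre y x * kim y' x' + kim y x * kre y' x') -
     (y' - y) * (kre y x * kre y' x' - kim y x * kim y' x') =
   (x' - x) * (kim y x * kre y' x' - (- kre y x) * kim y' x') +
   (y' - y) * (kim y x * kim y' x' + (- kre y x) * kre y' x') by ring.
by apply: kernel_increment_bound; rewrite ?normrN.
Qed.

(** Outside a square of radius d around the pole the kernel varies by O(h / d^2), and its
    total mass inside such a square is O(d). *)
Lemma pot_increment K c r M g (q q' : R * R) (d h : R) :
  inverse_kernel K -> kernel_increment K -> 0 <= r -> planar_density c r M g ->
  0 < d -> 0 <= h -> h <= d / 2 -> supdist q q' <= h ->
  `|pot K g q' - pot K g q| <= M * (24 * d + 32 * h / d ^+ 2 * r ^+ 2).
Proof.
move=> iK dK r0 gd d0 h0 hd qq'; have [mg gM gs] := gd.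
have M0 : 0 <= M := le_trans (normr_ge0 _) (gM c).
have ik := integrable_pot q iK r0 gd; have ik' := integrable_pot q' iK r0 gd.
rewrite /pot -RintegralB//.
have mK := measurable_shifted_kernel q iK.
have mK' := measurable_shifted_kernel q' iK.
have mi u : measurable_fun setT (fun p : RT * RT => ((supdist u p)^-1)%:E).
  by apply/measurable_EFinP; apply: measurable_funV; exact: measurable_supdist.
have id : mu2.-integrable setT (EFin \o (fun p =>
    g p * K (q'.1 - p.1) (q'.2 - p.2) - g p * K (q.1 - p.1) (q.2 - p.2))).
  exact: (integrableB measurableT ik' ik).
apply: (le_trans (le_normr_Rintegral measurableT id)).
rewrite -lee_fin /Rintegral fineK; last first.
  by have := integrable_fin_num measurableT (integrable_norm id).
pose e := 8 * h / d ^+ 2.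
have e0 : 0 <= e by apply: divr_ge0; [exact: mulr_ge0|exact: sqr_ge0].
(* f1 and f2 bound the two kernels near the pole, f3 their difference elsewhere. *)
pose f1 := (fun p => ((supdist q p)^-1)%:E) \_ (square q d).
pose f2 := (fun p => ((supdist q' p)^-1)%:E) \_ (square q' (2 * d)).
pose f3 := (cst e%:E : RT * RT -> \bar R) \_ (square c r).
have mf1 : measurable_fun setT f1.
  have [+ _] := measurable_restrictT (fun p : RT * RT => ((supdist q p)^-1)%:E) (measurable_square q d).
  by apply; apply: measurable_funTS; exact: mi.
have mf2 : measurable_fun setT f2.
  have [+ _] := measurable_restrictT (fun p : RT * RT => ((supdist q' p)^-1)%:E) (measurable_square q' (2 * d)).
  by apply; apply: measurable_funTS; exact: mi.
have mf3 : measurable_fun setT f3.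
  by have [+ _] := measurable_restrictT (cst e%:E : RT * RT -> \bar R) (measurable_square c r); apply.
have f10 p : (0 <= f1 p)%E.
  by rewrite /f1 patchE; case: ifP => // _; rewrite lee_fin invr_ge0 supdist_ge0.
have f20 p : (0 <= f2 p)%E.
  by rewrite /f2 patchE; case: ifP => // _; rewrite lee_fin invr_ge0 supdist_ge0.
have f30 p : (0 <= f3 p)%E by rewrite /f3 patchE; case: ifP => // _; rewrite lee_fin.
apply: (@le_trans _ _ (\int[mu2]_p (M%:E * (f1 p + f2 p + f3 p)))%E).
  apply: ge0_le_integral => //.
  - apply/measurable_EFinP; apply: measurableT_comp => //.
    by apply: measurable_funB; apply: measurable_funM.
  - apply: emeasurable_funM => //; apply: emeasurable_funD => //.
    exact: emeasurable_funD.
  - move=> p _; rewrite -mulrBr normrM.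
    have [cp|cp] := leP (supdist c p) r; last first.
      by rewrite gs// normr0 mul0r mule_ge0// ?lee_fin// !adde_ge0.
    have f3E : f3 p = e%:E by rewrite /f3 patchE mem_set.
    rewrite EFinM lee_pmul// ?lee_fin//.
    have Kb : `|K (q.1 - p.1) (q.2 - p.2)| <= (supdist q p)^-1 by exact: iK.2.
    have Kb' : `|K (q'.1 - p.1) (q'.2 - p.2)| <= (supdist q' p)^-1 by exact: iK.2.
    have qq'p : supdist q' p <= h + supdist q p.
      by apply: le_trans (supdist_triangle q q' p) _; rewrite lerD2r supdistC.
    have [qp|qp] := leP (supdist q p) d.
      have f1E : f1 p = ((supdist q p)^-1)%:E by rewrite /f1 patchE mem_set.
      have f2E : f2 p = ((supdist q' p)^-1)%:E.
        by rewrite /f2 patchE mem_set//=; rewrite /square/=; lra.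
      rewrite f1E f2E f3E -!EFinD lee_fin.
      by apply: le_trans (ler_normB _ _) _; lra.
    apply: (@le_trans _ _ e%:E); last first.
      by rewrite f3E leeDr// adde_ge0.
    have q'p : d / 2 <= supdist q' p.
      have := supdist_triangle q' q p; lra.
    have q0 : 0 < supdist q p by lra.
    have q'0 : 0 < supdist q' p by lra.
    rewrite lee_fin; apply: le_trans (dK _ _ _ _ q0 q'0) _.
    have -> : q'.1 - p.1 - (q.1 - p.1) = q'.1 - q.1 by ring.
    have -> : q'.2 - p.2 - (q.2 - p.2) = q'.2 - q.2 by ring.
    have i1 : (supdist q p)^-1 <= d^-1 by rewrite lef_pV2 ?posrE// ltW.
    have i2 : (supdist q' p)^-1 <= (d / 2)^-1 by rewrite lef_pV2 ?posrE// divr_gt0.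
    have -> : e = 4 * h * (d^-1 * (d / 2)^-1) by rewrite /e; field; rewrite gt_eqF.
    apply: ler_pM.
    + by rewrite mulr_ge0// le_max normr_ge0.
    + by rewrite mulr_ge0// invr_ge0 ltW.
    + by rewrite ler_pM2l//; rewrite supdistC in qq'.
    + by apply: ler_pM => //; rewrite invr_ge0 ltW.
rewrite ge0_integralZl_EFin//; last 2 first.
- by move=> p _; rewrite !adde_ge0.
- by apply: emeasurable_funD => //; exact: emeasurable_funD.
rewrite ge0_integralD//; last 2 first.
- by move=> p _; rewrite adde_ge0.
- exact: emeasurable_funD.
rewrite ge0_integralD// -!integral_mkcond.
rewrite [leRHS]EFinM lee_wpmul2l ?lee_fin//.
have -> : 24 * d + 32 * h / d ^+ 2 * r ^+ 2 = 8 * d + 8 * (2 * d) + e * (4 * r ^+ 2).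
  by rewrite /e; field; rewrite gt_eqF.
rewrite !EFinD !leeD ?integral_inv_supdist ?mulr_ge0 ?(ltW d0)//.
rewrite integral_cst//; last exact: measurable_square.
rewrite [leRHS]EFinM lee_wpmul2l ?lee_fin//.
by have /eqP := lebesgue_square c r0; rewrite eq_le => /andP[].
Qed.

(** A displacement of at most d^3 makes both terms of [pot_increment] O(d). *)
Lemma pot_continuous K c r M g (q : R * R) :
  inverse_kernel K -> kernel_increment K -> 0 <= r -> planar_density c r M g ->
  forall e, 0 < e -> exists2 d, 0 < d &
    forall q', supdist q q' <= d -> `|pot K g q' - pot K g q| <= e.
Proof.
move=> iK dK r0 gd e e0; have [mg gM gs] := gd.
have M0 : 0 <= M := le_trans (normr_ge0 _) (gM c).
pose C := M * (24 + 32 * r ^+ 2).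
have C0 : 0 <= C by rewrite /C mulr_ge0// addr_ge0// mulr_ge0// sqr_ge0.
pose d := Num.min (2^-1) (e / (C + 1)).
have d0 : 0 < d by rewrite lt_min invr_gt0 ltr0n/= divr_gt0// ltr_wpDl.
have d2 : d <= 2^-1 by rewrite ge_min lexx.
have de : d * (C + 1) <= e.
  by rewrite -ler_pdivlMr ?ltr_wpDl// ge_min lexx orbT.
exists (d ^+ 3); first exact: exprn_gt0.
move=> q' qq'.
have d3 : d ^+ 3 <= d / 2.
  have dd : d * d <= d * 2^-1 by rewrite ler_pM2l.
  have ddd : d * (d * d) <= 2^-1 * (d * 2^-1) by rewrite ler_pM ?mulr_ge0 ?(ltW d0).
  rewrite !exprS expr0 mulr1; lra.
apply: le_trans (pot_increment iK dK r0 gd d0 (exprn_ge0 3 (ltW d0)) d3 qq') _.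
have -> : 32 * d ^+ 3 / d ^+ 2 * r ^+ 2 = d * (32 * r ^+ 2).
  by field; rewrite gt_eqF.
have -> : M * (24 * d + d * (32 * r ^+ 2)) = d * C by rewrite /C; ring.
by apply: le_trans de; rewrite ler_pM2l// lerDl.
Qed.

End PlanarPotential.

(** * Differentiation of potentials of vanishing densities *)

Section PlanarDerivative.
Context {R : realType}.
Local Notation lam := (@lebesgue_measure R).
Local Notation RT := (measurableTypeR R).
Local Notation mu2 := (lam \x lam)%E.
Implicit Types (p q c : R * R) (g : R * R -> R) (K : R -> R -> R).

Lemma is_derive_dist (f : R -> R) (x l : R) :
  (forall e, 0 < e -> exists2 d, 0 < d & forall h, h != 0 -> `|h| <= d ->
    `|h^-1 * (f (x + h) - f x) - l| <= e) ->
  is_derive x 1 f l.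
Proof.
move=> fl.
have cl : h^-1 *: ((f \o shift x) (h *: (1 : R)) - f x) @[h --> 0^'] --> l.
  apply/cvgrPdist_le => e e0; have [d d0 fd] := fl e e0; near=> h.
  rewrite distrC /= /GRing.scale/= mulr1 (addrC h x); apply: fd.
    by near: h; exact: nbhs_dnbhs_neq.
  near: h; apply: dnbhs0_le; exact: d0.
by apply: DeriveDef; [apply/cvg_ex; exists l|apply/cvg_lim].
Unshelve. all: by end_near. Qed.

Lemma eq_Rintegral_off_null (f g : R * R -> R) (N : set (RT * RT)) :
  measurable N -> mu2 N = 0%E ->
  measurable_fun setT (f : RT * RT -> RT) -> measurable_fun setT (g : RT * RT -> RT) ->
  (forall p, ~ N p -> f p = g p) ->
  \int[mu2]_p f p = \int[mu2]_p g p.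
Proof.
move=> mN N0 mf mg fg; congr fine; apply: ae_eq_integral => //.
- exact/measurable_EFinP.
- exact/measurable_EFinP.
exists N; split => // p /= pfg; apply: contrapT => pN; apply: pfg => _.
by congr EFin; exact: fg.
Qed.

Lemma null_rectangle (A B : set R) : measurable (A : set RT) -> measurable (B : set RT) ->
  lam A = 0%E \/ lam B = 0%E -> mu2 (A `*` B) = 0%E.
Proof.
move=> mA mB AB; transitivity (lam A * lam B)%E; first exact: product_measure1E.
by case: AB => ->; rewrite ?mul0e ?mule0.
Qed.

Lemma eq_Rintegral_off_point (f g : R * R -> R) c :
  measurable_fun setT (f : RT * RT -> RT) -> measurable_fun setT (g : RT * RT -> RT) ->
  (forall p, p != c -> f p = g p) ->
  \int[mu2]_p f p = \int[mu2]_p g p.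
Proof.
move=> mf mg fg; apply: (@eq_Rintegral_off_null _ _ ([set c.1] `*` [set c.2])) => //.
- by apply: measurableX; exact: measurable_set1.
- apply: null_rectangle; [exact: measurable_set1..|].
  by left; exact: lebesgue_measure_set1.
- by move=> p pc; apply: fg; apply/eqP => pE; apply: pc; rewrite pE; split.
Qed.

Lemma eq_Rintegral_off_line (f g : R * R -> R) a :
  measurable_fun setT (f : RT * RT -> RT) -> measurable_fun setT (g : RT * RT -> RT) ->
  (forall p, p.2 != a -> f p = g p) ->
  \int[mu2]_p f p = \int[mu2]_p g p.
Proof.
move=> mf mg fg; apply: (@eq_Rintegral_off_null _ _ (setT `*` [set a])) => //.
- exact: measurableX.
- apply: null_rectangle => //.
  by right; exact: lebesgue_measure_set1.
- by move=> p pc; apply: fg; apply/eqP => pE; apply: pc; split.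
Qed.

(** A density vanishing to first order at q compensates the pole there. *)
Lemma planar_density_kernel K c r L (q : R * R) d : inverse_kernel K -> 0 <= L ->
  planar_density c r L d -> (forall p, `|d p| <= L * supdist q p) ->
  planar_density c r L (fun p => d p * K (q.1 - p.1) (q.2 - p.2)).
Proof.
move=> iK L0 [md dM ds] dq; split.
- by apply: measurable_funM => //; exact: measurable_shifted_kernel.
- move=> p; rewrite normrM; have [p0|p0] := leP (supdist q p) 0.
    have -> : `|d p| = 0.
      apply/eqP; rewrite -[X in X == _]normr_id normr_eq0 -normr_le0 normr_id.
      by apply: le_trans (dq p) _; rewrite mulr_ge0_le0.
    by rewrite mul0r.
  apply: (@le_trans _ _ (L * supdist q p * (supdist q p)^-1)).
    by apply: ler_pM => //; exact: iK.2.
  by rewrite mulfK// gt_eqF.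
- by move=> p /ds ->; rewrite mul0r.
Qed.

Section Quotient.
Variables (c q : R * R) (r L : R) (d : R * R -> R).
Hypotheses (r0 : 0 <= r) (L0 : 0 <= L).
Hypothesis (dd : planar_density c r L d).
Hypothesis (dq : forall p, `|d p| <= L * supdist q p).

Definition psire p := d p * kre (q.1 - p.1) (q.2 - p.2).
Definition psiim p := d p * kim (q.1 - p.1) (q.2 - p.2).

(** With psi = d / (q - p), the complex potential of psi is [cross_re] - i [cross_im]; it
    is the negative of the complex derivative of the potential of d at q. *)
Definition cross_re u := pot kre psire u - pot kim psiim u.
Definition cross_im u := pot kim psire u + pot kre psiim u.

Let dre : planar_density c r L psire.
Proof. exact: (planar_density_kernel (@inverse_kernel_re R)). Qed.

Let dim : planar_density c r L psiim.
Proof. exact: (planar_density_kernel (@inverse_kernel_im R)). Qed.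

Lemma cross_reE u : cross_re u = \int[mu2]_p
  (psire p * kre (u.1 - p.1) (u.2 - p.2) - psiim p * kim (u.1 - p.1) (u.2 - p.2)).
Proof.
by rewrite /cross_re /pot RintegralB//;
  [exact: (integrable_pot u (@inverse_kernel_re R) r0 dre)
  |exact: (integrable_pot u (@inverse_kernel_im R) r0 dim)].
Qed.

Lemma cross_imE u : cross_im u = \int[mu2]_p
  (psire p * kim (u.1 - p.1) (u.2 - p.2) + psiim p * kre (u.1 - p.1) (u.2 - p.2)).
Proof.
by rewrite /cross_im /pot RintegralD//;
  [exact: (integrable_pot u (@inverse_kernel_im R) r0 dre)
  |exact: (integrable_pot u (@inverse_kernel_re R) r0 dim)].
Qed.

Let integrable_cross_re u : mu2.-integrable setT (EFin \o (fun p =>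
  psire p * kre (u.1 - p.1) (u.2 - p.2) - psiim p * kim (u.1 - p.1) (u.2 - p.2))).
Proof.
exact: (integrableB measurableT (integrable_pot u (@inverse_kernel_re R) r0 dre)
  (integrable_pot u (@inverse_kernel_im R) r0 dim)).
Qed.

Let integrable_cross_im u : mu2.-integrable setT (EFin \o (fun p =>
  psire p * kim (u.1 - p.1) (u.2 - p.2) + psiim p * kre (u.1 - p.1) (u.2 - p.2))).
Proof.
exact: (integrableD measurableT (integrable_pot u (@inverse_kernel_im R) r0 dre)
  (integrable_pot u (@inverse_kernel_re R) r0 dim)).
Qed.

Lemma cross_linear u a b : a * cross_re u + b * cross_im u = \int[mu2]_p
  (a * (psire p * kre (u.1 - p.1) (u.2 - p.2) - psiim p * kim (u.1 - p.1) (u.2 - p.2)) +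
   b * (psire p * kim (u.1 - p.1) (u.2 - p.2) + psiim p * kre (u.1 - p.1) (u.2 - p.2))).
Proof.
have i1 := integrable_cross_re u; have i2 := integrable_cross_im u.
rewrite cross_reE cross_imE [RHS]RintegralD//; last 2 first.
- exact: (integrableZl measurableT a i1).
- exact: (integrableZl measurableT b i2).
by rewrite !RintegralZl.
Qed.

Let measurable_cross u a b : measurable_fun setT (fun p : RT * RT =>
  (a * (psire p * kre (u.1 - p.1) (u.2 - p.2) - psiim p * kim (u.1 - p.1) (u.2 - p.2)) +
   b * (psire p * kim (u.1 - p.1) (u.2 - p.2) + psiim p * kre (u.1 - p.1) (u.2 - p.2))) : RT).
Proof.
have [m1 _ _] := dre; have [m2 _ _] := dim.
have kr := measurable_shifted_kernel u (@inverse_kernel_re R).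
have ki := measurable_shifted_kernel u (@inverse_kernel_im R).
apply: measurable_funD; apply: measurable_funM => //.
  by apply: measurable_funB; apply: measurable_funM.
by apply: measurable_funD; apply: measurable_funM.
Qed.

(** The resolvent identity holds where both kernels are finite.  At q the density vanishes,
    and the exceptional point u is a null set. *)
Lemma pot_quotient K a b u t : inverse_kernel K -> t != 0 ->
  (forall y x y' x', y' - y = u.1 - q.1 -> x' - x = u.2 - q.2 ->
    0 < Num.max `|y| `|x| -> 0 < Num.max `|y'| `|x'| ->
    t^-1 * (K y' x' - K y x) =
    a * (kre y x * kre y' x' - kim y x * kim y' x') +
    b * (kre y x * kim y' x' + kim y x * kre y' x')) ->
  t^-1 * (pot K d u - pot K d q) = a * cross_re u + b * cross_im u.
Proof.
move=> iK t0 incr.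
have ju := integrable_pot u iK r0 dd; have jq := integrable_pot q iK r0 dd.
have ku := measurable_shifted_kernel u iK; have kq := measurable_shifted_kernel q iK.
have [md _ _] := dd.
rewrite cross_linear /pot -RintegralB// -RintegralZl//; last first.
  exact: (integrableB measurableT ju jq).
apply: (@eq_Rintegral_off_point _ _ u).
- apply: measurable_funM => //; apply: measurable_funB; exact: measurable_funM.
- exact: measurable_cross.
move=> p pu; rewrite /psire /psiim.
have [p0|p0] := leP (supdist q p) 0.
  have -> : d p = 0.
    apply/eqP; rewrite -normr_le0; apply: le_trans (dq p) _.
    by rewrite mulr_ge0_le0.
  by rewrite !mul0r !subr0 !addr0 !mulr0 addr0.
have u0 : 0 < Num.max `|u.1 - p.1| `|u.2 - p.2|.
  rewrite lt_max !normr_gt0 !subr_eq0 -negb_and; apply: contraNN pu.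
  by case: (p) (u) => p1 p2 [u1 u2] /= /andP[/eqP -> /eqP ->].
rewrite -mulrBr mulrCA (incr _ _ _ _ _ _ p0 u0); [ring|ring|ring].
Qed.

Let cross_re_continuous e : 0 < e -> exists2 h, 0 < h &
  forall u, supdist q u <= h -> `|cross_re u - cross_re q| <= e.
Proof.
move=> e0; have e2 : 0 < e / 2 by rewrite divr_gt0.
have [h1 h10 H1] := pot_continuous q (@inverse_kernel_re R) (@kernel_increment_re R) r0 dre e2.
have [h2 h20 H2] := pot_continuous q (@inverse_kernel_im R) (@kernel_increment_im R) r0 dim e2.
exists (Num.min h1 h2); first by rewrite lt_min h10.
move=> u; rewrite le_min => /andP[/H1 + /H2]; rewrite /cross_re.
rewrite !ler_norml; lra.
Qed.

Let cross_im_continuous e : 0 < e -> exists2 h, 0 < h &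
  forall u, supdist q u <= h -> `|cross_im u - cross_im q| <= e.
Proof.
move=> e0; have e2 : 0 < e / 2 by rewrite divr_gt0.
have [h1 h10 H1] := pot_continuous q (@inverse_kernel_im R) (@kernel_increment_im R) r0 dre e2.
have [h2 h20 H2] := pot_continuous q (@inverse_kernel_re R) (@kernel_increment_re R) r0 dim e2.
exists (Num.min h1 h2); first by rewrite lt_min h10.
move=> u; rewrite le_min => /andP[/H1 + /H2]; rewrite /cross_im.
rewrite !ler_norml; lra.
Qed.

Lemma supdist_x t : supdist q (q.1, q.2 + t) = `|t|.
Proof. by rewrite /supdist/= subrr normr0 opprD addNKr normrN max_r. Qed.

Lemma supdist_y t : supdist q (q.1 + t, q.2) = `|t|.
Proof. by rewrite /supdist/= subrr normr0 opprD addNKr normrN max_l. Qed.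

Lemma pot_re_dx : is_derive q.2 1 (fun x => pot kre d (q.1, x)) (- cross_re q).
Proof.
apply: is_derive_dist => e /cross_re_continuous[h h0 ch]; exists h => // t t0 th.
rewrite -surjective_pairing.
rewrite (@pot_quotient _ (-1) 0 (q.1, q.2 + t) t)//; last 2 first.
- exact: inverse_kernel_re.
- move=> y x y' x' /= yy xx w w'; rewrite kre_increment// yy xx.
  by field.
rewrite mulN1r mul0r addr0 -opprD normrN; apply: ch; by rewrite supdist_x.
Qed.

Lemma pot_im_dx : is_derive q.2 1 (fun x => pot kim d (q.1, x)) (- cross_im q).
Proof.
apply: is_derive_dist => e /cross_im_continuous[h h0 ch]; exists h => // t t0 th.
rewrite -surjective_pairing.
rewrite (@pot_quotient _ 0 (-1) (q.1, q.2 + t) t)//; last 2 first.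
- exact: inverse_kernel_im.
- move=> y x y' x' /= yy xx w w'; rewrite kim_increment// yy xx.
  by field.
rewrite mulN1r mul0r add0r -opprD normrN; apply: ch; by rewrite supdist_x.
Qed.

Lemma pot_re_dy : is_derive q.1 1 (fun y => pot kre d (y, q.2)) (- cross_im q).
Proof.
apply: is_derive_dist => e /cross_im_continuous[h h0 ch]; exists h => // t t0 th.
rewrite -surjective_pairing.
rewrite (@pot_quotient _ 0 (-1) (q.1 + t, q.2) t)//; last 2 first.
- exact: inverse_kernel_re.
- move=> y x y' x' /= yy xx w w'; rewrite kre_increment// yy xx.
  by field.
rewrite mulN1r mul0r add0r -opprD normrN; apply: ch; by rewrite supdist_y.
Qed.

Lemma pot_im_dy : is_derive q.1 1 (fun y => pot kim d (y, q.2)) (cross_re q).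
Proof.
apply: is_derive_dist => e /cross_re_continuous[h h0 ch]; exists h => // t t0 th.
rewrite -surjective_pairing.
rewrite (@pot_quotient _ 1 0 (q.1 + t, q.2) t)//; last 2 first.
- exact: inverse_kernel_im.
- move=> y x y' x' /= yy xx w w'; rewrite kim_increment// yy xx.
  by field.
rewrite mul1r mul0r addr0; apply: ch; by rewrite supdist_y.
Qed.

End Quotient.

End PlanarDerivative.

(** * Potentials of squares *)

Section SquarePotential.
Context {R : realType}.
Local Notation lam := (@lebesgue_measure R).
Local Notation RT := (measurableTypeR R).
Local Notation mu2 := (lam \x lam)%E.
Implicit Types (p q c : R * R).

Lemma Rintegral_planar_odd2 (f : R * R -> R) (a : R) :
  mu2.-integrable setT (EFin \o f) ->
  (forall p, f (p.1, a - p.2) = - f p) -> \int[mu2]_p f p = 0.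
Proof.
move=> fi fodd; have /integrableP[mf _] := fi.
suff : \int[mu2]_p f p = - \int[mu2]_p f p by lra.
rewrite -[in RHS]mulN1r -RintegralZl//.
have -> : \int[mu2]_p (-1 * f p) = \int[mu2]_p f (p.1, a - p.2).
  by apply: eq_Rintegral => p _; rewrite fodd mulN1r.
congr fine.
have fi' : mu2.-integrable setT (fun p => (f (p.1, a - p.2))%:E).
  rewrite (_ : (fun _ => _) = (fun p => (-1)%:E * (EFin \o f) p)%E).
    exact: integrableZl.
  by apply/funext => p; rewrite fodd /= -EFinM mulN1r.
rewrite -(integral21_prod_meas1 fi) -(integral21_prod_meas1 fi').
have mG := measurable_fubini_G fi.
rewrite -(@integral_isometry _ (-1) a _ (normrN1 _) mG).
by apply: eq_integral => u _; rewrite /fubini_G/= mulN1r addrC.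
Qed.

Lemma Rintegral_planar_odd1 (f : R * R -> R) (a : R) :
  mu2.-integrable setT (EFin \o f) ->
  (forall p, f (a - p.1, p.2) = - f p) -> \int[mu2]_p f p = 0.
Proof.
move=> fi fodd; have /integrableP[mf _] := fi.
suff : \int[mu2]_p f p = - \int[mu2]_p f p by lra.
rewrite -[in RHS]mulN1r -RintegralZl//.
have -> : \int[mu2]_p (-1 * f p) = \int[mu2]_p f (a - p.1, p.2).
  by apply: eq_Rintegral => p _; rewrite fodd mulN1r.
congr fine.
have fi' : mu2.-integrable setT (fun p => (f (a - p.1, p.2))%:E).
  rewrite (_ : (fun _ => _) = (fun p => (-1)%:E * (EFin \o f) p)%E).
    exact: integrableZl.
  by apply/funext => p; rewrite fodd /= -EFinM mulN1r.
rewrite -(integral12_prod_meas1 fi) -(integral12_prod_meas1 fi').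
have mG := measurable_fubini_F fi.
rewrite -(@integral_isometry _ (-1) a _ (normrN1 _) mG).
by apply: eq_integral => u _; rewrite /fubini_F/= mulN1r addrC.
Qed.

Variables (r : R) (r0 : 0 < r).

(** The angle under which a segment of half-length r is seen from distance w, negative for
    w < 0. *)
Definition segment_angle (w : R) : R := 2 * atan (r / w).

Lemma measurable_segment_angle : measurable_fun setT (segment_angle : RT -> RT).
Proof.
apply: measurable_funM => //.
apply: (measurableT_comp (f := atan : RT -> RT)).
  by apply: continuous_measurable_fun; exact: continuous_atan.
by apply: measurable_funM => //; exact: measurable_funV.
Qed.

(** For w = 0 both sides vanish, by the convention on inverses of zero. *)
Lemma integral_kre_segment (w : R) :
  (\int[lam]_(s in `[(- r)%R, r]) (kre s w)%:E = (segment_angle w)%:E)%E.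
Proof.
rewrite /segment_angle; have [->|w0] := eqVneq w 0.
  rewrite invr0 mulr0 atan0 mulr0.
  by apply: integral0_eq => s _; rewrite /kre mul0r.
pose F := (atan : R -> R) \o (w^-1 \*: id).
have dF (s : R) : is_derive s 1 F (kre s w).
  apply: is_derive_eq; rewrite /kre /GRing.scale/=.
  rewrite -[w^-1 *: s]/(w^-1 * s); field.
  by rewrite w0/= gt_eqF// ltr_pwDl ?sqr_ge0// exprn_even_gt0.
have cF : continuous F.
  by move=> v; apply/differentiable_continuous/derivable1_diffP; exact: ex_derive.
rewrite (@continuous_FTC2 _ _ F)//.
- rewrite -EFinB /F/= /GRing.scale/= mulrN atanN opprK mulrC.
  by rewrite mulr_natl mulr2n.
- by rewrite gtrN.
- suff : continuous (fun s => kre s w) by move=> /continuous_subspaceT.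
  move=> s; apply: cvgMr; apply: cvgV.
    by rewrite gt_eqF// ltr_pwDl ?sqr_ge0// exprn_even_gt0.
  by apply: cvgD; [exact: cvg_cst|exact: exprn_continuous].
- split => //.
  + by apply: cvg_at_right_filter; exact: cF.
  + by apply: cvg_at_left_filter; exact: cF.
- by move=> v _; rewrite derive1E derive_val.
Qed.

Lemma segment_angle_continuous (w : R) : w != 0 -> {for w, continuous segment_angle}.
Proof.
move=> w0; apply: cvgMr; apply: continuous_comp; last exact: continuous_atan.
by apply: cvgMr; exact: inv_continuous.
Qed.

Lemma segment_angle_bound (w : R) : `|segment_angle w| <= pi.
Proof.
have := atan_gtNpi2 (r / w); have := atan_ltpi2 (r / w).
by rewrite /segment_angle ler_norml; lra.
Qed.

Lemma segment_angleN (w : R) : segment_angle (- w) = - segment_angle w.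
Proof. by rewrite /segment_angle invrN mulrN atanN mulrN. Qed.

(** The window slides over a function that jumps at 0 but is continuous near the two ends,
    so only its values at r and - r enter: 2 (atan 1 - atan (-1)) = pi. *)
Lemma is_derive_window :
  is_derive (0 : R) 1 (fun t => \int[lam]_(w in `[t - r, t + r]) segment_angle w) pi.
Proof.
pose F (y : R) : R := \int[lam]_(w in `[- 2 * r, y]) segment_angle w.
have intI (I : interval R) : (lam [set` I] < +oo)%E ->
    lam.-integrable [set` I] (EFin \o segment_angle).
  move=> Ioo; apply: measurable_bounded_integrable => //.
    exact: (measurable_funTS measurable_segment_angle).
  by exists pi; split => [|M piM w _]; [exact: num_real|
    exact: le_trans (segment_angle_bound w) (ltW piM)].
have intab (a b : R) : lam.-integrable `[a, b] (EFin \o segment_angle).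
  by apply: intI; rewrite /= lebesgue_measure_itv/= lte_fin; case: ifP => _; rewrite ?ltry// -EFinB ltry.
have dF (x : R) : - 2 * r < x -> x != 0 -> is_derive x 1 F (segment_angle x).
  move=> rx x0.
  have [] := @continuous_FTC1_closed _ segment_angle (- 2 * r) x (x + 1) _ (intab _ _) rx
    (segment_angle_continuous x0).
    by rewrite ltrDl.
  by move=> dF; rewrite derive1E => dFE; apply: DeriveDef.
have FE (t : R) : `|t| < r ->
    \int[lam]_(w in `[t - r, t + r]) segment_angle w = F (t + r) - F (t - r).
  rewrite ltr_norml => /andP[rt tr].
  rewrite /F Rintegral_itvB//=; last 2 first.
  - by rewrite bnd_simp; lra.
  - by rewrite bnd_simp; lra.
  by rewrite Rintegral_itv_obnd_cbnd//; apply: integrableS (intab (t - r) (t + r)) => //;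
    apply: subset_itvr; rewrite bnd_simp.
have r_neq0 : r != 0 by rewrite gt_eqF.
have r1 : - 2 * r < r by have := r0; lra.
have r2 : - 2 * r < - r by have := r0; lra.
have dplus : is_derive (0 : R) 1 (fun t => F (t + r)) (segment_angle r).
  rewrite -[segment_angle r]mulr1; apply: is_derive1_comp; last exact: is_derive_shift.
  by rewrite /= add0r; exact: dF.
have dminus : is_derive (0 : R) 1 (fun t => F (t - r)) (segment_angle (- r)).
  rewrite -[segment_angle (- r)]mulr1; apply: is_derive1_comp; last exact: is_derive_shift.
  by rewrite /= add0r; apply: dF; rewrite ?oppr_eq0.
have piE : segment_angle r - segment_angle (- r) = pi :> R.
  by rewrite segment_angleN /segment_angle divff// atan1; lra.
have dB := is_deriveB dplus dminus; rewrite piE in dB.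
apply: near_eq_is_derive dB.
by near=> t; rewrite FE//; near: t; apply: nbhs0_lt.
Unshelve. all: by end_near. Qed.

Lemma integral_segment_kernel (c x : R) :
  (\int[lam]_v (\1_(`[c - r, c + r]%classic) v * kre (c - v) x)%:E = (segment_angle x)%:E)%E.
Proof.
rewrite -integral_kre_segment [RHS]integral_mkcond.
have mf : measurable_fun setT (((fun s => (kre s x)%:E) \_ `[(- r)%R, r]) : RT -> \bar R).
  have [+ _] := measurable_restrictT (fun s : RT => (kre s x)%:E) (measurable_itv `[(- r)%R, r]).
  apply; apply: measurable_funTS; apply/measurable_EFinP.
  apply: measurable_funM => //; apply: measurable_funV; exact: measurable_funD.
rewrite -(@integral_isometry _ (-1) c _ (normrN1 _) mf).
apply: eq_integral => v _; rewrite patchE indicE mulN1r (addrC (- v)) !mem_setE !in_itv/=.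
have -> : (c - r <= v <= c + r) = (- r <= c - v <= r).
  by apply/idP/idP => /andP[? ?]; apply/andP; split; lra.
by case: ifPn => _; rewrite ?mul1r ?mul0r.
Qed.

Lemma integral_segment_angle (c x : R) :
  (\int[lam]_u (\1_(`[c - r, c + r]%classic) u * segment_angle (x - u))%:E =
   \int[lam]_(w in `[(x - c - r)%R, (x - c + r)%R]) (segment_angle w)%:E)%E.
Proof.
rewrite [RHS]integral_mkcond.
have mf : measurable_fun setT (((fun w => (segment_angle w)%:E) \_ `[(x - c - r)%R, (x - c + r)%R]) : RT -> \bar R).
  have [+ _] := measurable_restrictT (fun s : RT => (segment_angle s)%:E) (measurable_itv `[(x - c - r)%R, (x - c + r)%R]).
  apply; apply: measurable_funTS; apply/measurable_EFinP.
  exact: measurable_segment_angle.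
rewrite -(@integral_isometry _ (-1) x _ (normrN1 _) mf).
apply: eq_integral => v _; rewrite patchE indicE mulN1r (addrC (- v)) !mem_setE !in_itv/=.
have -> : (c - r <= v <= c + r) = (x - c - r <= x - v <= x - c + r).
  by apply/idP/idP => /andP[? ?]; apply/andP; split; lra.
by case: ifPn => _; rewrite ?mul1r ?mul0r.
Qed.

Lemma planar_density_square q : planar_density q r 1 (\1_(square q r)).
Proof.
split.
- exact: (measurable_indic (measurable_square q r)).
- by move=> p; rewrite indicE; case: (_ \in _); rewrite ?normr1 ?normr0.
- by move=> p rp; rewrite indicE memNset// /square/=; apply/negP; rewrite -ltNge.
Qed.

Lemma indic_square q p : \1_(square q r) p =
  \1_(`[q.1 - r, q.1 + r]%classic) p.1 * \1_(`[q.2 - r, q.2 + r]%classic) p.2 :> R.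
Proof. by rewrite squareE indicE in_setX -natrM mulnb. Qed.

(** Integrating over the first coordinate gives the angle; the remaining integral is
    over a window moving with x. *)
Lemma pot_re_square q x : pot kre (\1_(square q r)) (q.1, x) =
  \int[lam]_(w in `[x - q.2 - r, x - q.2 + r]) segment_angle w.
Proof.
have ig := integrable_pot (q.1, x) (@inverse_kernel_re R) (ltW r0) (planar_density_square q).
rewrite /pot /Rintegral -integral_segment_angle -(integral21_prod_meas1 ig); congr fine.
apply: eq_integral => u _; rewrite /fubini_G/=.
have [uq|uq] : \1_(`[q.2 - r, q.2 + r]%classic) u = (1 : R) \/
    \1_(`[q.2 - r, q.2 + r]%classic) u = (0 : R).
  by rewrite indicE; case: (_ \in _); [left|right].
  rewrite uq mul1r -(integral_segment_kernel q.1).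
  by apply: eq_integral => v _; rewrite indic_square/= uq mulr1.
rewrite uq mul0r; apply: integral0_eq => v _.
by rewrite indic_square/= uq mulr0 mul0r.
Qed.

Lemma pot_im_square q y : pot kim (\1_(square q r)) (y, q.2) =
  \int[lam]_(w in `[y - q.1 - r, y - q.1 + r]) segment_angle w.
Proof.
have ig := integrable_pot (y, q.2) (@inverse_kernel_im R) (ltW r0) (planar_density_square q).
rewrite /pot /Rintegral -integral_segment_angle -(integral12_prod_meas1 ig); congr fine.
apply: eq_integral => v _; rewrite /fubini_F/=.
have kimE a b : kim a b = kre b a by rewrite /kim /kre addrC.
have [vq|vq] : \1_(`[q.1 - r, q.1 + r]%classic) v = (1 : R) \/
    \1_(`[q.1 - r, q.1 + r]%classic) v = (0 : R).
  by rewrite indicE; case: (_ \in _); [left|right].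
  rewrite vq mul1r -(integral_segment_kernel q.2).
  by apply: eq_integral => u _; rewrite indic_square/= vq mul1r kimE.
rewrite vq mul0r; apply: integral0_eq => u _.
by rewrite indic_square/= vq !mul0r.
Qed.

Let is_derive_centred_window (c : R) :
  is_derive c 1 (fun x => \int[lam]_(w in `[x - c - r, x - c + r]) segment_angle w) pi.
Proof.
rewrite -[pi]mulr1.
apply: (@is_derive1_comp _ (fun t => \int[lam]_(w in `[t - r, t + r]) segment_angle w)
  (fun x => x - c)); last exact: is_derive_shift.
by rewrite subrr; exact: is_derive_window.
Qed.

Lemma pot_re_square_dx q :
  is_derive q.2 1 (fun x => pot kre (\1_(square q r)) (q.1, x)) pi.
Proof.
rewrite (funext (pot_re_square q)); exact: is_derive_centred_window.
Qed.

Lemma pot_im_square_dy q :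
  is_derive q.1 1 (fun y => pot kim (\1_(square q r)) (y, q.2)) pi.
Proof.
rewrite (funext (pot_im_square q)); exact: is_derive_centred_window.
Qed.

(** On the symmetry axes of the square the integrand is odd. *)
Lemma pot_re_square_eq0 q y : pot kre (\1_(square q r)) (y, q.2) = 0.
Proof.
have ig := integrable_pot (y, q.2) (@inverse_kernel_re R) (ltW r0) (planar_density_square q).
apply: (Rintegral_planar_odd2 (a := 2 * q.2) ig) => p /=.
rewrite -mulrN; congr (_ * _).
  rewrite !indic_square/=; congr (_ * _); rewrite !indicE !mem_setE !in_itv/=.
  by congr (_%:R); congr nat_of_bool; apply/idP/idP => /andP[? ?]; apply/andP; split; lra.
by rewrite /kre -mulNr; congr (_ / _); [ring|congr (_ + _); ring].
Qed.

Lemma pot_im_square_eq0 q x : pot kim (\1_(square q r)) (q.1, x) = 0.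
Proof.
have ig := integrable_pot (q.1, x) (@inverse_kernel_im R) (ltW r0) (planar_density_square q).
apply: (Rintegral_planar_odd1 (a := 2 * q.1) ig) => p /=.
rewrite -mulrN; congr (_ * _).
  rewrite !indic_square/=; congr (_ * _); rewrite !indicE !mem_setE !in_itv/=.
  by congr (_%:R); congr nat_of_bool; apply/idP/idP => /andP[? ?]; apply/andP; split; lra.
by rewrite /kim -mulNr; congr (_ / _); [ring|congr (_ + _); ring].
Qed.

End SquarePotential.

(** * The Cauchy-Riemann system of a potential *)

Section PlanarTheorem.
Context {R : realType}.
Local Notation lam := (@lebesgue_measure R).
Local Notation RT := (measurableTypeR R).
Local Notation mu2 := (lam \x lam)%E.
Implicit Types (p q : R * R) (g : R * R -> R).

Definition lipschitz_at g q : Prop := exists L, exists2 e, 0 < e &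
  forall p, supdist q p <= e -> `|g p - g q| <= L * supdist q p.

(** The constant k is meant to be g q, so that the remaining density vanishes at q. *)
Lemma pot_subtract_square K g q (r M k : R) u : inverse_kernel K -> 0 < r ->
  planar_density q r M g ->
  pot K g u = pot K (fun p => g p - k * \1_(square q r) p) u +
    k * pot K (\1_(square q r)) u.
Proof.
move=> iK r0 gd.
have ig := integrable_pot u iK (ltW r0) gd.
have i1 := integrable_pot u iK (ltW r0) (planar_density_square r q).
have ik := integrableZl measurableT k i1.
rewrite /pot -RintegralZl// -RintegralD//; last first.
  rewrite (_ : _ \o _ = (fun p => (g p * K (u.1 - p.1) (u.2 - p.2))%:E -
     (k * (\1_(square q r) p * K (u.1 - p.1) (u.2 - p.2)))%:E)%E).
    exact: integrableB.
  by apply/funext => p; rewrite /= -EFinB; congr EFin; ring.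
by apply: eq_Rintegral => p _; ring.
Qed.

(** A and B come from the part of the density that vanishes at q, and pi g q from the
    square.  Only the sum of the first and the fourth derivative and the difference of the
    other two matter, where A and B cancel, so they may stay anonymous. *)
Theorem pot_derive g q (r M : R) : 0 < r -> planar_density q r M g ->
  lipschitz_at g q -> exists A B,
  [/\ is_derive q.2 1 (fun x => pot kre g (q.1, x)) (pi * g q - A),
      is_derive q.2 1 (fun x => pot kim g (q.1, x)) (- B),
      is_derive q.1 1 (fun y => pot kre g (y, q.2)) (- B) &
      is_derive q.1 1 (fun y => pot kim g (y, q.2)) (pi * g q + A)].
Proof.
move=> r0 gd [L [e e0 lip]]; have [mg gM gs] := gd.
pose d p := g p - g q * \1_(square q r) p.
have M0 : 0 <= M := le_trans (normr_ge0 _) (gM q).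
have dout p : r < supdist q p -> d p = 0.
  move=> rp; rewrite /d gs// indicE memNset ?mulr0 ?subr0// /square/=.
  by apply/negP; rewrite -ltNge.
have din p : supdist q p <= r -> d p = g p - g q.
  by move=> rp; rewrite /d indicE mem_set ?mulr1.
(* A global Lipschitz constant at q: L near q, and 2 M / e beyond
   distance e.  It also bounds the density itself. *)
pose N := `|L| + 2 * M / e + 2 * M.
have Me0 : 0 <= 2 * M / e by rewrite divr_ge0 ?mulr_ge0// ltW.
have dM p : `|d p| <= 2 * M.
  have [/din ->|/dout ->] := leP (supdist q p) r; last by rewrite normr0 mulr_ge0.
  by apply: le_trans (ler_normB _ _) _; have := gM p; have := gM q; lra.
have N0 : 0 <= N by rewrite !addr_ge0// mulr_ge0.
have dd : planar_density q r N d.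
  split => //.
    apply: measurable_funB => //; apply: measurable_funM => //.
    exact: (measurable_indic (measurable_square q r)).
  move=> p; apply: le_trans (dM p) _; rewrite /N; have := normr_ge0 L; lra.
have dq p : `|d p| <= N * supdist q p.
  have s0 := supdist_ge0 q p.
  have [rp|/dout ->] := leP (supdist q p) r; last by rewrite normr0 mulr_ge0.
  have [ep|ep] := leP (supdist q p) e.
    rewrite din//; apply: le_trans (lip _ ep) _; apply: ler_wpM2r => //.
    by rewrite /N; have := ler_norm L; lra.
  apply: le_trans (dM p) _.
  apply: (@le_trans _ _ (2 * M / e * supdist q p)).
    by rewrite -mulrA ler_peMr ?mulr_ge0// mulrC ler_pdivlMr// mul1r ltW.
  apply: ler_wpM2r => //; rewrite /N; have := normr_ge0 L; lra.
have E K : inverse_kernel K -> forall u,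
    pot K g u = pot K d u + g q * pot K (\1_(square q r)) u.
  by move=> iK u; rewrite (pot_subtract_square (g q) u iK r0 gd).
have Ere := E _ (@inverse_kernel_re R); have Eim := E _ (@inverse_kernel_im R).
exists (cross_re q d q), (cross_im q d q); split.
- rewrite (_ : (fun _ => _) = (fun x => pot kre d (q.1, x)) +
      (g q) \*: (fun x => pot kre (\1_(square q r)) (q.1, x))); last first.
    by apply/funext => x; rewrite Ere.
  have d1 := pot_re_dx (ltW r0) N0 dd dq; have d2 := pot_re_square_dx r0 q.
  by apply: is_derive_eq; rewrite /GRing.scale/= mulrC addrC.
- rewrite (_ : (fun _ => _) = (fun x => pot kim d (q.1, x))); last first.
    by apply/funext => x; rewrite Eim pot_im_square_eq0// mulr0 addr0.
  exact: (pot_im_dx (ltW r0) N0 dd dq).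
- rewrite (_ : (fun _ => _) = (fun y => pot kre d (y, q.2))); last first.
    by apply/funext => x; rewrite Ere pot_re_square_eq0// mulr0 addr0.
  exact: (pot_re_dy (ltW r0) N0 dd dq).
- rewrite (_ : (fun _ => _) = (fun y => pot kim d (y, q.2)) +
      (g q) \*: (fun y => pot kim (\1_(square q r)) (y, q.2))); last first.
    by apply/funext => x; rewrite Eim.
  have d1 := pot_im_dy (ltW r0) N0 dd dq; have d2 := pot_im_square_dy r0 q.
  by apply: is_derive_eq; rewrite /GRing.scale/= mulrC addrC.
Qed.

End PlanarTheorem.

(** * Paravectors *)

Section CliffordVectors.
Context {R : realType} {m : nat}.
Local Notation Cl := (clifford R m).
Implicit Types (x : 'rV[R]_m.+1) (v w : 'rV[R]_m).

Lemma cl_vecN v : cl_vec (- v) = - cl_vec v.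
Proof.
by rewrite /cl_vec -sumrN; apply: eq_bigr => i _; rewrite mxE scaleNr.
Qed.

Lemma cl_vecZ (k : R) v : cl_vec (k *: v) = k *: cl_vec v.
Proof.
by rewrite /cl_vec scaler_sumr; apply: eq_bigr => i _; rewrite mxE scalerA.
Qed.

Lemma sqr_enorm k (v : 'rV[R]_k) : enorm v ^+ 2 = \sum_i v 0 i ^+ 2.
Proof. by rewrite sqr_sqrtr// sumr_ge0// => i _; exact: sqr_ge0. Qed.

Lemma enorm_ge0 k (v : 'rV[R]_k) : 0 <= enorm v.
Proof. exact: sqrtr_ge0. Qed.

Lemma enorm_eq0 k (v : 'rV[R]_k) : (enorm v == 0) = (v == 0).
Proof.
rewrite -sqrf_eq0 sqr_enorm; apply/idP/eqP => [|->].
  rewrite psumr_eq0 => [/allP v0|i _]; last exact: sqr_ge0.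
  apply/rowP => i; rewrite mxE; apply/eqP.
  by have := v0 i; rewrite mem_index_enum sqrf_eq0 => /(_ isT).
by rewrite big1// => i _; rewrite mxE expr0n.
Qed.

Lemma usphere_normalize k (v : 'rV[R]_k) : v != 0 -> usphere ((enorm v)^-1 *: v).
Proof.
rewrite -enorm_eq0 => v0; rewrite /usphere/=.
rewrite (_ : \sum_i _ = enorm v ^- 2 * \sum_i v 0 i ^+ 2).
  by rewrite -sqr_enorm mulVf// expf_neq0.
by rewrite mulr_sumr; apply: eq_bigr => i _; rewrite mxE exprMn exprVn.
Qed.

Lemma cl_vec_sqr v : cl_vec v * cl_vec v = - (enorm v ^+ 2)%:A.
Proof.
rewrite sqr_enorm; apply: (@scalerI _ _ (2 : R)); first by rewrite pnatr_eq0.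
rewrite scaler_nat mulr2n.
have vv : cl_vec v * cl_vec v = \sum_i \sum_j (v 0 i * v 0 j) *: (cl_gen R i * cl_gen R j).
  rewrite {1}/cl_vec mulr_suml; apply: eq_bigr => i _.
  rewrite mulr_sumr; apply: eq_bigr => j _.
  by rewrite -scalerAl -scalerAr scalerA.
rewrite {1}vv {1}exchange_big/= vv -big_split/=.
transitivity (\sum_(i < m) (- 2 * v 0 i ^+ 2)%:A : Cl).
  apply: eq_bigr => i _; rewrite -big_split/= (bigD1 i)//= big1 ?addr0.
    by rewrite -scalerDr cl_genM eqxx mulr1 scalerA expr2 mulrC.
  move=> j ji; rewrite (mulrC (v 0 j)) -scalerDr addrC cl_genM eq_sym (negbTE ji).
  by rewrite mulr0 scale0r scaler0.
rewrite -scaler_suml -mulr_sumr scalerN scalerA -scaleNr mulNr.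
by [].
Qed.

Lemma cl_conjD (x y : Cl) : cl_conj (x + y) = cl_conj x + cl_conj y.
Proof. by apply/ffunP => A; rewrite !ffunE mulrDr. Qed.

Lemma cl_conjZ (k : R) (x : Cl) : cl_conj (k *: x) = k *: cl_conj x.
Proof. by apply/ffunP => A; rewrite !ffunE; exact: mulrCA. Qed.

Lemma cl_conj1 : cl_conj 1 = 1 :> Cl.
Proof.
have -> : 1 = cl_basis R finset.set0 :> Cl by [].
apply/ffunP => A; rewrite !ffunE.
by have [->|] := eqVneq A finset.set0; rewrite ?mulr0// cards0 mul0n div0n mul1r.
Qed.

Lemma cl_conj_gen i : cl_conj (cl_gen R i) = - cl_gen R i :> Cl.
Proof.
apply/ffunP => A; rewrite !ffunE.
have [->|] := eqVneq A (finset.set1 i); rewrite ?mulr0 ?oppr0//.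
by rewrite cards1 mul1n divnn expr1 mulN1r.
Qed.

Lemma cl_conj_vec v : cl_conj (cl_vec v) = - cl_vec v.
Proof.
rewrite /cl_vec (big_morph _ cl_conjD (_ : cl_conj 0 = 0)) ?raddf0//.
  by rewrite -sumrN; apply: eq_bigr => i _; rewrite cl_conjZ cl_conj_gen scalerN.
by rewrite -[X in cl_conj X](scale0r (0 : Cl)) cl_conjZ scale0r.
Qed.

Lemma cl_conj_para x : cl_conj (para x) = (sc x)%:A - cl_vec (vec x).
Proof. by rewrite /para cl_conjD cl_conjZ cl_conj1 cl_conj_vec. Qed.

Lemma sqr_enorm_para x : enorm x ^+ 2 = sc x ^+ 2 + enorm (vec x) ^+ 2.
Proof.
rewrite !sqr_enorm big_ord_recl; congr (_ + _).
by apply: eq_bigr => i _; rewrite mxE.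
Qed.

(** For w nonzero, 1 and [cl_vec w] span a copy of the complex numbers; if the element
    is zero, both sides are zero because the inverse of zero is zero. *)
Lemma cl_inv_linear (s t : R) w :
  (s%:A + t *: cl_vec w)^-1 =
  (s ^+ 2 + t ^+ 2 * enorm w ^+ 2)^-1 *: (s%:A - t *: cl_vec w).
Proof.
set n := _ + _ * _; set z := _ + _; set z' := _ - _.
have zz' : z * z' = n%:A.
  rewrite /z /z' mulrBr !mulrDl -!scalerAl -!scalerAr !mul1r !mulr1 cl_vec_sqr.
  rewrite !scalerN !scalerA (mulrC t s) opprD opprK addrA addrK -scalerDl.
  by rewrite /n !expr2 mulrA.
have z'z : z' * z = n%:A.
  rewrite /z /z' mulrDr !mulrBl -!scalerAl -!scalerAr !mul1r !mulr1 cl_vec_sqr.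
  rewrite !scalerN !scalerA (mulrC t s) opprK addrA subrK -scalerDl.
  by rewrite /n !expr2 mulrA.
have [n0|n0] := eqVneq n 0.
  suff z0 : z = 0 by rewrite n0 z0 !invr0 scale0r.
  move/eqP: n0; rewrite /n paddr_eq0 ?sqr_ge0//; last by rewrite mulr_ge0 ?sqr_ge0.
  rewrite sqrf_eq0 [X in _ && X]mulf_eq0 !sqrf_eq0 enorm_eq0.
  by rewrite /z => /andP[/eqP -> /orP[/eqP ->|/eqP ->]];
    rewrite ?scale0r ?add0r// -[0 : 'rV_m](scale0r 0) cl_vecZ scale0r scaler0.
have zi : z * (n^-1 *: z') = 1 by rewrite -scalerAr zz' scalerA mulVf// scale1r.
have iz : (n^-1 *: z') * z = 1 by rewrite -scalerAl z'z scalerA mulVf// scale1r.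
have zu : z \is a GRing.unit by apply/unitrP; exists (n^-1 *: z').
by apply: (mulrI zu); rewrite divrr// zi.
Qed.

End CliffordVectors.

(** * The slice Cauchy kernel in real coordinates *)

Section SliceKernel.
Context {R : realType} {m : nat}.
Local Notation Cl := (clifford R m).
Implicit Types (q x : 'rV[R]_m.+1) (w : 'rV[R]_m).

Definition cl_dir w : Cl := (enorm w)^-1 *: cl_vec w.

Lemma cl_vec_dir w : cl_vec w = enorm w *: cl_dir w.
Proof.
have [|w0] := eqVneq (enorm w) 0.
  move=> w0; rewrite w0 scale0r; move/eqP: w0; rewrite enorm_eq0 => /eqP ->.
  by rewrite -[0 : 'rV_m](scale0r 0) cl_vecZ scale0r.
by rewrite /cl_dir scalerA mulfV// scale1r.
Qed.

Lemma cl_dir_sqr w : w != 0 -> cl_dir w * cl_dir w = -1.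
Proof.
rewrite -enorm_eq0 => w0; rewrite /cl_dir -scalerAl -scalerAr scalerA cl_vec_sqr.
by rewrite scalerN scalerA -invfM expr2 mulVf ?mulf_neq0// scale1r.
Qed.

Lemma cl_dirN w : cl_dir (- w) = - cl_dir w.
Proof.
rewrite /cl_dir cl_vecN scalerN; congr (- (_^-1 *: _)).
by congr Num.sqrt; apply: eq_bigr => i _; rewrite mxE sqrrN.
Qed.

Section Coefficients.
Variables (b al v : R).
(** The product of the squared distances, in the plane, from the point to q and to its
    conjugate. *)
Definition pole_norm := (al ^+ 2 + (b - v) ^+ 2) * (al ^+ 2 + (b + v) ^+ 2).
(** The coefficients of 1, I, J and I J in minus the kernel, with al = a - u. *)
Definition kcoef1 := al * (al ^+ 2 + b ^+ 2 + v ^+ 2) / pole_norm.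
Definition kcoef2 := b * (v ^+ 2 - al ^+ 2 - b ^+ 2) / pole_norm.
Definition kcoef3 := v * (al ^+ 2 - b ^+ 2 + v ^+ 2) / pole_norm.
Definition kcoef4 := - 2 * al * b * v / pole_norm.
End Coefficients.

Definition slice_factor1 q v u : Cl :=
  (kcoef1 (enorm (vec q)) (sc q - u) v)%:A +
  kcoef2 (enorm (vec q)) (sc q - u) v *: cl_dir (vec q).

Definition slice_factor2 q v u : Cl :=
  (kcoef3 (enorm (vec q)) (sc q - u) v)%:A +
  kcoef4 (enorm (vec q)) (sc q - u) v *: cl_dir (vec q).

(** The quadratic polynomial of q is an affine function of the vector part of q, hence is
    inverted by [cl_inv_linear]; its norm is a product over the two poles, [pole_norm]. *)
Lemma slice_cauchy_kernelE q x : vec q != 0 -> vec x != 0 ->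
  slice_cauchy_kernel q x = - (slice_factor1 q (enorm (vec x)) (sc x) +
    slice_factor2 q (enorm (vec x)) (sc x) * cl_dir (vec x)).
Proof.
rewrite -!enorm_eq0 => q0 x0; congr (- _).
rewrite cl_conj_para sqr_enorm_para /para.
rewrite /slice_factor1 /slice_factor2 /kcoef1 /kcoef2 /kcoef3 /kcoef4 /pole_norm.
rewrite /cl_dir; set b := enorm (vec q); set v := enorm (vec x).
set a := sc q; set u := sc x; set vq := cl_vec (vec q); set vx := cl_vec (vec x).
have vqq : vq * vq = - (b ^+ 2)%:A by rewrite /vq cl_vec_sqr.
pose s := (a - u) ^+ 2 - b ^+ 2 + v ^+ 2.
pose t := 2 * (a - u).
have -> : (a%:A + vq) ^+ 2 - (2 * u) *: (a%:A + vq) + (u ^+ 2 + v ^+ 2)%:A =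
    s%:A + t *: vq.
  rewrite expr2 mulrDl !mulrDr -!scalerAl -!scalerAr !mul1r !mulr1 vqq.
  apply/ffunP => A; rewrite !ffunE /GRing.scale/=; move: (vq A) ((1 : Cl) A) => V E.
  by rewrite /s /t; ring.
rewrite cl_inv_linear -/b -/vq.
have -> : s ^+ 2 + t ^+ 2 * b ^+ 2 =
    ((a - u) ^+ 2 + (b - v) ^+ 2) * ((a - u) ^+ 2 + (b + v) ^+ 2).
  by rewrite /s /t; ring.
set n := ((a - u) ^+ 2 + (b - v) ^+ 2) * _.
have -> : a%:A + vq - (u%:A - vx) = (a - u)%:A + vq + vx.
  apply/ffunP => A; rewrite !ffunE /GRing.scale/=; ring.
rewrite ?(mulrDl, mulrDr, mulNr) -?scalerAl -?scalerAr ?mul1r ?mulr1.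
rewrite ?(mulrDl, mulrDr, mulNr) -?scalerAl -?scalerAr ?mul1r ?mulr1 vqq.
apply/ffunP => A; rewrite !ffunE /GRing.scale/= /s /t.
move: (vq A) (vx A) ((vq * vx) A) ((A == finset.set0)%:R) n^-1 => V X W E n'.
by field; apply/andP.
Qed.

(** The terms of degree one in J cancel, and J squares to - 1 in those of degree two. *)
Lemma slice_symmetrize (J X Y F G : Cl) : J * J = -1 ->
  (X + Y * J) * (F + J * G) + (X + Y * - J) * (F + - J * G) =
  2 *: (X * F - Y * G).
Proof.
move=> JJ; rewrite !mulrDl !mulrDr !mulrN !mulNr !mulrN !opprK.
have -> : Y * J * (J * G) = - (Y * G) by rewrite -mulrA (mulrA J) JJ mulN1r mulrN.
by apply/ffunP => A; rewrite !ffunE /GRing.scale/=; ring.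
Qed.

End SliceKernel.

(** * Norm and measurability in the algebra *)

Section CliffordNorm.
Context {R : realType} {m : nat}.
Local Notation Cl := (clifford R m).
Implicit Types (X Y : Cl).

Definition cl_norm X : R := \sum_A `|X A|.

Lemma cl_norm_ge0 X : 0 <= cl_norm X.
Proof. exact: sumr_ge0. Qed.

Lemma le_cl_norm X A : `|X A| <= cl_norm X.
Proof. by rewrite /cl_norm (bigD1 A)//= lerDl sumr_ge0. Qed.

Lemma cl_normD X Y : cl_norm (X + Y) <= cl_norm X + cl_norm Y.
Proof. by rewrite -big_split; apply: ler_sum => A _; rewrite ffunE ler_normD. Qed.

Lemma cl_normZ (k : R) X : cl_norm (k *: X) = `|k| * cl_norm X.
Proof. by rewrite /cl_norm mulr_sumr; apply: eq_bigr => A _; rewrite ffunE normrM. Qed.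

Lemma cl_norm_sum I (r : seq I) (P : pred I) (F : I -> Cl) :
  cl_norm (\sum_(i <- r | P i) F i) <= \sum_(i <- r | P i) cl_norm (F i).
Proof.
elim/big_ind2 : _ => //.
- by rewrite /cl_norm big1// => A _; rewrite ffunE normr0.
- by move=> a x b y ax bY; apply: le_trans (cl_normD _ _) _; exact: lerD.
Qed.

Lemma cl_norm_basis A : cl_norm (cl_basis R A) = 1.
Proof.
rewrite /cl_norm (bigD1 A)//= ffunE eqxx normr1 big1 ?addr0// => B BA.
by rewrite ffunE (negbTE BA) normr0.
Qed.

Lemma cl_normM X Y : cl_norm (X * Y) <= cl_norm X * cl_norm Y.
Proof.
rewrite {1}/GRing.mul/= /cl_mul.
apply: le_trans (cl_norm_sum _ _ _) _; rewrite mulr_suml; apply: ler_sum => A _.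
apply: le_trans (cl_norm_sum _ _ _) _; rewrite mulr_sumr; apply: ler_sum => B _.
by rewrite cl_normZ cl_norm_basis mulr1 normrM normr_sign mul1r normrM.
Qed.

Lemma cl_norm1 : cl_norm 1 = 1.
Proof. exact: (cl_norm_basis finset.set0). Qed.

Lemma cl_norm_dir (w : 'rV[R]_m) : cl_norm (cl_dir w) <= m%:R.
Proof.
rewrite cl_normZ.
have [->|w0] := eqVneq (enorm w) 0; first by rewrite invr0 normr0 mul0r.
rewrite normfV ger0_norm ?enorm_ge0// mulrC ler_pdivrMr ?lt_def ?w0 ?enorm_ge0//.
apply: le_trans (cl_norm_sum _ _ _) _.
apply: (@le_trans _ _ (\sum_(i < m) enorm w)).
  apply: ler_sum => i _; rewrite cl_normZ cl_norm_basis mulr1.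
  rewrite /enorm -sqrtr_sqr ler_sqrt; last by apply: sumr_ge0 => j _; exact: sqr_ge0.
  by rewrite (bigD1 i)//= lerDl; apply: sumr_ge0 => j _; exact: sqr_ge0.
by rewrite sumr_const card_ord mulr_natl.
Qed.

End CliffordNorm.

Section CliffordMeasurable.
Context {R : realType} {m : nat} d (T : measurableType d).
Local Notation Cl := (clifford R m).
Local Notation RT := (measurableTypeR R).
Implicit Types (g h : T -> Cl).

Definition cl_measurable g : Prop :=
  forall A, measurable_fun setT (fun t => g t A : RT).

Lemma cl_measurable_cst X : cl_measurable (cst X).
Proof. by move=> A; exact: measurable_cst. Qed.

Lemma cl_measurableD g h : cl_measurable g -> cl_measurable h ->
  cl_measurable (fun t => g t + h t).
Proof.
move=> mg mh A; under eq_fun do rewrite ffunE.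
exact: (measurable_funD (mg A) (mh A)).
Qed.

Lemma cl_measurableN g : cl_measurable g -> cl_measurable (fun t => - g t).
Proof.
move=> mg A; under eq_fun do rewrite ffunE.
exact: (measurable_funN (mg A)).
Qed.

Lemma cl_measurableZ (k : T -> RT) g : measurable_fun setT k -> cl_measurable g ->
  cl_measurable (fun t => (k t : R) *: g t).
Proof.
move=> mk mg A; under eq_fun do rewrite ffunE.
exact: (measurable_funM mk (mg A)).
Qed.

Lemma cl_measurableM g h : cl_measurable g -> cl_measurable h ->
  cl_measurable (fun t => g t * h t).
Proof.
move=> mg mh C.
rewrite (_ : (fun t => _) = (fun t => \sum_A (-1) ^+ clsign A (symd A C) *
    (g t A * h t (symd A C)) : RT)); last by apply/funext => t; exact: cl_mulE.
apply: measurable_sum => A; apply: measurable_funM => //.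
exact: (measurable_funM (mg A) (mh _)).
Qed.

Lemma cl_measurable_sum I (r : seq I) (F : I -> T -> Cl) :
  (forall i, cl_measurable (F i)) -> cl_measurable (fun t => \sum_(i <- r) F i t).
Proof.
move=> mF A; under eq_fun do rewrite sum_ffunE.
by apply: measurable_sum => i; exact: mF.
Qed.

End CliffordMeasurable.

(** * Planar integrals of the kernel coefficients *)

Section PlanarCoefficients.
Context {R : realType}.
Local Notation lam := (@lebesgue_measure R).
Local Notation RT := (measurableTypeR R).
Local Notation mu2 := (lam \x lam)%E.
Implicit Types (p q : R * R).

Section Pointwise.
Variables b al v : R.
Hypotheses (hm : al ^+ 2 + (b - v) ^+ 2 != 0) (hp : al ^+ 2 + (b + v) ^+ 2 != 0).

(** Partial fractions: on the line al = 0 the poles are v = b and v = - b. *)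
Lemma kcoef1E : kcoef1 b al v = 1 / 2 * (kre (b - v) al + 1 * kre (b + v) al).
Proof. by rewrite /kcoef1 /pole_norm /kre; field; rewrite hm hp. Qed.

Lemma kcoef2E : kcoef2 b al v = - 1 / 2 * (kim (b - v) al + 1 * kim (b + v) al).
Proof. by rewrite /kcoef2 /pole_norm /kim; field; rewrite hm hp. Qed.

Lemma kcoef3E : kcoef3 b al v = - 1 / 2 * (kim (b - v) al + - 1 * kim (b + v) al).
Proof. by rewrite /kcoef3 /pole_norm /kim; field; rewrite hm hp. Qed.

Lemma kcoef4E : kcoef4 b al v = - 1 / 2 * (kre (b - v) al + - 1 * kre (b + v) al).
Proof. by rewrite /kcoef4 /pole_norm /kre; field; rewrite hm hp. Qed.

End Pointwise.

Definition pole_bound (b al v : R) :=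
  (Num.max `|b - v| `|al|)^-1 + (Num.max `|b + v| `|al|)^-1.

Lemma pole_bound_ge0 b al v : 0 <= pole_bound b al v.
Proof. by rewrite addr_ge0// invr_ge0 le_max normr_ge0. Qed.

Lemma le_pole_bound (b al v s e k : R) (K : R -> R -> R) : inverse_kernel K ->
  `|s| = 1 -> `|e| = 1 ->
  (pole_norm b al v = 0 -> k = 0) ->
  (al ^+ 2 + (b - v) ^+ 2 != 0 -> al ^+ 2 + (b + v) ^+ 2 != 0 ->
    k = s / 2 * (K (b - v) al + e * K (b + v) al)) ->
  `|k| <= pole_bound b al v.
Proof.
move=> [_ Kb] s1 e1 k0 kE; have [n0|n0] := eqVneq (pole_norm b al v) 0.
  by rewrite k0// normr0 pole_bound_ge0.
move: n0; rewrite mulf_eq0 negb_or => /andP[hm hp]; rewrite (kE hm hp).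
rewrite normrM normf_div s1 (ger0_norm (_ : 0 <= 2))//.
have h1 := Kb (b - v) al; have h2 := Kb (b + v) al.
have := ler_normD (K (b - v) al) (e * K (b + v) al); rewrite normrM e1 mul1r.
have := pole_bound_ge0 b al v; rewrite /pole_bound.
have := normr_ge0 (K (b - v) al); have := normr_ge0 (K (b + v) al).
lra.
Qed.

Let n1 : `|1 : R| = 1. Proof. exact: normr1. Qed.
Let nN1 : `|- 1 : R| = 1. Proof. exact: normrN1. Qed.

Lemma kcoef1_bound b al v : `|kcoef1 b al v| <= pole_bound b al v.
Proof.
apply: (le_pole_bound inverse_kernel_re n1 n1); last exact: kcoef1E.
by rewrite /kcoef1 => ->; rewrite invr0 mulr0.
Qed.

Lemma kcoef2_bound b al v : `|kcoef2 b al v| <= pole_bound b al v.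
Proof.
apply: (le_pole_bound inverse_kernel_im nN1 n1); last exact: kcoef2E.
by rewrite /kcoef2 => ->; rewrite invr0 mulr0.
Qed.

Lemma kcoef3_bound b al v : `|kcoef3 b al v| <= pole_bound b al v.
Proof.
apply: (le_pole_bound inverse_kernel_im nN1 nN1); last exact: kcoef3E.
by rewrite /kcoef3 => ->; rewrite invr0 mulr0.
Qed.

Lemma kcoef4_bound b al v : `|kcoef4 b al v| <= pole_bound b al v.
Proof.
apply: (le_pole_bound inverse_kernel_re nN1 nN1); last exact: kcoef4E.
by rewrite /kcoef4 => ->; rewrite invr0 mulr0.
Qed.

Lemma measurable_coefs (d : measure_display) (T : measurableType d) (v u : T -> RT) b a :
  measurable_fun setT v -> measurable_fun setT u ->
  [/\ measurable_fun setT (fun t => kcoef1 b (a - u t) (v t) : RT),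
      measurable_fun setT (fun t => kcoef2 b (a - u t) (v t) : RT),
      measurable_fun setT (fun t => kcoef3 b (a - u t) (v t) : RT) &
      measurable_fun setT (fun t => kcoef4 b (a - u t) (v t) : RT)].
Proof.
move=> mv mu.
have mal : measurable_fun setT (fun t => a - u t : RT) by exact: measurable_funB.
have mal2 := measurable_funX 2 mal; have mv2 := measurable_funX 2 mv.
have mm : measurable_fun setT (fun t => b - v t : RT) by exact: measurable_funB.
have mp : measurable_fun setT (fun t => b + v t : RT) by exact: measurable_funD.
have mi : measurable_fun setT (fun t => (pole_norm b (a - u t) (v t))^-1 : RT).
  apply: measurable_funV; apply: measurable_funM; apply: measurable_funD => //;
    exact: measurable_funX.
have mb (k : R) : measurable_fun setT (cst k : T -> RT) by exact: measurable_cst.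
split; apply: measurable_funM => //.
- by apply: measurable_funM => //; apply: measurable_funD => //; apply: measurable_funD.
- by apply: measurable_funM => //; apply: measurable_funB => //; apply: measurable_funB.
- by apply: measurable_funM => //; apply: measurable_funD => //; apply: measurable_funB.
- apply: measurable_funM => //; apply: measurable_funM => //.
  exact: (measurable_funM (mb (-2)) mal).
Qed.

(** The reflection of v exchanges the poles b and - b, and the parities e of phi and t of K
    make the two contributions equal; o is the odd function that carries the difference.
    The partial fractions hold off the line where the denominators can vanish. *)
Lemma coef_integral (k : R -> R -> R -> R) K (s e t b a : R) phi c (r M : R) :
  inverse_kernel K -> 0 <= r -> planar_density c r M phi ->
  e * e = 1 -> (forall p, phi (- p.1, p.2) = e * phi p) ->
  (forall y x, K (- y) x = t * K y x) -> t * t = 1 ->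
  measurable_fun setT (fun p : RT * RT => k b (a - p.2) p.1 : RT) ->
  (forall al v, al ^+ 2 + (b - v) ^+ 2 != 0 -> al ^+ 2 + (b + v) ^+ 2 != 0 ->
    k b al v = s / 2 * (K (b - v) al + e * K (b + v) al)) ->
  \int[mu2]_p (k b (a - p.2) p.1 * phi p) = s * pot K phi (b, a).
Proof.
move=> iK r0 dphi ee phie Kt tt mk kE; have [mphi _ _] := dphi.
have i1 := integrable_pot (b, a) iK r0 dphi.
have i2 := integrable_pot (- b, a) iK r0 dphi.
have mK1 := measurable_shifted_kernel (b, a) iK.
have mK2 := measurable_shifted_kernel (- b, a) iK.
pose o p := (s / 2 * (e * t)) * (phi p * K (- b - p.1) (a - p.2)) +
  (- (s / 2)) * (phi p * K (b - p.1) (a - p.2)).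
have j2 := integrableZl measurableT (s / 2 * (e * t)) i2.
have j1 := integrableZl measurableT (- (s / 2)) i1.
have io : mu2.-integrable setT (EFin \o o) := integrableD measurableT j2 j1.
have o0 : \int[mu2]_p o p = 0.
  apply: (Rintegral_planar_odd1 (a := 0) io) => -[v u] /=.
  rewrite /o/= !sub0r (phie (v, u))/= opprK.
  have -> : K (- b + v) (a - u) = t * K (b - v) (a - u) by rewrite -Kt opprB addrC.
  have -> : K (- b - v) (a - u) = t * K (b + v) (a - u) by rewrite -Kt opprD.
  have Ee : s / 2 * (e * t) * (e * phi (v, u) * (t * K (b - v) (a - u))) =
      (e * e) * (t * t) * (s / 2 * (phi (v, u) * K (b - v) (a - u))) by ring.
  rewrite Ee ee tt.
  have -> : s / 2 * (e * t) * (phi (v, u) * (t * K (b + v) (a - u))) =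
    (t * t) * (s / 2 * e * (phi (v, u) * K (b + v) (a - u))) by ring.
  rewrite tt; ring.
rewrite -[RHS]addr0 -o0 /pot -RintegralZl// -RintegralD//; last first.
  exact: (integrableZl measurableT s i1).
apply: (@eq_Rintegral_off_line _ _ _ a).
- exact: measurable_funM.
- by have /measurable_int/measurable_EFinP :=
    integrableD measurableT (integrableZl measurableT s i1) io.
move=> [v u] /= ua; have al0 : a - u != 0 by rewrite subr_eq0 eq_sym.
have h2 (y : R) : (a - u) ^+ 2 + y ^+ 2 != 0.
  by rewrite gt_eqF// ltr_pwDl ?sqr_ge0// exprn_even_gt0.
rewrite kE// /o/=.
have -> : K (- b - v) (a - u) = t * K (b + v) (a - u) by rewrite -Kt opprD.
have -> : s / 2 * (e * t) * (phi (v, u) * (t * K (b + v) (a - u))) =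
    (t * t) * (s / 2 * e * (phi (v, u) * K (b + v) (a - u))) by ring.
by rewrite tt; field.
Qed.

Lemma kreN (y x : R) : kre (- y) x = 1 * kre y x.
Proof. by rewrite /kre sqrrN mul1r. Qed.

Lemma kimN (y x : R) : kim (- y) x = - 1 * kim y x.
Proof. by rewrite /kim sqrrN mulN1r mulNr. Qed.

Section Four.
Variables (phi : R * R -> R) (c : R * R) (r M b a : R).
Hypotheses (r0 : 0 <= r) (dphi : planar_density c r M phi).

Let mcoef := measurable_coefs b a measurable_fst measurable_snd.

Lemma integral_coef1 : (forall p, phi (- p.1, p.2) = phi p) ->
  \int[mu2]_p (kcoef1 b (a - p.2) p.1 * phi p) = pot kre phi (b, a).
Proof.
move=> even; have [m1 _ _ _] := mcoef; rewrite -[RHS]mul1r.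
apply: (coef_integral inverse_kernel_re r0 dphi (e := 1) (t := 1)) => //.
- by rewrite mulr1.
- by move=> p; rewrite mul1r.
- exact: kreN.
- by rewrite mulr1.
- exact: kcoef1E.
Qed.

Lemma integral_coef2 : (forall p, phi (- p.1, p.2) = phi p) ->
  \int[mu2]_p (kcoef2 b (a - p.2) p.1 * phi p) = - 1 * pot kim phi (b, a).
Proof.
move=> even; have [_ m1 _ _] := mcoef.
apply: (coef_integral inverse_kernel_im r0 dphi (e := 1) (t := -1)) => //.
- by rewrite mulr1.
- by move=> p; rewrite mul1r.
- exact: kimN.
- by rewrite mulrNN mulr1.
- exact: kcoef2E.
Qed.

Lemma integral_coef3 : (forall p, phi (- p.1, p.2) = - phi p) ->
  \int[mu2]_p (kcoef3 b (a - p.2) p.1 * phi p) = - 1 * pot kim phi (b, a).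
Proof.
move=> odd; have [_ _ m1 _] := mcoef.
apply: (coef_integral inverse_kernel_im r0 dphi (e := - 1) (t := -1)) => //.
- by rewrite mulrNN mulr1.
- by move=> p; rewrite mulN1r.
- exact: kimN.
- by rewrite mulrNN mulr1.
- exact: kcoef3E.
Qed.

Lemma integral_coef4 : (forall p, phi (- p.1, p.2) = - phi p) ->
  \int[mu2]_p (kcoef4 b (a - p.2) p.1 * phi p) = - 1 * pot kre phi (b, a).
Proof.
move=> odd; have [_ _ _ m1] := mcoef.
apply: (coef_integral inverse_kernel_re r0 dphi (e := - 1) (t := 1)) => //.
- by rewrite mulrNN mulr1.
- by move=> p; rewrite mulN1r.
- exact: kreN.
- by rewrite mulr1.
- exact: kcoef4E.
Qed.

End Four.

End PlanarCoefficients.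

(** * Potentials with values in the algebra *)

Section CliffordPotential.
Context {R : realType} {m : nat}.
Local Notation lam := (@lebesgue_measure R).
Local Notation RT := (measurableTypeR R).
Local Notation mu2 := (lam \x lam)%E.
Local Notation Cl := (clifford R m).
Implicit Types (p q : R * R) (Phi : R * R -> Cl).

(** Supports are described around a common centre, but [pot_derive] wants them around the
    point of differentiation. *)
Lemma planar_density_recenter c c' (r M : R) g : planar_density c r M g ->
  planar_density c' (supdist c' c + r) M g.
Proof.
move=> [mg gM gs]; split => // p rp; apply: gs.
rewrite -(ltrD2l (supdist c' c)); apply: lt_le_trans rp _.
exact: supdist_triangle.
Qed.

Definition cl_density (r M : R) Phi : Prop :=
  forall A, planar_density 0 r M (fun p => Phi p A).

Definition cl_pot (K : R -> R -> R) Phi q : Cl :=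
  [ffun A => pot K (fun p => Phi p A) q].

Lemma cl_mul_constE (X : Cl) (Y : Cl) A :
  (X * Y) A = \sum_B (-1) ^+ clsign B (symd B A) * X B * Y (symd B A).
Proof.
rewrite [LHS]cl_mulE; apply: eq_bigr => B _; exact: mulrA.
Qed.

Lemma cl_density_mul (X : Cl) r M Phi : 0 <= M -> cl_density r M Phi ->
  cl_density r (cl_norm X * M) (fun p => X * Phi p).
Proof.
move=> M0 dPhi A; split.
- apply: (cl_measurableM (g := cst X) (h := Phi : RT * RT -> Cl)).
    exact: cl_measurable_cst.
  by move=> B; have [] := dPhi B.
- move=> p; rewrite cl_mul_constE mulr_suml.
  apply: le_trans (ler_norm_sum _ _ _) _; apply: ler_sum => B _.
  rewrite !normrM normr_sign mul1r ler_wpM2l//.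
  by have [_ + _] := dPhi (symd B A); apply.
- move=> p rp; rewrite cl_mul_constE big1// => B _.
  by have [_ _ ->//] := dPhi (symd B A); rewrite mulr0.
Qed.

(** Left multiplication by a constant is a linear combination of components. *)
Lemma cl_potM K (X : Cl) r M Phi q : inverse_kernel K -> 0 <= r ->
  cl_density r M Phi -> cl_pot K (fun p => X * Phi p) q = X * cl_pot K Phi q.
Proof.
move=> iK r0 dPhi; apply/ffunP => A; rewrite ffunE cl_mul_constE /pot.
have iB B : mu2.-integrable setT (EFin \o (fun p => (-1) ^+ clsign B (symd B A) * X B *
    (Phi p (symd B A) * K (q.1 - p.1) (q.2 - p.2)))).
  exact: (integrableZl measurableT _ (integrable_pot q iK r0 (dPhi (symd B A)))).
transitivity (\int[mu2]_p \sum_B ((-1) ^+ clsign B (symd B A) * X B *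
    (Phi p (symd B A) * K (q.1 - p.1) (q.2 - p.2)))).
  apply: eq_Rintegral => p _; rewrite cl_mul_constE mulr_suml.
  by apply: eq_bigr => B _; rewrite mulrA.
rewrite /Rintegral; under eq_integral do rewrite -sumEFin.
rewrite integral_sum// -sum_fine; last first.
  by move=> B _; exact: integrable_fin_num (iB B).
apply: eq_bigr => B _; rewrite ffunE.
by rewrite /pot -RintegralZl//; exact: (integrable_pot q iK r0 (dPhi (symd B A))).
Qed.

End CliffordPotential.

Section AxialKernel.
Context {R : realType} {n : nat}.
Local Notation m := n.+1.
Local Notation lam := (@lebesgue_measure R).
Local Notation RT := (measurableTypeR R).
Local Notation mu2 := (lam \x lam)%E.
Local Notation Cl := (clifford R m).
Local Notation tupleR k := (k.-tuple RT).

Definition axial_weight (v : R) : R := 2 / (surface_area (@usphere R m) * v ^+ n).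

(** The area of the spheres is exactly cancelled by the weight of the kernel. *)
Lemma axial_weight_density (v : R) : v != 0 -> axial_density n v * axial_weight `|v| = 1.
Proof.
move=> v0; rewrite /axial_density /axial_weight surface_area_usphere.
have V0 : @ball_volume R n != 0 by rewrite gt_eqF// ball_volume_gt0.
have vn : `|v| ^+ n != 0 by rewrite expf_neq0// normr_eq0.
by field; rewrite V0 vn /= addrC natr1 pnatr_eq0.
Qed.

Lemma axial_weight_ge0 (v : R) : 0 <= v -> 0 <= axial_weight v.
Proof.
move=> v0; rewrite divr_ge0// mulr_ge0 ?exprn_ge0// ltW//.
exact: surface_area_usphere_gt0.
Qed.

(** At v = 0 the left-hand side may be 0 instead of 1, since the inverse of zero is zero. *)
Lemma axial_weight_density_le1 (v : R) : axial_density n v * axial_weight `|v| <= 1.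
Proof.
have [->|v0] := eqVneq v 0; last by rewrite axial_weight_density.
rewrite normr0 /axial_density /axial_weight normr0 surface_area_usphere.
have V0 : @ball_volume R n != 0 by rewrite gt_eqF// ball_volume_gt0.
have [->|n0] := eqVneq n 0%N; last by rewrite expr0n (negbTE n0) mulr0 mul0r.
rewrite !expr0 !mulr1 le_eqVlt; apply/orP; left; apply/eqP; field.
by rewrite gt_eqF// ball_volume_gt0.
Qed.

End AxialKernel.

(** * Reduction of the volume integral to a slice *)

Section AxialIntegrand.
Context {R : realType} {n : nat}.
Local Notation m := n.+1.
Local Notation lam := (@lebesgue_measure R).
Local Notation RT := (measurableTypeR R).
Local Notation mu2 := (lam \x lam)%E.
Local Notation Cl := (clifford R m).
Local Notation tupleR k := (k.-tuple RT).
Implicit Types (q : 'rV[R]_m.+1) (t : tupleR m.+1).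

Definition tvec t : 'rV[R]_m := row_of_tuple (tail_tuple t).
Definition trad t : R := tnorm (tail_tuple t).
Definition tsc t : R := thead t.

Lemma measurable_trad : measurable_fun setT (trad : tupleR m.+1 -> RT).
Proof. exact: (measurableT_comp (@measurable_tnorm R m) (@measurable_tail R m)). Qed.

Lemma measurable_tsc : measurable_fun setT (tsc : tupleR m.+1 -> RT).
Proof. exact: measurable_thead. Qed.

Lemma measurable_tpair : measurable_fun setT (fun t => (trad t, tsc t) : RT * RT).
Proof. exact: measurable_fun_pair measurable_trad measurable_tsc. Qed.

Lemma cl_measurable_dir : cl_measurable (fun t => cl_dir (tvec t)).
Proof.
apply: cl_measurableZ; first by apply: measurable_funV; exact: measurable_trad.
apply: cl_measurable_sum => i; apply: cl_measurableZ; last exact: cl_measurable_cst.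
rewrite (_ : (fun t => _) = (fun t => tnth t (lift ord0 i) : RT)).
  exact: measurable_tnth.
apply/funext => t; rewrite mxE (tnth_nth 0) [RHS](tnth_nth 0) /= nth_behead.
by rewrite /bump/= add1n.
Qed.

Lemma measurable_axial_weight : measurable_fun setT (@axial_weight R n : RT -> RT).
Proof.
apply: measurable_funM => //; apply: measurable_funV.
by apply: measurable_funM => //; exact: exprn_measurable.
Qed.

Variables (q : 'rV[R]_m.+1) (q0 : vec q != 0).
Variables (Phi1 Phi2 : R * R -> Cl) (r M : R).
Hypotheses (r0 : 0 <= r) (M0 : 0 <= M).
Hypotheses (dPhi1 : cl_density r M Phi1) (dPhi2 : cl_density r M Phi2).
Hypothesis Phi1_even : forall p, Phi1 (- p.1, p.2) = Phi1 p.
Hypothesis Phi2_odd : forall p, Phi2 (- p.1, p.2) = - Phi2 p.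
Hypothesis Phi1_0 : forall u, Phi1 (0, u) = 0.
Hypothesis Phi2_0 : forall u, Phi2 (0, u) = 0.

Local Notation b := (enorm (vec q)).
Local Notation a := (sc q).
Local Notation I := (cl_dir (vec q)).

(** The integrand of the transform in the coordinates (v, u) and J of the point, up to the
    factor that [teodorescu] takes out of the integral. *)
Definition axial_integrand t : Cl :=
  @axial_weight R n (trad t) *:
    - ((slice_factor1 q (trad t) (tsc t) +
        slice_factor2 q (trad t) (tsc t) * cl_dir (tvec t)) *
       (Phi1 (trad t, tsc t) + cl_dir (tvec t) * Phi2 (trad t, tsc t))).

Definition planar_integrand (p : R * R) : Cl :=
  slice_factor1 q p.1 p.2 * Phi1 p - slice_factor2 q p.1 p.2 * Phi2 p.

(** Averaging over J and - J by [slice_symmetrize].  The null vector has direction zero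
    rather than a unit, but both stem components vanish there. *)
Lemma axial_integrand_flip t :
  axial_integrand t + axial_integrand (flip_tail t) =
  2 *: (@axial_weight R n (trad t) *: - planar_integrand (trad t, tsc t)).
Proof.
have fE : [/\ trad (flip_tail t) = trad t, tsc (flip_tail t) = tsc t &
    tvec (flip_tail t) = - tvec t].
  rewrite /trad /tsc /tvec /flip_tail; have [-> ->] := tuple_consK (scale_tuple (-1) (tail_tuple t)) (thead t).
  split => //; first by rewrite tnorm_scale normrN1 mul1r.
  by apply/rowP => i; rewrite !mxE tnth_map mulN1r.
case: fE => f1 f2 f3; rewrite /axial_integrand f1 f2 f3 cl_dirN.
have [t0|t0] := eqVneq (tvec t) 0.
  have -> : trad t = 0 by apply/eqP; rewrite /trad /tnorm enorm_eq0; exact/eqP.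
  by rewrite /planar_integrand/= Phi1_0 Phi2_0 !(mulr0, addr0, subr0, oppr0, scaler0).
rewrite -scalerDr -opprD slice_symmetrize; last exact: cl_dir_sqr.
by rewrite -(scalerN 2) !scalerA mulrC.
Qed.

Definition sup_bound : R := #|{: {set 'I_m}}|%:R * M.

Lemma cl_density_bound (Phi : R * R -> Cl) p : cl_density r M Phi -> cl_norm (Phi p) <= sup_bound.
Proof.
move=> dPhi; apply: (@le_trans _ _ (\sum_(A : {set 'I_m}) M)).
  by apply: ler_sum => A _; have [_ + _] := dPhi A; apply.
by rewrite sumr_const /sup_bound mulr_natl.
Qed.

Lemma cl_density_out (Phi : R * R -> Cl) p : cl_density r M Phi -> r < supdist 0 p -> Phi p = 0.
Proof.
move=> dPhi rp; apply/ffunP => A; have [_ _ +] := dPhi A => /(_ p rp) ->.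
by rewrite ffunE.
Qed.

Lemma slice_factor_bound v u :
  cl_norm (slice_factor1 q v u) <= (1 + m%:R) * pole_bound b (a - u) v /\
  cl_norm (slice_factor2 q v u) <= (1 + m%:R) * pole_bound b (a - u) v.
Proof.
have I0 := cl_norm_dir (vec q).
have gen k l : `|k| <= pole_bound b (a - u) v -> `|l| <= pole_bound b (a - u) v ->
    cl_norm (k%:A + l *: I) <= (1 + m%:R) * pole_bound b (a - u) v.
  move=> kb lb; apply: le_trans (cl_normD _ _) _.
  rewrite (cl_normZ k) (cl_normZ l) cl_norm1 mulr1 mulrDl mul1r lerD// [leRHS]mulrC.
  by apply: ler_pM => //; exact: cl_norm_ge0.
by split; apply: gen; [exact: kcoef1_bound|exact: kcoef2_bound
  |exact: kcoef3_bound|exact: kcoef4_bound].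
Qed.

(** Dominates the integrand: the inverse distances to the two poles, cut off outside the
    support, with the weight of the kernel, whose product with the axial density is at most 1. *)
Definition majorant (p : R * R) : R :=
  @axial_weight R n p.1 * (pole_bound b (a - p.2) p.1 * \1_(square 0%R r) p).

Lemma supdist_abs (v u : R) : supdist 0 (`|v|, u) = supdist 0 (v, u).
Proof. by rewrite /supdist/= !sub0r !normrN normr_id. Qed.

Lemma measurable_pole_bound : measurable_fun setT
  (fun p : RT * RT => pole_bound b (a - p.2) p.1 : RT).
Proof.
have m1 : measurable_fun setT (fun p : RT * RT => a - p.2 : RT).
  by apply: measurable_funB => //; exact: measurable_snd.
apply: measurable_funD; apply: measurable_funV; apply: measurable_maxr;
  apply: measurableT_comp => //.
  by apply: measurable_funB => //; exact: measurable_fst.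
by apply: measurable_funD => //; exact: measurable_fst.
Qed.

Lemma measurable_majorant : measurable_fun setT (majorant : RT * RT -> RT).
Proof.
apply: measurable_funM; first exact: (measurableT_comp measurable_axial_weight measurable_fst).
apply: measurable_funM; first exact: measurable_pole_bound.
exact: (measurable_indic (measurable_square 0%R r)).
Qed.

Lemma majorant_ge0 p : 0 <= p.1 -> 0 <= majorant p.
Proof.
by move=> p0; rewrite mulr_ge0 ?axial_weight_ge0// mulr_ge0 ?pole_bound_ge0.
Qed.

Lemma integral_pole_square (c : R * R) :
  (\int[mu2]_(p in square 0%R r) ((supdist c p)^-1)%:E < +oo)%E.
Proof.
have mi : measurable_fun setT (fun p : RT * RT => ((supdist c p)^-1)%:E).
  by apply/measurable_EFinP; apply: measurable_funV; exact: measurable_supdist.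
pose s := supdist c 0 + r.
have s0 : 0 <= s by rewrite addr_ge0// supdist_ge0.
apply: (@le_lt_trans _ _ (\int[mu2]_(p in square c s) ((supdist c p)^-1)%:E)%E); last first.
  by apply: le_lt_trans (integral_inv_supdist c s0) _; rewrite ltry.
apply: ge0_subset_integral => //.
- exact: measurable_square.
- exact: measurable_square.
- exact: measurable_funTS.
- by move=> p _; rewrite lee_fin invr_ge0 supdist_ge0.
- move=> p p0; apply: (le_trans (supdist_triangle 0 c p)).
  by rewrite lerD2l; exact: p0.
Qed.

Lemma pole_bound_supdist p : pole_bound b (a - p.2) p.1 =
  (supdist (b, a) p)^-1 + (supdist (- b, a) p)^-1.
Proof.
rewrite /pole_bound /supdist/=; congr (_ + (Num.max _ _)^-1).
by rewrite -opprD normrN.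
Qed.

Lemma integral_pole_bound :
  (\int[mu2]_p (pole_bound b (a - p.2) p.1 * \1_(square 0%R r) p)%:E < +oo)%E.
Proof.
have mi (c : R * R) : measurable_fun (square 0%R r) (fun p : RT * RT => ((supdist c p)^-1)%:E).
  apply: measurable_funTS.
  by apply/measurable_EFinP; apply: measurable_funV; exact: measurable_supdist.
have i0 (c p : R * R) : (0 <= ((supdist c p)^-1)%:E)%E.
  by rewrite lee_fin invr_ge0 supdist_ge0.
rewrite (_ : (\int[mu2]_p _)%E = (\int[mu2]_(p in square 0%R r)
    (((supdist (b, a) p)^-1)%:E + ((supdist (- b, a) p)^-1)%:E))%E); last first.
  rewrite [RHS]integral_mkcond; apply: eq_integral => p _.
  rewrite patchE pole_bound_supdist indicE.
  by case: (_ \in _); rewrite ?mulr1 ?mulr0.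
rewrite ge0_integralD//; last exact: measurable_square.
by apply: lte_add_pinfty; exact: integral_pole_square.
Qed.

Lemma integrable_majorant : (lebesgue_tuple R m.+1).-integrable setT
  (fun t => (majorant (trad t, tsc t))%:E).
Proof.
have mm : measurable_fun setT (fun p : RT * RT => `|majorant p|%:E).
  by apply/measurable_EFinP; apply: measurableT_comp => //; exact: measurable_majorant.
apply/integrableP; split.
  by apply/measurable_EFinP; exact: (measurableT_comp measurable_majorant measurable_tpair).
rewrite (@ge0_integral_axial R n (fun p => `|majorant p|%:E))//.
apply: le_lt_trans integral_pole_bound.
apply: ge0_le_integral => //.
- by move=> p _; rewrite mule_ge0// lee_fin axial_density_ge0.
- apply: emeasurable_funM.
    apply/measurable_EFinP.
    exact: (measurableT_comp (@measurable_axial_density R n) measurable_fst).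
  apply: (measurableT_comp mm (g := fun p : RT * RT => (`|p.1|, p.2) : RT * RT)).
  apply: measurable_fun_pair => //; apply: measurableT_comp => //; exact: measurable_fst.
- apply/measurable_EFinP; apply: measurable_funM; first exact: measurable_pole_bound.
  exact: (measurable_indic (measurable_square 0%R r)).
- move=> [v u] _ /=.
  have h0 : 0 <= majorant (`|v|, u) by apply: majorant_ge0; exact: normr_ge0.
  rewrite -EFinM lee_fin ger0_norm//.
  rewrite /majorant/= mulrA -[leRHS]mul1r.
  have -> : pole_bound b (a - u) `|v| * \1_(square 0%R r) (`|v|, u) =
      pole_bound b (a - u) v * \1_(square 0%R r) (v, u).
    have -> : \1_(square 0%R r) (`|v|, u) = \1_(square 0%R r) (v, u) :> R.
      rewrite !indicE; congr (_%:R); congr nat_of_bool.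
      by apply/idP/idP; rewrite !inE /square/= supdist_abs.
    congr (_ * _); rewrite /pole_bound.
    by have [v0|v0] := ger0P v => //; rewrite opprK addrC.
  apply: ler_pM => //.
  + by rewrite mulr_ge0 ?axial_density_ge0 ?axial_weight_ge0.
  + by rewrite mulr_ge0 ?pole_bound_ge0.
  + exact: axial_weight_density_le1.
Qed.

Lemma integrable_le_majorant (h : tupleR m.+1 -> R) (C : R) :
  measurable_fun setT (h : tupleR m.+1 -> RT) ->
  (forall t, `|h t| <= C * majorant (trad t, tsc t)) ->
  (lebesgue_tuple R m.+1).-integrable setT (EFin \o h).
Proof.
move=> mh hC.
apply: (le_integrable measurableT (g := fun t => (C%:E * (majorant (trad t, tsc t))%:E)%E)).
- exact/measurable_EFinP.
- move=> t _; rewrite /= lee_fin (le_trans (hC t))//; exact: ler_norm.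
- exact: (integrableZl measurableT C integrable_majorant).
Qed.

Let S := sup_bound.

Let S0 : 0 <= S. Proof. by rewrite mulr_ge0. Qed.

Lemma majorant_in v u : supdist 0 (v, u) <= r ->
  majorant (v, u) = @axial_weight R n v * pole_bound b (a - u) v.
Proof. by move=> vr; rewrite /majorant/= indicE mem_set ?mulr1. Qed.

Lemma axial_integrand_bound t A :
  `|axial_integrand t A| <= (1 + m%:R) ^+ 3 * S * majorant (trad t, tsc t).
Proof.
apply: le_trans (le_cl_norm _ _) _.
have t0 : 0 <= trad t by exact: tnorm_ge0.
have w0 := @axial_weight_ge0 R n _ t0.
have [tr|tr] := leP (supdist 0 (trad t, tsc t)) r; last first.
  rewrite /axial_integrand !cl_density_out// mulr0 addr0 mulr0 oppr0 scaler0.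
  rewrite (_ : cl_norm 0 = 0); last by rewrite /cl_norm big1// => B _; rewrite ffunE normr0.
  apply: mulr_ge0; last exact: majorant_ge0.
  by apply: mulr_ge0 => //; exact: exprn_ge0.
rewrite majorant_in// /axial_integrand cl_normZ ger0_norm//.
set P := pole_bound _ _ _; have P0 : 0 <= P by exact: pole_bound_ge0.
have [X Y] := slice_factor_bound (trad t) (tsc t); rewrite -/P in X Y.
have J := cl_norm_dir (tvec t); set J' := cl_dir _ in J *.
have F1 := cl_density_bound (trad t, tsc t) dPhi1.
have F2 := cl_density_bound (trad t, tsc t) dPhi2.
rewrite -/S in F1 F2.
rewrite [leRHS]mulrCA; apply: ler_wpM2l => //.
rewrite -scaleN1r cl_normZ normrN1 mul1r.
apply: le_trans (cl_normM _ _) _.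
have -> : (1 + m%:R) ^+ 3 * S * P = ((1 + m%:R) * ((1 + m%:R) * P)) * ((1 + m%:R) * S) by ring.
have m0 : 0 <= m%:R :> R by [].
apply: ler_pM => //; try exact: cl_norm_ge0.
- apply: le_trans (cl_normD _ _) _; rewrite [leRHS]mulrDl mul1r lerD//.
  apply: le_trans (cl_normM _ _) _; rewrite [leRHS]mulrC.
  by apply: ler_pM => //; exact: cl_norm_ge0.
- apply: le_trans (cl_normD _ _) _; rewrite [leRHS]mulrDl mul1r lerD//.
  apply: le_trans (cl_normM _ _) _.
  by apply: ler_pM => //; exact: cl_norm_ge0.
Qed.

Lemma planar_integrand_bound t A :
  `|(@axial_weight R n (trad t) *: - planar_integrand (trad t, tsc t)) A| <=
    2 * (1 + m%:R) * S * majorant (trad t, tsc t).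
Proof.
apply: le_trans (le_cl_norm _ _) _.
have t0 : 0 <= trad t by exact: tnorm_ge0.
have w0 := @axial_weight_ge0 R n _ t0.
have [tr|tr] := leP (supdist 0 (trad t, tsc t)) r; last first.
  rewrite /planar_integrand !cl_density_out// !mulr0 subr0 oppr0 scaler0.
  rewrite (_ : cl_norm 0 = 0); last by rewrite /cl_norm big1// => B _; rewrite ffunE normr0.
  apply: mulr_ge0; last exact: majorant_ge0.
  by apply: mulr_ge0 => //; exact: mulr_ge0.
rewrite majorant_in// cl_normZ ger0_norm//.
set P := pole_bound _ _ _; have P0 : 0 <= P by exact: pole_bound_ge0.
have [X Y] := slice_factor_bound (trad t) (tsc t); rewrite -/P in X Y.
have F1 := cl_density_bound (trad t, tsc t) dPhi1.
have F2 := cl_density_bound (trad t, tsc t) dPhi2.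
rewrite -/S in F1 F2.
rewrite [leRHS]mulrCA; apply: ler_wpM2l => //.
rewrite -scaleN1r cl_normZ normrN1 mul1r /planar_integrand.
apply: le_trans (cl_normD _ _) _.
rewrite -[X in _ + cl_norm X]scaleN1r cl_normZ normrN1 mul1r.
have -> : 2 * (1 + m%:R) * S * P = ((1 + m%:R) * P) * S + ((1 + m%:R) * P) * S by ring.
by apply: lerD; apply: le_trans (cl_normM _ _) _; apply: ler_pM => //; exact: cl_norm_ge0.
Qed.

Lemma cl_measurable_factors d (T : measurableType d) (v u : T -> RT) :
  measurable_fun setT v -> measurable_fun setT u ->
  cl_measurable (fun x : T => slice_factor1 q (v x) (u x)) /\
  cl_measurable (fun x : T => slice_factor2 q (v x) (u x)).
Proof.
move=> mv mu; have [k1 k2 k3 k4] := measurable_coefs b a mv mu.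
by split; apply: cl_measurableD; apply: cl_measurableZ => //; exact: cl_measurable_cst.
Qed.

Lemma cl_measurable_density (Phi : R * R -> Cl) : cl_density r M Phi ->
  cl_measurable (Phi : RT * RT -> Cl).
Proof. by move=> dPhi A; have [] := dPhi A. Qed.

Lemma cl_measurable_planar_integrand :
  cl_measurable (planar_integrand : RT * RT -> Cl).
Proof.
have [X Y] := cl_measurable_factors (@measurable_fst _ _ RT RT) (@measurable_snd _ _ RT RT).
apply: cl_measurableD; first exact: (cl_measurableM X (cl_measurable_density dPhi1)).
apply: cl_measurableN; exact: (cl_measurableM Y (cl_measurable_density dPhi2)).
Qed.

Lemma cl_measurable_axial_integrand : cl_measurable axial_integrand.
Proof.
have [X Y] := cl_measurable_factors measurable_trad measurable_tsc.
apply: cl_measurableZ; first exact: (measurableT_comp measurable_axial_weight measurable_trad).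
have mPhi (Phi : R * R -> Cl) : cl_density r M Phi -> cl_measurable (fun t => Phi (trad t, tsc t)).
  move=> dPhi A.
  exact: (measurableT_comp (cl_measurable_density dPhi A) measurable_tpair).
apply: cl_measurableN; apply: cl_measurableM; apply: cl_measurableD => //.
- by apply: cl_measurableM => //; exact: cl_measurable_dir.
- exact: mPhi.
- by apply: cl_measurableM; [exact: cl_measurable_dir|exact: mPhi].
Qed.

Lemma integrable_axial_integrand A :
  (lebesgue_tuple R m.+1).-integrable setT (fun t => (axial_integrand t A)%:E).
Proof.
apply: integrable_le_majorant; first exact: cl_measurable_axial_integrand.
by move=> t; exact: axial_integrand_bound.
Qed.

Lemma slice_factor1N v u : slice_factor1 q (- v) u = slice_factor1 q v u.
Proof.
rewrite /slice_factor1 /kcoef1 /kcoef2 /pole_norm !sqrrN opprK.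
by rewrite (mulrC (_ + (b + v) ^+ 2)).
Qed.

Lemma slice_factor2N v u : slice_factor2 q (- v) u = - slice_factor2 q v u.
Proof.
rewrite /slice_factor2 /kcoef3 /kcoef4 /pole_norm !sqrrN opprK.
by rewrite (mulrC (_ + (b + v) ^+ 2)) !mulrN !mulNr !scaleNr -opprD.
Qed.

Lemma planar_integrand_even v u : planar_integrand (- v, u) = planar_integrand (v, u).
Proof.
rewrite /planar_integrand/= slice_factor1N slice_factor2N.
by rewrite (Phi1_even (v, u)) (Phi2_odd (v, u)) mulrNN.
Qed.

(** Subtracting half the sum over the two directions leaves an odd integrand; the rest
    depends on the axial coordinates only. *)
Lemma integral_axial_integrand A :
  \int[lebesgue_tuple R m.+1]_t axial_integrand t A =
  \int[mu2]_p (- planar_integrand p A).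
Proof.
pose E (p : R * R) : R := @axial_weight R n p.1 * - planar_integrand p A.
have mE : measurable_fun setT (E : RT * RT -> RT).
  apply: measurable_funM; first exact: (measurableT_comp measurable_axial_weight measurable_fst).
  exact: (measurable_funN (cl_measurable_planar_integrand A)).
have ih := integrable_axial_integrand A.
have iE : (lebesgue_tuple R m.+1).-integrable setT (EFin \o (fun t => E (trad t, tsc t))).
  apply: (@integrable_le_majorant _ (2 * (1 + m%:R) * S)).
    exact: (measurableT_comp mE measurable_tpair).
  move=> t; have := planar_integrand_bound t A.
  have gen (Z : Cl) k : (k *: - Z) A = k * - Z A by rewrite !ffunE.
  by rewrite gen.
have hE t : axial_integrand t A + axial_integrand (flip_tail t) A = 2 * E (trad t, tsc t).
  have gen (X Y Z : Cl) k : X + Y = 2 *: (k *: - Z) -> X A + Y A = 2 * (k * - Z A).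
    by move/ffunP/(_ A); rewrite !ffunE.
  exact: gen (axial_integrand_flip t).
have Ef t : E (trad (flip_tail t), tsc (flip_tail t)) = E (trad t, tsc t).
  rewrite /trad /tsc /flip_tail.
  have [-> ->] := tuple_consK (scale_tuple (-1) (tail_tuple t)) (thead t).
  by rewrite tnorm_scale normrN1 mul1r.
(* The average of the integrand over the two directions is E. *)
have odd0 : \int[lebesgue_tuple R m.+1]_t (axial_integrand t A - E (trad t, tsc t)) = 0.
  apply: integral_flip_tail_odd; first exact: (integrableB measurableT ih iE).
  by move=> t; rewrite Ef; have := hE t; lra.
move: odd0; rewrite RintegralB// => /eqP; rewrite subr_eq0 => /eqP ->.
have := @integral_axial R n (EFin \o E).
rewrite /Rintegral => -> //; last exact/measurable_EFinP.
congr fine; apply: eq_integral => -[v u] _ /=.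
rewrite -EFinM; congr EFin; rewrite /E/= mulrA.
have [->|v0] := eqVneq v 0.
  by rewrite normr0 /planar_integrand/= Phi1_0 Phi2_0 !mulr0 subr0 ffunE oppr0 mulr0.
rewrite axial_weight_density// mul1r.
by case: (ger0P v) => // _; rewrite planar_integrand_even.
Qed.

Lemma integrable_coef (k phi : R * R -> R) (C : R) :
  measurable_fun setT (k : RT * RT -> RT) ->
  (forall p, `|k p| <= pole_bound b (a - p.2) p.1) ->
  planar_density 0 r C phi ->
  mu2.-integrable setT (EFin \o (fun p => k p * phi p)).
Proof.
move=> mk kb [mphi phiC phi0].
have C0 : 0 <= C := le_trans (normr_ge0 _) (phiC 0).
pose B (p : R * R) := pole_bound b (a - p.2) p.1 * \1_(square 0 r) p.
have B0 p : 0 <= B p by rewrite mulr_ge0 ?pole_bound_ge0.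
have mB : measurable_fun setT (B : RT * RT -> RT).
  apply: measurable_funM; first exact: measurable_pole_bound.
  exact: (measurable_indic (measurable_square 0 r)).
have iB : mu2.-integrable setT (EFin \o B).
  apply/integrableP; split; first exact/measurable_EFinP.
  apply: le_lt_trans integral_pole_bound; rewrite le_eqVlt; apply/orP; left; apply/eqP.
  by apply: eq_integral => p _; rewrite /= ger0_norm.
apply: (le_integrable measurableT (g := fun p : RT * RT => (C%:E * (B p)%:E)%E)).
- by apply/measurable_EFinP; exact: measurable_funM.
- move=> p _; rewrite /= lee_fin normrM [leRHS]ger0_norm; last exact: mulr_ge0.
  rewrite /B indicE; have [pr|pr] := leP (supdist 0 p) r.
    by rewrite mem_set// mulr1 [leRHS]mulrC; apply: ler_pM.
  by rewrite phi0// normr0 mulr0 mulr_ge0// mulr_ge0// pole_bound_ge0.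
- exact: (integrableZl measurableT C iB).
Qed.

Lemma integral_planar_integrand A :
  mu2.-integrable setT (EFin \o (fun p => planar_integrand p A)) /\
  \int[mu2]_p planar_integrand p A =
  (cl_pot kre Phi1 (b, a) - I * cl_pot kim Phi1 (b, a) +
   (cl_pot kim Phi2 (b, a) + I * cl_pot kre Phi2 (b, a))) A.
Proof.
have dI1 := cl_density_mul I M0 dPhi1; have dI2 := cl_density_mul I M0 dPhi2.
rewrite -(cl_potM I (b, a) inverse_kernel_im r0 dPhi1).
rewrite -(cl_potM I (b, a) inverse_kernel_re r0 dPhi2).
have -> (X Y Z W : Cl) : (X - Y + (Z + W)) A = (X A - Y A) + (Z A + W A) by rewrite !ffunE.
rewrite 4!ffunE.
have [m1 m2 m3 m4] := measurable_coefs b a (@measurable_fst _ _ RT RT) (@measurable_snd _ _ RT RT).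
have i1 := integrable_coef m1 (fun p => kcoef1_bound b (a - p.2) p.1) (dPhi1 A).
have i2 := integrable_coef m2 (fun p => kcoef2_bound b (a - p.2) p.1) (dI1 A).
have i3 := integrable_coef m3 (fun p => kcoef3_bound b (a - p.2) p.1) (dPhi2 A).
have i4 := integrable_coef m4 (fun p => kcoef4_bound b (a - p.2) p.1) (dI2 A).
have j1 := integral_coef1 b a r0 (dPhi1 A) (fun p => congr1 (fun X : Cl => X A) (Phi1_even p)).
have j2 := integral_coef2 b a r0 (dI1 A)
  (fun p => congr1 (fun X : Cl => (I * X) A) (Phi1_even p)).
have odd1 p : Phi2 (- p.1, p.2) A = - Phi2 p A by rewrite Phi2_odd ffunE.
have odd2 p : (I * Phi2 (- p.1, p.2)) A = - (I * Phi2 p) A by rewrite Phi2_odd mulrN ffunE.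
have j3 := integral_coef3 b a r0 (dPhi2 A) odd1.
have j4 := integral_coef4 b a r0 (dI2 A) odd2.
have -> : pot kim (fun p => (I * Phi1 p) A) (b, a) =
  - \int[mu2]_p (kcoef2 b (a - p.2) p.1 * (I * Phi1 p) A) by rewrite j2 mulN1r opprK.
have -> : pot kim (fun p => Phi2 p A) (b, a) =
  - \int[mu2]_p (kcoef3 b (a - p.2) p.1 * Phi2 p A) by rewrite j3 mulN1r opprK.
have -> : pot kre (fun p => (I * Phi2 p) A) (b, a) =
  - \int[mu2]_p (kcoef4 b (a - p.2) p.1 * (I * Phi2 p) A) by rewrite j4 mulN1r opprK.
rewrite -j1 opprK -opprD.
have i12 := integrableD measurableT i1 i2; have i34 := integrableD measurableT i3 i4.
rewrite -(RintegralD measurableT i1 i2) -(RintegralD measurableT i3 i4).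
rewrite -(RintegralB measurableT i12 i34).
have gen (k l k' l' : R) (X Y : Cl) : ((k%:A + l *: I) * X - (k'%:A + l' *: I) * Y) A =
    k * X A + l * (I * X) A - (k' * Y A + l' * (I * Y) A).
  rewrite !mulrDl -!scalerAl !mul1r.
  have e (u u' w w' : R) (U U' W W' : Cl) :
    (u *: U + u' *: U' - (w *: W + w' *: W')) A = u * U A + u' * U' A - (w * W A + w' * W' A).
    by rewrite !ffunE.
  exact: e.
split; last by apply: eq_Rintegral => p _; exact: gen.
have := integrableB measurableT i12 i34; apply: eq_integrable => // p _.
by rewrite /= gen.
Qed.

(** The four coefficients yield the real and imaginary potentials of the two components,
    the factor I being moved out of the integrals by [cl_potM]. *)
Lemma integral_axial_integrandE A :
  \int[lebesgue_tuple R m.+1]_t axial_integrand t A =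
  - (cl_pot kre Phi1 (b, a) - I * cl_pot kim Phi1 (b, a) +
   (cl_pot kim Phi2 (b, a) + I * cl_pot kre Phi2 (b, a))) A.
Proof.
have [ip <-] := integral_planar_integrand A.
rewrite integral_axial_integrand -mulN1r -RintegralZl//.
by apply: eq_Rintegral => p _; rewrite mulN1r.
Qed.

End AxialIntegrand.

(** * The planar domain and the restriction to a slice *)

Section PlaneTopology.
Context {R : realType}.
Local Notation RT := (measurableTypeR R).
Implicit Types (p : R * R).

(** Squares replace discs, to match [supdist]. *)
Definition plane_open (U : set (R * R)) : Prop :=
  forall p, U p -> exists2 e, 0 < e & square p e `<=` U.

Lemma measurable_plane_open (U : set (R * R)) : plane_open U ->
  measurable (U : set (RT * RT)).
Proof.
move=> oU.
pose S (i j k : rat) : set (RT * RT) :=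
  if `[< square (ratr i, ratr j) (ratr k : R) `<=` U >]
  then square (ratr i, ratr j) (ratr k) else set0.
rewrite (_ : U = \bigcup_i \bigcup_j \bigcup_k S i j k); last first.
  apply/seteqP; split => [p Up|p [i _ [j _ [k _]]]]; last first.
    by rewrite /S; case: asboolP => // SU; exact: SU.
  have [e e0 eU] := oU p Up.
  have e4 : e / 4 < e / 2 by lra.
  have le4 (x : R) : x - e / 4 < x + e / 4 by lra.
  have [i /[!in_itv]/= /andP[i1 i2]] := rat_in_itvoo (le4 p.1).
  have [j /[!in_itv]/= /andP[j1 j2]] := rat_in_itvoo (le4 p.2).
  have [k /[!in_itv]/= /andP[k1 k2]] := rat_in_itvoo e4.
  exists i => //; exists j => //; exists k => //; rewrite /S.
  have cp : supdist (ratr i, ratr j) p <= e / 4.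
    by rewrite /supdist/= ge_max !ler_distl; apply/andP; split; apply/andP; split; lra.
  rewrite asboolT; first by rewrite /square/=; lra.
  move=> p' pk; apply: eU.
  change (is_true (supdist p p' <= e)).
  apply: le_trans (supdist_triangle (ratr i, ratr j) p p') _.
  rewrite (supdistC p).
  have pk' : supdist (ratr i, ratr j) p' <= ratr k by exact: pk.
  lra.
apply: bigcupT_measurable_rat => i; apply: bigcupT_measurable_rat => j.
apply: bigcupT_measurable_rat => k; rewrite /S; case: asboolP => // _.
exact: measurable_square.
Qed.

Lemma lipschitz_at_nbhs (g : R * R -> R) p : lipschitz_at g p -> forall e, 0 < e ->
  exists2 d, 0 < d & forall p', supdist p p' <= d -> `|g p' - g p| <= e.
Proof.
move=> [L [d d0 lip]] e e0; pose L' := `|L| + 1.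
have L0 : 0 < L' by rewrite ltr_wpDl.
exists (Num.min d (e / L')); first by rewrite lt_min d0 divr_gt0.
move=> p'; rewrite le_min => /andP[/lip + pe] => /le_trans; apply.
apply: (@le_trans _ _ (L' * supdist p p')).
  by apply: ler_wpM2r; [exact: supdist_ge0|rewrite /L'; have := ler_norm L; lra].
by rewrite mulrC -ler_pdivlMr.
Qed.

(** The sets where g exceeds c are open within U; outside U they are empty or everything,
    according to the sign of c. *)
Lemma measurable_locally_lipschitz (U : set (R * R)) (g : R * R -> R) :
  plane_open U -> (forall p, ~ U p -> g p = 0) ->
  (forall p, U p -> lipschitz_at g p) ->
  measurable_fun setT (g : RT * RT -> RT).
Proof.
move=> oU g0 gl; apply: (measurability _ (RGenOInfty.measurableE R)) => //.
move=> /= _ [_ [c ->] <-]; rewrite setTI.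
have oUc : plane_open (U `&` [set p | c < g p]).
  move=> p [Up cg]; have [e e0 eU] := oU p Up.
  have h0 : 0 < (g p - c) / 2 by rewrite divr_gt0// subr_gt0.
  have [d d0 dg] := lipschitz_at_nbhs (gl p Up) h0.
  exists (Num.min e d); first by rewrite lt_min e0.
  move=> p' pp'; have pe : supdist p p' <= Num.min e d by exact: pp'.
  move: pe; rewrite le_min => /andP[pe pd]; split; first exact: eU.
  by have /= := dg p' pd; rewrite ler_norml; lra.
have mUc := measurable_plane_open oUc; have mU := measurable_plane_open oU.
have [c0|c0] := leP 0 c.
  rewrite (_ : _ @^-1` _ = U `&` [set p | c < g p])//.
  apply/seteqP; split => p /=; rewrite in_itv/= andbT; last by case.
  move=> cg; split => //; apply: contrapT => /g0 gp0.
  by move: cg; rewrite gp0 ltNge c0.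
rewrite (_ : _ @^-1` _ = (U `&` [set p | c < g p]) `|` ~` U).
  by apply: measurableU => //; exact: measurableC.
apply/seteqP; split => p /=; rewrite in_itv/= andbT.
  by move=> cg; have [Up|Up] := pselect (U p); [left|right].
by case => [[]//|/g0 ->].
Qed.

End PlaneTopology.

Section CompactBound.
Context {R : realType} {k : nat}.

Lemma closure_bounded (W : set 'rV[R]_k) : bounded_set W -> bounded_set (closure W).
Proof.
move=> [M [Mr WM]]; exists M; split => // x Mx y Wy.
have e0 : 0 < (x - M) / 2 by rewrite divr_gt0// subr_gt0.
have [w [Ww]] := Wy _ (nbhsx_ballx y _ e0).
rewrite -ball_normE /= => yw.
have wM : `|w| <= (M + x) / 2 by apply: (WM ((M + x) / 2)) => //; lra.
rewrite -(subrK w y); apply: le_trans (ler_normD _ _) _; lra.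
Qed.

Lemma bounded_on_closure (W : set 'rV[R]_k) (g : 'rV[R]_k -> R) :
  bounded_set W -> {within closure W, continuous g} ->
  exists2 M, 0 <= M & forall x, W x -> `|g x| <= M.
Proof.
move=> bW cg.
have cW : compact (closure W).
  apply: bounded_closed_compact; first exact: closure_bounded.
  exact: closed_closure.
have := continuous_compact cg cW => /compact_bounded[M [Mr gM]].
exists (`|M| + 1); first by rewrite addr_ge0.
move=> x Wx; apply: (gM (`|M| + 1)).
  by rewrite (le_lt_trans (ler_norm M))// ltrDl.
by exists x => //; exact: subset_closure.
Qed.

End CompactBound.

Section MeanValue.
Context {R : realType}.

Lemma mean_value_bound (g dg : R -> R) (x y M : R) :
  (forall z, `|z - x| <= `|y - x| -> is_derive z 1 g (dg z) /\ `|dg z| <= M) ->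
  `|g y - g x| <= M * `|y - x|.
Proof.
move=> gd.
have key (a b : R) : a < b ->
    (forall z, a <= z <= b -> is_derive z 1 g (dg z) /\ `|dg z| <= M) ->
    `|g b - g a| <= M * `|b - a|.
  move=> ab gab.
  have [z zab| |z zab ->] := @MVT _ g dg a b ab.
  - by apply: (gab z _).1; move: zab; rewrite in_itv/= => /andP[/ltW -> /ltW ->].
  - apply: derivable_within_continuous => z; rewrite in_itv/= => zab.
    by have [dz _] := gab z zab; exact: ex_derive.
  - rewrite normrM ler_wpM2r//; apply: (gab z _).2.
    by move: zab; rewrite in_itv/= => /andP[/ltW -> /ltW ->].
have [xy|yx|<-] := ltgtP x y; last by rewrite !subrr normr0 mulr0.
- apply: key => // z /andP[xz zy]; apply: gd.
  by rewrite !ger0_norm ?subr_ge0//; [lra|exact: ltW].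
- rewrite distrC (distrC y); apply: key => // z /andP[yz zx]; apply: gd.
  by rewrite !ler0_norm ?subr_le0//; [lra|exact: ltW].
Qed.

Lemma is_derive_line k (g : 'rV[R]_k -> R) (X : R -> 'rV[R]_k) (d : 'rV[R]_k) (s : R) :
  (forall h, X (h + s) = h *: d + X s) -> derivable g (X s) d ->
  is_derive s 1 (g \o X) ('D_d g (X s)).
Proof.
move=> XE gd.
have E : (fun h : R => h^-1 *: (((g \o X) \o shift s) (h *: (1 : R)) - (g \o X) s)) =
    (fun h : R => h^-1 *: ((g \o shift (X s)) (h *: d) - g (X s))).
  by apply/funext => h /=; rewrite -XE [h *: _]mulr1.
apply: DeriveDef; first by rewrite /derivable E.
by rewrite /derive E.
Qed.

End MeanValue.

Section SliceDomain.
Context {R : realType} {n : nat}.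
Local Notation m := n.+1.
Local Notation RT := (measurableTypeR R).
Local Notation Cl := (clifford R m).
Implicit Types (p : R * R).

Variables (D : set R[i]) (f : 'rV[R]_m.+1 -> Cl).
Hypothesis D_open : open (D : set R[i]^o).
Hypothesis D_conj : conj_invariant D.
Hypothesis Omega_off : axial m D `<=` @off_axis R m.
Hypothesis Omega_bounded : bounded_set (axial m D).
Hypothesis f_C1 : C1_closure (axial m D) f.
Hypothesis f_slice : slice_function D f.

(** Points of the plane carry the imaginary part first, as in the product decomposition
    of the volume. *)
Definition plane_domain : set (R * R) := [set p | D (p.2 +i* p.1)%C].

(** An arbitrary but fixed direction; one slice determines a slice function. *)
Definition unit_axis : 'rV[R]_m := delta_mx 0 ord0.

Lemma usphere_unit_axis : usphere unit_axis.
Proof.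
rewrite /usphere/= (bigD1 ord0)//= mxE !eqxx expr1n big1 ?addr0// => i i0.
by rewrite mxE (negbTE i0) andbF expr0n.
Qed.

Lemma plane_open_domain : plane_open plane_domain.
Proof.
move=> p Dp; have := open_nbhs_nbhs (conj D_open Dp).
move=> /nbhs_ballP[/= e e0 eD].
have [eR ei] : 0 < complex.Re e /\ complex.Im e = 0.
  by move: e0; rewrite ltcE/= => /andP[/eqP -> ->].
exists (complex.Re e / 4); first by rewrite divr_gt0.
move=> [v u] pp; have /= := pp; rewrite /square/= /supdist/= ge_max => /andP[pv pu].
apply: eD; rewrite -ball_normE /=.
rewrite ltcE /= ei eqxx /=.
set E := complex.Re e in eR pv pu *.
have sq (x : R) : `|x| <= E / 4 -> x ^+ 2 <= (E / 4) ^+ 2.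
  by move=> xE; rewrite -real_normK ?num_real// lerXn2r// nnegrE divr_ge0// ltW.
apply: (@le_lt_trans _ _ (Num.sqrt ((E / 2) ^+ 2))).
  rewrite ler_sqrt ?sqr_ge0//; have := sq _ pv; have := sq _ pu.
  by have : 0 <= E ^+ 2 by [exact: sqr_ge0]; rewrite !expr_div_n; lra.
by rewrite sqrtr_sqr ger0_norm ?divr_ge0 ?(ltW eR)//; lra.
Qed.

Lemma plane_domainN p : plane_domain (- p.1, p.2) <-> plane_domain p.
Proof.
split=> [/D_conj|Dp]; first by rewrite /= opprK; case: p.
exact: (D_conj Dp).
Qed.

Lemma slice_pointE (J : 'rV[R]_m) p :
  sc (slice_point J (p.2 +i* p.1)%C) = p.2 /\
  vec (slice_point J (p.2 +i* p.1)%C) = p.1 *: J.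
Proof.
split.
  transitivity ((p.2%:M : 'M[R]_1) 0 0); last by rewrite mxE mulr1n.
  rewrite -(row_mxEl p.2%:M (p.1 *: J)) /sc /slice_point.
  by congr (row_mx _ _ _ _); exact/val_inj.
apply/rowP => k; rewrite mxE -(row_mxEr p.2%:M (p.1 *: J)).
by congr (row_mx _ _ _ _); exact/val_inj.
Qed.

Lemma slice_point_eta (x : 'rV[R]_m.+1) (J : 'rV[R]_m) (v : R) :
  vec x = v *: J -> x = slice_point J (sc x +i* v)%C.
Proof.
move=> xv; have [s1 s2] := slice_pointE J (v, sc x).
apply/rowP => k; case: (unliftP ord0 k) => [j|] ->; last exact: esym s1.
by have /rowP/(_ j) := s2; rewrite /= -xv !mxE => <-.
Qed.

(** A real point of D would give a point of the axis in every slice. *)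
Lemma plane_domain_off u : ~ plane_domain (0, u).
Proof.
move=> Du; have : axial m D (slice_point unit_axis (u +i* 0)%C).
  by exists unit_axis; [exact: usphere_unit_axis|exists (u +i* 0)%C].
move=> /Omega_off; rewrite /off_axis/=.
by have [_ ->] := slice_pointE unit_axis (0, u); rewrite scale0r eqxx.
Qed.

Lemma enorm_usphere (J : 'rV[R]_m) v : usphere J -> enorm (v *: J) = `|v|.
Proof.
move=> J1; rewrite /enorm -sqrtr_sqr -[X in _ = Num.sqrt X]mulr1 -J1 mulr_sumr.
by congr Num.sqrt; apply: eq_bigr => i _; rewrite mxE exprMn.
Qed.

Lemma axialP (x : 'rV[R]_m.+1) :
  axial m D x <-> plane_domain (enorm (vec x), sc x).
Proof.
split.
  move=> [J J1 [[u v] Dz <-]].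
  have [/= -> ->] := slice_pointE J (v, u); rewrite enorm_usphere//.
  case: (ger0P v) => // _.
  by apply/(plane_domainN (v, u)).
move=> Dx; have x0 : vec x != 0.
  by apply/eqP => x0; move: Dx; rewrite x0 (_ : enorm 0 = 0);
    [exact: plane_domain_off|apply/eqP; rewrite enorm_eq0].
have x0' : enorm (vec x) != 0 by rewrite enorm_eq0.
exists ((enorm (vec x))^-1 *: vec x); first exact: usphere_normalize.
exists (sc x +i* enorm (vec x))%C => //.
by rewrite -slice_point_eta// scalerA mulfV// scale1r.
Qed.

Lemma norm_slice_point p : plane_domain p ->
  supdist 0 p <= `|slice_point unit_axis (p.2 +i* p.1)%C|.
Proof.
have [s1 s2] := slice_pointE unit_axis p.
set x := slice_point _ _ in s1 s2 *; move=> _.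
have cx j : `|x 0 j| <= `|x| by rewrite [`|x|]mx_normrE; exact: (le_bigmax _ (fun ij => `|x ij.1 ij.2|) (0, j)).
rewrite /supdist/= !sub0r !normrN ge_max; apply/andP; split.
  have <- : x 0 (lift ord0 ord0) = p.1; last exact: cx.
  by have /rowP/(_ ord0) := s2; rewrite mxE => ->; rewrite !mxE !eqxx mulr1.
by rewrite -s1; exact: cx.
Qed.

Lemma plane_domain_bounded : exists2 r, 0 <= r & forall p, plane_domain p -> supdist 0 p <= r.
Proof.
have [M [Mr WM]] := Omega_bounded; exists (`|M| + 1); first by rewrite addr_ge0.
move=> p Dp; apply: le_trans (norm_slice_point Dp) _.
apply: (WM (`|M| + 1)); first by rewrite (le_lt_trans (ler_norm M))// ltrDl.
by exists unit_axis; [exact: usphere_unit_axis|exists (p.2 +i* p.1)%C].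
Qed.

(** Extension by zero lets potentials be integrated over the whole plane. *)
Definition slice_restriction (p : R * R) : Cl :=
  if `[< plane_domain p >] then f (slice_point unit_axis (p.2 +i* p.1)%C) else 0.

Lemma slice_restriction_out p : ~ plane_domain p -> slice_restriction p = 0.
Proof. by rewrite /slice_restriction => /asboolPn/negbTE ->. Qed.

Lemma slice_restriction_in p : plane_domain p ->
  slice_restriction p = f (slice_point unit_axis (p.2 +i* p.1)%C).
Proof. by rewrite /slice_restriction => /asboolP ->. Qed.

Lemma axial_slice_point p : plane_domain p ->
  axial m D (slice_point unit_axis (p.2 +i* p.1)%C).
Proof.
by move=> Dp; exists unit_axis; [exact: usphere_unit_axis|exists (p.2 +i* p.1)%C].
Qed.

Lemma slice_restriction_bounded A :
  exists2 M, 0 <= M & forall p, `|slice_restriction p A| <= M.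
Proof.
have [fc _ _] := f_C1; have [M M0 fM] := bounded_on_closure Omega_bounded (fc A).
exists M => // p; have [Dp|Dp] := pselect (plane_domain p).
  by rewrite slice_restriction_in// fM//; exact: axial_slice_point.
by rewrite slice_restriction_out// ffunE normr0.
Qed.

Lemma partial_bounded j A :
  exists2 M, 0 <= M & forall x, axial m D x -> `|partial j f x A| <= M.
Proof.
have [_ _ /(_ j A)[h hc hE]] := f_C1.
have [M M0 hM] := bounded_on_closure Omega_bounded hc.
by exists M => // x Wx; rewrite -hE// hM.
Qed.

Lemma row_vec_ext (x y : 'rV[R]_m.+1) : sc x = sc y -> vec x = vec y -> x = y.
Proof.
move=> sxy vxy; apply/rowP => k; case: (unliftP ord0 k) => [j|] ->; last exact: sxy.
by have /rowP/(_ j) := vxy; rewrite !mxE.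
Qed.

Lemma sc_lin (h : R) (x y : 'rV[R]_m.+1) : sc (h *: x + y) = h * sc x + sc y.
Proof. by rewrite /sc !mxE. Qed.

Lemma vec_lin (h : R) (x y : 'rV[R]_m.+1) : vec (h *: x + y) = h *: vec x + vec y.
Proof. by apply/rowP => k; rewrite !mxE. Qed.

Lemma sc_delta0 : sc (delta_mx 0 ord0 : 'rV[R]_m.+1) = 1.
Proof. by rewrite /sc mxE !eqxx. Qed.

Lemma vec_delta0 : vec (delta_mx 0 ord0 : 'rV[R]_m.+1) = 0.
Proof. by apply/rowP => k; rewrite !mxE andbF. Qed.

Lemma sc_delta j : sc (delta_mx 0 (lift ord0 j) : 'rV[R]_m.+1) = 0.
Proof. by rewrite /sc mxE. Qed.

Lemma vec_delta j : vec (delta_mx 0 (lift ord0 j) : 'rV[R]_m.+1) = delta_mx 0 j.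
Proof. by apply/rowP => k; rewrite !mxE (inj_eq lift_inj). Qed.

(** Two applications of the mean value theorem, along a broken line parallel to the axes
    that stays in a square inside the domain. *)
Lemma slice_restriction_lipschitz A p : plane_domain p ->
  lipschitz_at (fun p => slice_restriction p A) p.
Proof.
move=> Dp; have [e e0 eD] := plane_open_domain Dp.
have [M0 M00 hM0] := partial_bounded ord0 A.
have [M1 M10 hM1] := partial_bounded (lift ord0 ord0) A.
exists (M0 + M1), e => // p' pp'.
have pe1 : `|p.1 - p'.1| <= supdist p p' by rewrite /supdist le_max lexx.
have pe2 : `|p.2 - p'.2| <= supdist p p' by rewrite /supdist le_max lexx orbT.
pose X0 (s : R) := slice_point unit_axis (s +i* p.1)%C.
pose X1 (s : R) := slice_point unit_axis (p'.2 +i* s)%C.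
have Dm v u : `|v - p.1| <= supdist p p' -> `|u - p.2| <= supdist p p' -> plane_domain (v, u).
  move=> vp up; apply: eD; change (is_true (supdist p (v, u) <= e)).
  by rewrite /supdist/= ge_max distrC (le_trans vp)// distrC (le_trans up).
have [_ fd _] := f_C1.
have d0 : `|f (X0 p'.2) A - f (X0 p.2) A| <= M0 * `|p'.2 - p.2|.
  apply: (@mean_value_bound _ (fun s => f (X0 s) A) (fun s => partial ord0 f (X0 s) A)) => z zp.
  have Dz : plane_domain (p.1, z).
    apply: Dm; first by rewrite subrr normr0 supdist_ge0.
    by rewrite (le_trans zp)// distrC.
  have Wz := axial_slice_point Dz.
  split; last exact: hM0.
  rewrite /partial ffunE.
  apply: (@is_derive_line _ _ (fun x => f x A) X0); last exact: fd.
  move=> h; apply: row_vec_ext.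
    rewrite sc_lin sc_delta0 mulr1.
    by rewrite (slice_pointE unit_axis (p.1, h + z)).1 (slice_pointE unit_axis (p.1, z)).1.
  rewrite vec_lin vec_delta0 scaler0 add0r.
  by rewrite (slice_pointE unit_axis (p.1, h + z)).2 (slice_pointE unit_axis (p.1, z)).2.
have d1 : `|f (X1 p'.1) A - f (X1 p.1) A| <= M1 * `|p'.1 - p.1|.
  apply: (@mean_value_bound _ (fun s => f (X1 s) A) (fun s => partial (lift ord0 ord0) f (X1 s) A)) => z zp.
  have Dz : plane_domain (z, p'.2).
    by apply: Dm; rewrite ?(le_trans zp)// distrC.
  have Wz := axial_slice_point Dz.
  split; last exact: hM1.
  rewrite /partial ffunE.
  apply: (@is_derive_line _ _ (fun x => f x A) X1); last exact: fd.
  move=> h; apply: row_vec_ext.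
    rewrite sc_lin sc_delta mulr0 add0r.
    by rewrite (slice_pointE unit_axis (h + z, p'.2)).1 (slice_pointE unit_axis (z, p'.2)).1.
  rewrite vec_lin vec_delta.
  by rewrite (slice_pointE unit_axis (h + z, p'.2)).2 (slice_pointE unit_axis (z, p'.2)).2 /= scalerDl.
have Dp' : plane_domain p'.
  by case: (p') pe1 pe2 Dm => v u /= pv pu Dm; apply: Dm; rewrite distrC.
rewrite !slice_restriction_in//.
have := ler_distD (f (X0 p'.2) A) (f (X1 p'.1) A) (f (X0 p.2) A).
rewrite -/(X1 p'.1) -/(X0 p.2) in d0 d1 *.
move=> /le_trans; apply; rewrite mulrDl addrC; apply: lerD.
  by apply: le_trans d0 _; apply: ler_wpM2l => //; rewrite distrC.
by apply: le_trans d1 _; apply: ler_wpM2l => //; rewrite distrC.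
Qed.

End SliceDomain.

(** * Stem components *)

Section LipschitzClosure.
Context {R : realType}.
Implicit Types (g h : R * R -> R) (p : R * R).

Lemma lipschitz_at0 p : lipschitz_at (fun=> 0) p.
Proof. by exists 0, 1 => // p' _; rewrite subr0 normr0 mul0r. Qed.

Lemma lipschitz_atD g h p : lipschitz_at g p -> lipschitz_at h p ->
  lipschitz_at (fun p => g p + h p) p.
Proof.
move=> [L [e e0 gL]] [K [d d0 hK]]; exists (L + K), (Num.min e d).
  by rewrite lt_min e0.
move=> p'; rewrite le_min => /andP[/gL g1 /hK h1].
rewrite opprD addrACA mulrDl; apply: le_trans (ler_normD _ _) _; exact: lerD.
Qed.

Lemma lipschitz_atZ (k : R) g p : lipschitz_at g p -> lipschitz_at (fun p => k * g p) p.
Proof.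
move=> [L [e e0 gL]]; exists (`|k| * L), e => // p' /gL pL.
by rewrite -mulrBr normrM -mulrA ler_wpM2l.
Qed.

Lemma lipschitz_at_sum I (s : seq I) (g : I -> R * R -> R) p :
  (forall i, lipschitz_at (g i) p) -> lipschitz_at (fun p => \sum_(i <- s) g i p) p.
Proof.
move=> gL; elim: s => [|i s IH].
  by under eq_fun do rewrite big_nil; exact: lipschitz_at0.
by under eq_fun do rewrite big_cons; exact: lipschitz_atD.
Qed.

Lemma supdist_flip p p' : supdist (- p.1, p.2) (- p'.1, p'.2) = supdist p p'.
Proof. by rewrite /supdist/= -opprB opprK normrN addrC distrC. Qed.

Lemma lipschitz_at_flip g p : lipschitz_at g (- p.1, p.2) ->
  lipschitz_at (fun p => g (- p.1, p.2)) p.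
Proof.
move=> [L [e e0 gL]]; exists L, e => // p' pp'.
by rewrite -(supdist_flip p p'); apply: gL; rewrite supdist_flip.
Qed.

End LipschitzClosure.

Section DensityClosure.
Context {R : realType} {m : nat}.
Local Notation RT := (measurableTypeR R).
Local Notation Cl := (clifford R m).
Implicit Types (Phi Psi : R * R -> Cl).

Lemma cl_densityD r M M' Phi Psi : cl_density r M Phi -> cl_density r M' Psi ->
  cl_density r (M + M') (fun p => Phi p + Psi p).
Proof.
move=> dPhi dPsi A; have [mP PM P0] := dPhi A; have [mQ QM Q0] := dPsi A.
split.
- exact: (cl_measurableD (g := Phi : RT * RT -> Cl) (h := Psi : RT * RT -> Cl)
    (fun B => let: And3 x _ _ := dPhi B in x) (fun B => let: And3 x _ _ := dPsi B in x)).
- by move=> p; rewrite ffunE (le_trans (ler_normD _ _))// lerD.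
- by move=> p rp; rewrite ffunE P0// Q0// addr0.
Qed.

Lemma cl_density_flip r M Phi : cl_density r M Phi ->
  cl_density r M (fun p => Phi (- p.1, p.2)).
Proof.
move=> dPhi A; have [mP PM P0] := dPhi A; split => //.
  apply: (measurableT_comp mP (g := fun p : RT * RT => (- p.1, p.2) : RT * RT)).
  apply: measurable_fun_pair => //; apply: measurable_funN; exact: measurable_fst.
move=> p rp; apply: P0.
by rewrite (_ : 0 = (- (0 : R * R).1, (0 : R * R).2)) ?supdist_flip//= oppr0.
Qed.

End DensityClosure.

Section StemComponents.
Context {R : realType} {n : nat}.
Local Notation m := n.+1.
Local Notation RT := (measurableTypeR R).
Local Notation Cl := (clifford R m).
Implicit Types (p : R * R).

Variables (D : set R[i]) (f : 'rV[R]_m.+1 -> Cl).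
Hypothesis D_open : open (D : set R[i]^o).
Hypothesis D_conj : conj_invariant D.
Hypothesis Omega_off : axial m D `<=` @off_axis R m.
Hypothesis Omega_bounded : bounded_set (axial m D).
Hypothesis f_C1 : C1_closure (axial m D) f.
Hypothesis f_slice : slice_function D f.

Local Notation psi := (slice_restriction D f).
Local Notation e1 := (cl_vec (@unit_axis R n)).

(** The even part in v of the restriction to one slice.  The stem function itself comes
    without any regularity; these expressions inherit that of f. *)
Definition stem1 p : Cl := (2^-1)%:A * (psi p + psi (- p.1, p.2)).
(** The odd part is [unit_axis] times the second component, and the unit squares to - 1. *)
Definition stem2 p : Cl := ((- 2^-1) *: e1) * (psi p + (- 1)%:A * psi (- p.1, p.2)).

Lemma plane_domain_outN p : ~ plane_domain D p -> ~ plane_domain D (- p.1, p.2).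
Proof. by move=> Dp /(plane_domainN D_conj). Qed.

Lemma stem_out p : ~ plane_domain D p -> stem1 p = 0 /\ stem2 p = 0.
Proof.
move=> Dp; rewrite /stem1 /stem2 !slice_restriction_out//; last exact: plane_domain_outN.
by rewrite mulr0 addr0 !mulr0.
Qed.

Lemma stem1_even p : stem1 (- p.1, p.2) = stem1 p.
Proof. by rewrite /stem1/= opprK addrC; case: p. Qed.

Lemma stem2_odd p : stem2 (- p.1, p.2) = - stem2 p.
Proof.
rewrite /stem2/= opprK -mulrN; congr (_ * _); case: p => v u /=.
by rewrite !scaleN1r !mulN1r opprB addrC.
Qed.

Lemma cl_density_slice_restriction : exists r M, [/\ 0 <= r, 0 <= M & cl_density r M psi].
Proof.
have [r r0 Dr] := plane_domain_bounded Omega_bounded.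
have /choice[M hM] : forall A, exists M, 0 <= M /\ forall p, `|psi p A| <= M.
  by move=> A; have [M M0 MA] := slice_restriction_bounded Omega_bounded f_C1 A; exists M.
exists r, (\sum_A M A); split => //.
  by apply: sumr_ge0 => A _; exact: (hM A).1.
have out p : ~ plane_domain D p -> forall A, psi p A = 0.
  by move=> Dp A; rewrite slice_restriction_out// ffunE.
move=> A; split.
- apply: (measurable_locally_lipschitz (plane_open_domain D_open)).
    by move=> p Dp; exact: out.
  by move=> p; exact: slice_restriction_lipschitz.
- move=> p; apply: le_trans ((hM A).2 p) _.
  by rewrite (bigD1 A)//= lerDl sumr_ge0// => B _; exact: (hM B).1.
- move=> p rp; apply: out => Dp.
  by move: rp; rewrite ltNge Dr.
Qed.

Lemma cl_density_stem : exists r M,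
  [/\ 0 < r, 0 <= M, cl_density r M stem1 & cl_density r M stem2].
Proof.
have [r [M [r0 M0 dpsi]]] := cl_density_slice_restriction.
have MM : 0 <= M + M by exact: addr_ge0.
have N0 X : 0 <= cl_norm X * M by rewrite mulr_ge0 ?cl_norm_ge0.
have d1 := cl_density_mul (2^-1)%:A MM (cl_densityD dpsi (cl_density_flip dpsi)).
have M2 : 0 <= M + cl_norm ((- 1)%:A : Cl) * M by exact: addr_ge0.
have d2 := cl_density_mul ((- 2^-1) *: e1) M2
  (cl_densityD dpsi (cl_density_mul (- 1)%:A M0 (cl_density_flip dpsi))).
set N1 := _ * _ in d1; set N2 := _ * _ in d2.
have N10 : 0 <= N1 by rewrite mulr_ge0 ?cl_norm_ge0.
have N20 : 0 <= N2 by rewrite mulr_ge0 ?cl_norm_ge0.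
exists (r + 1), (N1 + N2); split; rewrite ?addr_ge0//; first by rewrite ltr_wpDl.
  move=> A; have [mP PM P0] := d1 A; split => // [p|p rp].
    by apply: le_trans (PM p) _; rewrite lerDl.
  by apply: P0; apply: lt_trans rp; rewrite ltrDl.
move=> A; have [mP PM P0] := d2 A; split => // [p|p rp].
  by apply: le_trans (PM p) _; rewrite lerDr.
by apply: P0; apply: lt_trans rp; rewrite ltrDl.
Qed.

Lemma stem_lipschitz A p : plane_domain D p ->
  lipschitz_at (fun p => stem1 p A) p /\ lipschitz_at (fun p => stem2 p A) p.
Proof.
move=> Dp; have lp B := slice_restriction_lipschitz D_open Omega_bounded f_C1 B Dp.
have lN B := lipschitz_at_flip
  (slice_restriction_lipschitz D_open Omega_bounded f_C1 B ((plane_domainN D_conj p).2 Dp)).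
have lM (X : Cl) (Phi : R * R -> Cl) : (forall B, lipschitz_at (fun p => Phi p B) p) ->
    forall B, lipschitz_at (fun p => (X * Phi p) B) p.
  move=> lPhi B; under eq_fun do rewrite cl_mul_constE.
  by apply: lipschitz_at_sum => C; apply: lipschitz_atZ; exact: lPhi.
have lD (Phi Psi : R * R -> Cl) : (forall B, lipschitz_at (fun p => Phi p B) p) ->
    (forall B, lipschitz_at (fun p => Psi p B) p) ->
    forall B, lipschitz_at (fun p => (Phi p + Psi p) B) p.
  by move=> lPhi lPsi B; under eq_fun do rewrite ffunE; exact: lipschitz_atD.
by split; apply: (lM); apply: (lD) => //; apply: (lM).
Qed.

Lemma cl_vec_usphere_sqr (J : 'rV[R]_m) : usphere J -> cl_vec J * cl_vec J = -1.
Proof.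
move=> J1; rewrite cl_vec_sqr.
by rewrite -[J]scale1r enorm_usphere// normr1 expr1n scale1r.
Qed.

(** The representation formula: the values on one slice determine those on all others. *)
Lemma slice_stemE (J : 'rV[R]_m) p : usphere J -> plane_domain D p ->
  f (slice_point J (p.2 +i* p.1)%C) = stem1 p + cl_vec J * stem2 p.
Proof.
move=> J1 Dp; have [F stemF fF] := f_slice.
have [s1 s2] := stemF _ Dp.
have psiE : psi p = (F (p.2 +i* p.1)%C).1 + e1 * (F (p.2 +i* p.1)%C).2.
  rewrite slice_restriction_in// fF//; exact: usphere_unit_axis.
have psiN : psi (- p.1, p.2) = (F (p.2 +i* p.1)%C).1 - e1 * (F (p.2 +i* p.1)%C).2.
  have DN := (plane_domainN D_conj p).2 Dp.
  rewrite slice_restriction_in// fF//; last exact: usphere_unit_axis.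
  by rewrite -s1 -mulrN -s2.
rewrite fF// /stem1 /stem2 psiE psiN.
set X := (F _).1; set Y := (F _).2.
have Y1 : e1 * (e1 * Y) = - Y.
  by rewrite mulrA cl_vec_usphere_sqr ?mulN1r//; exact: usphere_unit_axis.
congr (_ + _ * _).
  rewrite -scalerAl mul1r; move: (e1 * Y) => Z.
  by apply/ffunP => A; rewrite !ffunE /GRing.scale/=; field.
rewrite -!scalerAl scaleN1r mul1r.
have -> : X + e1 * Y + - (X - e1 * Y) = e1 * Y + e1 * Y.
  by move: (e1 * Y) => Z; apply/ffunP => A; rewrite !ffunE /GRing.scale/=; ring.
rewrite mulrDr Y1.
by apply/ffunP => A; rewrite !ffunE /GRing.scale/=; field.
Qed.

Lemma slice_functionE (x : 'rV[R]_m.+1) : axial m D x ->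
  f x = stem1 (enorm (vec x), sc x) + cl_dir (vec x) * stem2 (enorm (vec x), sc x).
Proof.
move=> Wx; have Dx := (axialP D_conj Omega_off x).1 Wx.
have x0 : enorm (vec x) != 0 by rewrite enorm_eq0; exact: Omega_off.
have xJ : vec x = enorm (vec x) *: ((enorm (vec x))^-1 *: vec x).
  by rewrite scalerA mulfV// scale1r.
have J1 : usphere ((enorm (vec x))^-1 *: vec x).
  by apply: usphere_normalize; exact: Omega_off.
rewrite {1}(slice_point_eta xJ) (slice_stemE (p := (enorm (vec x), sc x)))//.
by rewrite /cl_dir cl_vecZ.
Qed.

End StemComponents.

(** * The transform as a potential on a slice *)

Section TeodorescuPotential.
Context {R : realType} {n : nat}.
Local Notation m := n.+1.
Local Notation RT := (measurableTypeR R).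
Local Notation Cl := (clifford R m).
Local Notation tupleR k := (k.-tuple RT).
Implicit Types (p : R * R) (t : tupleR m.+1).

Variables (D : set R[i]) (f : 'rV[R]_m.+1 -> Cl).
Hypothesis D_open : open (D : set R[i]^o).
Hypothesis D_conj : conj_invariant D.
Hypothesis Omega_off : axial m D `<=` @off_axis R m.
Hypothesis Omega_bounded : bounded_set (axial m D).
Hypothesis f_C1 : C1_closure (axial m D) f.
Hypothesis f_slice : slice_function D f.

Local Notation W := ((@row_of_tuple R m.+1) @^-1` axial m D).
Local Notation F1 := (stem1 D f).
Local Notation F2 := (stem2 D f).

Lemma sc_row_of_tuple t : sc (row_of_tuple t) = tsc t.
Proof. by rewrite /sc mxE. Qed.

Lemma vec_row_of_tuple t : vec (row_of_tuple t) = tvec t.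
Proof.
apply/rowP => i; rewrite !mxE (tnth_nth 0) [RHS](tnth_nth 0) /= nth_behead.
by rewrite /bump/= add1n.
Qed.

Lemma axial_row_of_tuple t : axial m D (row_of_tuple t) <-> plane_domain D (trad t, tsc t).
Proof. by rewrite -sc_row_of_tuple /trad /tnorm -/(tvec t) -vec_row_of_tuple; exact: axialP. Qed.

Lemma measurable_axial_preimage : measurable W.
Proof.
have -> : W = (fun t => (trad t, tsc t) : RT * RT) @^-1` plane_domain D.
  by apply/seteqP; split => t /axial_row_of_tuple.
rewrite -[X in measurable X]setTI; apply: measurable_tpair => //.
exact: measurable_plane_open (plane_open_domain D_open).
Qed.

Variables (q : 'rV[R]_m.+1) (q0 : vec q != 0).

Lemma teodorescu_integrandE t : W t ->
  teodorescu_kernel q (row_of_tuple t) * f (row_of_tuple t) = axial_integrand q F1 F2 t.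
Proof.
move=> Wt; rewrite /teodorescu_kernel -scalerAl /axial_integrand.
rewrite slice_cauchy_kernelE//; last exact: Omega_off.
rewrite (slice_functionE D_conj Omega_off f_slice)// vec_row_of_tuple sc_row_of_tuple.
by rewrite mulNr.
Qed.

(** This is what makes integration over the domain the same as over the whole space. *)
Lemma axial_integrand_out t : ~ W t -> axial_integrand q F1 F2 t = 0.
Proof.
move=> Wt; have /(stem_out f D_conj)[h1 h2] : ~ plane_domain D (trad t, tsc t).
  by move=> /axial_row_of_tuple.
by rewrite /axial_integrand h1 h2 !(mulr0, addr0) oppr0 scaler0.
Qed.

Lemma teodorescu_integrable : cl_integrable (axial m D) (fun x => teodorescu_kernel q x * f x).
Proof.
move=> A; have [r [M [/ltW r0 M0 d1 d2]]] := cl_density_stem D_open Omega_bounded f_C1.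
have iT := integrable_axial_integrand q r0 M0 d1 d2 A.
have := integrableS measurableT measurable_axial_preimage (@subsetT _ _) iT.
apply: eq_integrable; first exact: measurable_axial_preimage.
by move=> t; rewrite inE => Wt; rewrite teodorescu_integrandE.
Qed.

(** Up to the constant, the product of (kre - I kim) with F1 + I F2, integrated
    over the plane.  It holds at every q off the axis, in the domain or not. *)
Lemma teodorescuE : teodorescu (axial m D) f q =
  (2 * pi)^-1 *: (cl_pot kre F1 (enorm (vec q), sc q) + cl_pot kim F2 (enorm (vec q), sc q) +
    cl_dir (vec q) * (cl_pot kre F2 (enorm (vec q), sc q) - cl_pot kim F1 (enorm (vec q), sc q))).
Proof.
have [r [M [/ltW r0 M0 d1 d2]]] := cl_density_stem D_open Omega_bounded f_C1.
rewrite /teodorescu; set X := cl_integral _ _; set Y := (X in _ = _ *: X).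
suff -> : X = - Y by rewrite scalerN scaleNr opprK.
apply/ffunP => A; rewrite ffunE [RHS]ffunE /volume_integral.
transitivity (\int[lebesgue_tuple R m.+1]_t axial_integrand q F1 F2 t A).
  rewrite [LHS]Rintegral_mkcond; apply: eq_Rintegral => t _; rewrite patchE.
  case: ifPn => [|]; first by rewrite inE => Wt; rewrite teodorescu_integrandE.
  by move/negP; rewrite inE => Wt; rewrite axial_integrand_out// ffunE.
have s1 u : F1 (0, u) = 0 /\ F2 (0, u) = 0.
  exact: (stem_out f D_conj (plane_domain_off Omega_off (u := u))).
rewrite (integral_axial_integrandE q r0 M0 d1 d2 (stem1_even D f) (stem2_odd D f)
  (fun u => (s1 u).1) (fun u => (s1 u).2)).
congr (- _); rewrite /Y mulrBr.
rewrite !ffunE; ring.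
Qed.

End TeodorescuPotential.

(** * The slice operator on functions U + I V *)

Section CliffordDerivative.
Context {R : realType} {m : nat}.
Local Notation Cl := (clifford R m).
Implicit Types (X Y : R -> Cl) (dX dY Z : Cl) (s : R).

Lemma is_derive_big (I : Type) (r : seq I) (h : I -> R -> R) (dh : I -> R) s :
  (forall i, is_derive s 1 (h i) (dh i)) ->
  is_derive s 1 (fun t => \sum_(i <- r) h i t) (\sum_(i <- r) dh i).
Proof.
move=> hd; elim: r => [|i r IH].
  by under eq_fun do rewrite big_nil; rewrite big_nil; exact: is_derive_cst.
by under eq_fun do rewrite big_cons; rewrite big_cons; exact: is_deriveD.
Qed.

(** Componentwise, like the partial derivatives in the definition of the slice operator. *)
Definition cl_derive s X dX : Prop := forall A, is_derive s 1 (fun t => X t A) (dX A).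

Lemma cl_derive_cst s Z : cl_derive s (cst Z) 0.
Proof. by move=> A; rewrite ffunE; exact: is_derive_cst. Qed.

Lemma cl_deriveD s X Y dX dY : cl_derive s X dX -> cl_derive s Y dY ->
  cl_derive s (fun t => X t + Y t) (dX + dY).
Proof.
move=> hX hY A; under eq_fun do rewrite ffunE; rewrite ffunE.
exact: (is_deriveD (hX A) (hY A)).
Qed.

Lemma cl_deriveZ s (k : R -> R) (dk : R) X dX : is_derive s 1 k dk -> cl_derive s X dX ->
  cl_derive s (fun t => k t *: X t) (dk *: X s + k s *: dX).
Proof.
move=> hk hX A; under eq_fun do rewrite ffunE; rewrite !ffunE.
by have := is_deriveM hk (hX A); rewrite /GRing.scale/= addrC [_ * dk]mulrC.
Qed.

Lemma cl_deriveM s X Y dX dY : cl_derive s X dX -> cl_derive s Y dY ->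
  cl_derive s (fun t => X t * Y t) (dX * Y s + X s * dY).
Proof.
move=> hX hY A; under eq_fun do rewrite cl_mulE; rewrite ffunE !cl_mulE -big_split/=.
apply: is_derive_big => B; rewrite -mulrDr.
have hM := is_deriveM (hX B) (hY (symd B A)).
have := is_deriveZ ((-1) ^+ clsign B (symd B A)) hM.
by rewrite /GRing.scale/= addrC [_ * dX B]mulrC.
Qed.

Lemma cl_derive_comp s (k : R -> R) (dk : R) X dX : cl_derive (k s) X dX ->
  is_derive s 1 k dk -> cl_derive s (X \o k) (dk *: dX).
Proof.
move=> hX hk A; rewrite ffunE /GRing.scale/= mulrC.
exact: (@is_derive1_comp _ (fun t => X t A) k s _ _ (hX A) hk).
Qed.

End CliffordDerivative.

Section DirectionalDerivative.
Context {R : realType}.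

Lemma is_derive_dir k (g : 'rV[R]_k -> R) (x v : 'rV[R]_k) (d : R) :
  is_derive (0 : R) 1 (fun h => g (h *: v + x)) d -> is_derive x v g d.
Proof.
have E : (fun h : R => h^-1 *: (((fun h => g (h *: v + x)) \o shift (0 : R)) (h *: (1 : R)) -
      g (0 *: v + x))) =
    (fun h : R => h^-1 *: ((g \o shift x) (h *: v) - g x)).
  by apply/funext => h /=; rewrite scale0r add0r addr0 [h *: 1]mulr1.
by case=> gd <-; apply: DeriveDef; [rewrite /derivable -E|rewrite /derive -E].
Qed.

Lemma enorm_line k (y : 'rV[R]_k) j (h : R) :
  enorm (h *: delta_mx 0 j + y) = Num.sqrt (enorm y ^+ 2 + 2 * y 0 j * h + h ^+ 2).
Proof.
congr Num.sqrt; rewrite sqr_enorm (bigD1 j)//= [in RHS](bigD1 j)//= !mxE !eqxx mulr1.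
rewrite (eq_bigr (fun i => y 0 i ^+ 2)); first by ring.
by move=> i ij; rewrite !mxE (negbTE ij) andbF mulr0 add0r.
Qed.

Lemma is_derive_enorm k (y : 'rV[R]_k) j : y != 0 ->
  is_derive (0 : R) 1 (fun h => enorm (h *: delta_mx 0 j + y)) (y 0 j / enorm y).
Proof.
rewrite -enorm_eq0 => y0; have b0 : 0 < enorm y by rewrite lt_def y0 enorm_ge0.
under eq_fun do rewrite enorm_line.
pose P (h : R) : R := enorm y ^+ 2 + 2 * y 0 j * h + h ^+ 2.
have P0 : P 0 = enorm y ^+ 2 by rewrite /P; ring.
have p0 : 0 < P 0 by rewrite P0 exprn_gt0.
have dP : is_derive (0 : R) 1 P (2 * y 0 j).
  have poly (c d : R) : is_derive (0 : R) 1 (fun h => c + d * h + h ^+ 2) d.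
    have := is_deriveD (is_deriveD (is_derive_cst c (0 : R) 1)
      (is_deriveZ d (is_derive_id (0 : R) 1))) (is_deriveX 2 (is_derive_id (0 : R) 1)).
    by rewrite /GRing.scale/= expr1 !(mulr0, mul0r) mulr1 add0r addr0.
  exact: poly.
have := is_derive1_comp (is_derive1_sqrt p0) dP.
rewrite P0 sqrtr_sqr ger0_norm ?ltW//.
by rewrite (_ : _ * _ = y 0 j / enorm y)//; field.
Qed.

Lemma enorm_delta k (j : 'I_k) (h : R) : enorm (h *: (delta_mx 0 j : 'rV[R]_k)) = `|h|.
Proof.
rewrite -[X in enorm X]addr0 enorm_line (_ : enorm 0 = 0); last by apply/eqP; rewrite enorm_eq0.
by rewrite expr0n mxE mulr0 mul0r !add0r sqrtr_sqr.
Qed.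

(** Keeps the points near q off the axis, where the form U + I V is available. *)
Lemma line_neq0 k (y : 'rV[R]_k) j (h : R) : `|h| < enorm y -> h *: delta_mx 0 j + y != 0.
Proof.
apply: contraTN => /eqP /(canRL (addKr _)); rewrite addr0 -scaleNr => ->.
by rewrite enorm_delta normrN ltxx.
Qed.

End DirectionalDerivative.

Section SliceForm.
Context {R : realType} {n : nat}.
Local Notation m := n.+1.
Local Notation Cl := (clifford R m).
Variables (T : 'rV[R]_m.+1 -> Cl) (U V : R * R -> Cl).
Hypothesis T_slice : forall x, vec x != 0 ->
  T x = U (enorm (vec x), sc x) + cl_dir (vec x) * V (enorm (vec x), sc x).
Variables (q : 'rV[R]_m.+1) (q0 : vec q != 0).
Local Notation b := (enorm (vec q)).
Local Notation a := (sc q).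
Local Notation I := (cl_dir (vec q)).
Variables (Ua Ub Va Vb : Cl).
Hypotheses (dUa : cl_derive a (fun u => U (b, u)) Ua)
           (dUb : cl_derive b (fun v => U (v, a)) Ub)
           (dVa : cl_derive a (fun u => V (b, u)) Va)
           (dVb : cl_derive b (fun v => V (v, a)) Vb).

Let b0 : 0 < b. Proof. by rewrite lt_def enorm_eq0 q0 enorm_ge0. Qed.

Lemma is_derive_sc A : is_derive q (delta_mx 0 ord0) (fun x => T x A) ((Ua + I * Va) A).
Proof.
apply: is_derive_dir.
have E h : T (h *: delta_mx 0 ord0 + q) = U (b, h + a) + I * V (b, h + a).
  have vE : vec (h *: delta_mx 0 ord0 + q) = vec q.
    by rewrite vec_lin vec_delta0 scaler0 add0r.
  by rewrite T_slice vE// sc_lin sc_delta0 mulr1.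
under eq_fun do rewrite E.
have sd : is_derive (0 : R) 1 (fun h => h + a) 1.
  have := is_deriveD (is_derive_id (0 : R) 1) (is_derive_cst a (0 : R) 1).
  by rewrite addr0.
have sa : 0 + a = a by rewrite add0r.
have dU : cl_derive 0 (fun h => U (b, h + a)) Ua.
  rewrite -[Ua]scale1r; apply: (cl_derive_comp (k := fun h => h + a) (X := fun u => U (b, u)) _ sd).
  by rewrite sa.
have dV : cl_derive 0 (fun h => V (b, h + a)) Va.
  rewrite -[Va]scale1r; apply: (cl_derive_comp (k := fun h => h + a) (X := fun u => V (b, u)) _ sd).
  by rewrite sa.
have := cl_deriveD dU (cl_deriveM (cl_derive_cst 0 I) dV).
by rewrite mul0r add0r; apply.
Qed.

Lemma cl_vec_line (h : R) j (y : 'rV[R]_m) :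
  cl_vec (h *: delta_mx 0 j + y) = h *: cl_gen R j + cl_vec y.
Proof.
transitivity (\sum_i ((h *: delta_mx 0 j : 'rV[R]_m) 0 i *: cl_gen R i + y 0 i *: cl_gen R i)).
  by apply: eq_bigr => i _; rewrite [in LHS]mxE scalerDl.
rewrite big_split/=; congr (_ + _).
rewrite (bigD1 j)//= !mxE !eqxx mulr1 big1 ?addr0// => i ij.
by rewrite !mxE (negbTE ij) andbF mulr0 scale0r.
Qed.

(** The chain rule through b, whose derivative is the j-th coordinate divided by b; the
    second term differentiates the direction. *)
Definition radial_partial (j : 'I_m) : Cl :=
  (vec q 0 j / b) *: (Ub + I * Vb) +
  (b^-1 *: cl_gen R j - (vec q 0 j / b ^+ 2) *: I) * V (b, a).

Lemma is_derive_vec j A :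
  is_derive q (delta_mx 0 (lift ord0 j)) (fun x => T x A) (radial_partial j A).
Proof.
apply: is_derive_dir.
pose B h := enorm (h *: delta_mx 0 j + vec q).
have B0 : B 0 = b by rewrite /B scale0r add0r.
have dB : is_derive (0 : R) 1 B (vec q 0 j / b) by exact: is_derive_enorm.
pose G h : Cl := U (B h, a) + ((B h)^-1 *: (h *: cl_gen R j + cl_vec (vec q))) * V (B h, a).
apply: (@near_eq_is_derive _ _ _ (fun h => G h A)).
  near=> h; congr (fun_of_fin _ A).
  have vE : vec (h *: delta_mx 0 (lift ord0 j) + q) = h *: delta_mx 0 j + vec q.
    by rewrite vec_lin vec_delta.
  rewrite T_slice vE; last first.
    apply: line_neq0; near: h.
    by exists b => // z /=; rewrite sub0r normrN.
  by rewrite sc_lin sc_delta mulr0 add0r /G -/(B h) /cl_dir -/(B h) cl_vec_line.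
have dU : cl_derive 0 (fun h => U (B h, a)) ((vec q 0 j / b) *: Ub).
  by apply: (cl_derive_comp (k := B) (X := fun v => U (v, a)) _ dB); rewrite B0.
have dV : cl_derive 0 (fun h => V (B h, a)) ((vec q 0 j / b) *: Vb).
  by apply: (cl_derive_comp (k := B) (X := fun v => V (v, a)) _ dB); rewrite B0.
have dBi : is_derive (0 : R) 1 (fun h => (B h)^-1) (- (b ^- 2) * (vec q 0 j / b)).
  have B0' : B 0 != 0 by rewrite B0 gt_eqF.
  by have := is_deriveV B0' dB; rewrite B0.
have dN : cl_derive (0 : R) (fun h => h *: cl_gen R j + cl_vec (vec q)) (cl_gen R j).
  have := cl_deriveD (cl_deriveZ (is_derive_id (0 : R) 1) (cl_derive_cst 0 (cl_gen R j)))
    (cl_derive_cst 0 (cl_vec (vec q))).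
  by rewrite scale1r scaler0 !addr0; apply.
have := cl_deriveD dU (cl_deriveM (cl_deriveZ dBi dN) dV) A.
rewrite scale0r add0r B0 (_ : _ + _ = radial_partial j); first by apply.
rewrite /radial_partial -/I.
rewrite cl_vec_dir scalerA.
rewrite (_ : _ * b = - (vec q 0 j / b ^+ 2)); last first.
  by rewrite /GRing.scale/=; field; rewrite gt_eqF.
rewrite scalerDr -addrA scaleNr [X in _ *: Ub + X]addrC; congr (_ + (_ + _ * _)).
  by rewrite -scalerAr.
by rewrite addrC.
Unshelve. all: by end_near.
Qed.

Lemma slice_has_partials : has_partials T q.
Proof.
move=> j A; case: (unliftP ord0 j) => [k|] ->.
  by have [] := is_derive_vec k A.
by have [] := is_derive_sc A.
Qed.

(** The direction is homogeneous of degree 0, so its radial derivative vanishes; what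
    remains is the Cauchy-Riemann operator of the slice, I being the imaginary unit. *)
Lemma slice_CR_slice : slice_CR T q = (Ua - Vb) + I * (Va + Ub).
Proof.
have bn : b != 0 by rewrite gt_eqF.
rewrite /slice_CR.
have -> : partial ord0 T q = Ua + I * Va.
  by apply/ffunP => A; rewrite ffunE; have [_ ->] := is_derive_sc A.
have pE j : partial (lift ord0 j) T q = radial_partial j.
  by apply/ffunP => A; rewrite ffunE; have [_ ->] := is_derive_vec j A.
under eq_bigr do rewrite pE /radial_partial scalerDr scalerA scalerAl scalerBr scalerA scalerA.
rewrite big_split/= -scaler_suml -mulr_suml sumrB -scaler_suml.
have s2 : \sum_(j < m) vec q 0 j * (vec q 0 j / b) = b.
  rewrite (eq_bigr (fun j => vec q 0 j ^+ 2 / b)); last by move=> j _; rewrite mulrA.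
  by rewrite -mulr_suml -sqr_enorm expr2 mulfK.
have s3 : \sum_(j < m) vec q 0 j * (vec q 0 j / b ^+ 2) = 1.
  rewrite (eq_bigr (fun j => vec q 0 j ^+ 2 / b ^+ 2)); last by move=> j _; rewrite mulrA.
  by rewrite -mulr_suml -sqr_enorm mulfV// expf_neq0.
have s1 : \sum_(j < m) (vec q 0 j * b^-1) *: cl_gen R j = I.
  by rewrite /cl_dir /cl_vec scaler_sumr; apply: eq_bigr => j _; rewrite scalerA mulrC.
rewrite s1 s2 s3 scale1r subrr mul0r addr0.
have -> : b ^- 2 *: cl_vec (vec q) = b^-1 *: I.
  by rewrite /cl_dir scalerA -invfM expr2.
have cancel X : (b^-1 *: I) * (b *: X) = I * X.
  by rewrite -scalerAl -scalerAr scalerA mulVf// scale1r.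
rewrite cancel mulrDr mulrA cl_dir_sqr// mulN1r mulrDr.
by apply/ffunP => A; rewrite !ffunE; ring.
Qed.

End SliceForm.

(** * The theorem *)

Section PotentialPair.
Context {R : realType} {m : nat}.
Local Notation Cl := (clifford R m).
Variables (Phi1 Phi2 : R * R -> Cl).

(** With [potential2], the components along 1 and I of the Cauchy transform of
    Phi1 + I Phi2, the product being expanded with I * I = - 1. *)
Definition potential1 p : Cl := (2 * pi)^-1 *: (cl_pot kre Phi1 p + cl_pot kim Phi2 p).
Definition potential2 p : Cl := (2 * pi)^-1 *: (cl_pot kre Phi2 p - cl_pot kim Phi1 p).

(** In both combinations the unknown parts A and B of [pot_derive] cancel, and two terms
    pi Phi add up to 2 pi Phi. *)
Lemma potential_CR r M q : 0 < r -> cl_density r M Phi1 -> cl_density r M Phi2 ->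
  (forall A, lipschitz_at (fun p => Phi1 p A) q) ->
  (forall A, lipschitz_at (fun p => Phi2 p A) q) ->
  exists Ua Ub Va Vb,
  [/\ cl_derive q.2 (fun u => potential1 (q.1, u)) Ua,
      cl_derive q.1 (fun v => potential1 (v, q.2)) Ub,
      cl_derive q.2 (fun u => potential2 (q.1, u)) Va,
      cl_derive q.1 (fun v => potential2 (v, q.2)) Vb &
      Ua - Vb = Phi1 q /\ Va + Ub = Phi2 q].
Proof.
move=> r0 d1 d2 l1 l2.
have rq : 0 < supdist q 0 + r by rewrite ltr_wpDl ?supdist_ge0.
have /choice[E1 h1] := fun A => pot_derive rq (planar_density_recenter q (d1 A)) (l1 A).
have /choice[S1 {}h1] := h1.
have /choice[E2 h2] := fun A => pot_derive rq (planar_density_recenter q (d2 A)) (l2 A).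
have /choice[S2 {}h2] := h2.
pose c : R := (2 * pi)^-1.
exists [ffun A => c * (pi * Phi1 q A - E1 A - S2 A)],
  [ffun A => c * (pi * Phi2 q A + E2 A - S1 A)],
  [ffun A => c * (pi * Phi2 q A - E2 A + S1 A)],
  [ffun A => c * (- S2 A - (pi * Phi1 q A + E1 A))].
have cp : c * (2 * pi) = 1 by rewrite mulVf// mulf_neq0// gt_eqF// pi_gt0.
have gen (k1 k2 : R) (Y : Cl) B : (k1 *: Y) B = k1 * Y B by rewrite ffunE.
split.
- move=> A; have [x1 _ _ _] := h1 A; have [_ y2 _ _] := h2 A.
  rewrite (_ : (fun _ => _) = c \*: ((fun x => pot kre (fun p => Phi1 p A) (q.1, x)) +
    (fun x => pot kim (fun p => Phi2 p A) (q.1, x)))); last first.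
    by apply/funext => u; rewrite /potential1 !ffunE.
  by have := is_deriveZ c (is_deriveD x1 y2); rewrite ffunE.
- move=> A; have [_ _ x1 _] := h1 A; have [_ _ _ y2] := h2 A.
  rewrite (_ : (fun _ => _) = c \*: ((fun x => pot kre (fun p => Phi1 p A) (x, q.2)) +
    (fun x => pot kim (fun p => Phi2 p A) (x, q.2)))); last first.
    by apply/funext => u; rewrite /potential1 !ffunE.
  have := is_deriveZ c (is_deriveD x1 y2); rewrite ffunE.
  by rewrite [- S1 A + _]addrC.
- move=> A; have [x1 _ _ _] := h2 A; have [_ y2 _ _] := h1 A.
  rewrite (_ : (fun _ => _) = c \*: ((fun x => pot kre (fun p => Phi2 p A) (q.1, x)) -
    (fun x => pot kim (fun p => Phi1 p A) (q.1, x)))); last first.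
    by apply/funext => u; rewrite /potential2 !ffunE.
  by have := is_deriveZ c (is_deriveB x1 y2); rewrite ffunE opprK.
- move=> A; have [_ _ x1 _] := h2 A; have [_ _ _ y2] := h1 A.
  rewrite (_ : (fun _ => _) = c \*: ((fun x => pot kre (fun p => Phi2 p A) (x, q.2)) -
    (fun x => pot kim (fun p => Phi1 p A) (x, q.2)))); last first.
    by apply/funext => u; rewrite /potential2 !ffunE.
  by have := is_deriveZ c (is_deriveB x1 y2); rewrite ffunE.
- split; apply/ffunP => A; rewrite !ffunE.
    by rewrite -[RHS]mul1r -cp; ring.
  by rewrite -[RHS]mul1r -cp; ring.
Qed.

End PotentialPair.

Theorem theorem3p6 (R : realType) (m : nat) (m_gt0 : (0 < m)%N)
    (D : set R[i]) (D_open : open (D : set R[i]^o))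
    (D_conj : conj_invariant D)
    (Omega_off : axial m D `<=` @off_axis R m)
    (Omega_bounded : bounded_set (axial m D))
    (Omega_connected : connected (axial m D))
    (f : 'rV[R]_m.+1 -> clifford R m)
    (f_C1 : C1_closure (axial m D) f)
    (f_slice : slice_function D f)
    (q : 'rV[R]_m.+1) (Omega_q : axial m D q) :
  [/\ cl_integrable (axial m D) (fun x => teodorescu_kernel q x * f x),
      has_partials (teodorescu (axial m D) f) q &
      slice_CR (teodorescu (axial m D) f) q = f q].
Proof.
case: m m_gt0 Omega_off Omega_bounded Omega_connected f f_C1 f_slice q Omega_q => // n _.
move=> Omega_off Omega_bounded _ f f_C1 f_slice q Omega_q.
have q0 : vec q != 0 by exact: Omega_off.
have Dq := (axialP D_conj Omega_off q).1 Omega_q.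
have [r [M [r0 M0 d1 d2]]] := cl_density_stem D_open Omega_bounded f_C1.
have lip A := stem_lipschitz D_open D_conj Omega_bounded f_C1 A Dq.
have [Ua [Ub [Va [Vb [dUa dUb dVa dVb [CR1 CR2]]]]]] :=
  potential_CR r0 d1 d2 (fun A => (lip A).1) (fun A => (lip A).2).
have TE x : vec x != 0 -> teodorescu (axial n.+1 D) f x =
    potential1 (stem1 D f) (stem2 D f) (enorm (vec x), sc x) +
    cl_dir (vec x) * potential2 (stem1 D f) (stem2 D f) (enorm (vec x), sc x).
  move=> x0; rewrite (teodorescuE D_open D_conj Omega_off Omega_bounded f_C1 f_slice x0).
  by rewrite scalerDr /potential1 /potential2 -scalerAr.
split.
- exact: teodorescu_integrable.
- exact: (slice_has_partials TE q0 dUa dUb dVa dVb).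
- rewrite (slice_CR_slice TE q0 dUa dUb dVa dVb) CR1 CR2.
  by rewrite (slice_functionE D_conj Omega_off f_slice).
Qed.
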